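(* Let $\varepsilon>0$ be given and assume $L\ge1$. Let Assumptions (A) and (B) of the context hold, and run the DEEPSTORM algorithm of the context with $\tilde{\mathbf v}_i^{(k+1)}$ any unbiased gradient estimator that satisfies either (v1) or (v2), and with $$\alpha_k=\frac{\alpha}{(k+k_0)^{1/3}},\qquad\beta_k=1-\frac{\alpha_{k+1}}{\alpha_k}+48L^2\alpha_{k+1}^2\qquad(k=0,\dots,K-1).$$ Let $\mathbf x_i^{(0)}=\mathbf x_j^{(0)}$ for all $i,j=1,\dots,N$, let the local batch size be $m=\mathcal O(1)$ for all iterations (the initial batch included), choose $k_0=\left\lceil\frac{2}{(1-\tilde\rho)^6}\right\rceil$, and perform $T_0=\left\lceil\frac{-2\ln(1-\tilde\rho)}{\sqrt{1-\rho}}\right\rceil$ Chebyshev communications for the initial gradient tracking variable $\mathbf Y^{(0)}=\mathcal W_{T_0}(\mathbf D^{(0)})$. Choose $\alpha=\frac1{64L}$. Then for all $K\ge2^{3/2}k_0$, the algorithm produces a stochastic $\varepsilon$-stationary point in $$K=\mathcal O\left(\max\left\{\frac{(L\delta)^{3/2}+\hat\sigma^3+k_0^{1/2}\sigma^3}{\varepsilon^{3/2}},\ \frac{\hat\sigma^3\left(|\ln\varepsilon|+|\ln\hat\sigma|\right)^{3/2}}{\varepsilon^{3/2}}\right\}\right)$$ local stochastic gradient computations and $T_0+T(K-1)$ neighbor communications, for any $T\ge1$, where $\delta:=\|\mathbf D^{(0)}-\bar{\mathbf D}^{(0)}\|_F^2+\phi(\bar{\mathbf x}^{(0)})-\ph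i^*$.
   Context: Problem. There are $N$ agents; vectors are rows in $\mathbb R^{1\times p}$. Agent $i$ has a smooth, possibly nonconvex function $f_i(\mathbf x)=\mathbb E_{\xi\sim\mathcal D_i}[f_i(\mathbf x;\xi)]$, and $r$ is a regularizer common to all agents. Let $\phi_i=f_i+r$, $f=\frac1N\sum_{i=1}^N f_i$, $\phi=\frac1N\sum_{i=1}^N\phi_i$. The agents minimize $\phi$ collaboratively, communicating only along the edges of a graph $\mathcal G=(\mathcal V,\mathcal E)$. Assumption (A). (i) $r$ is convex (possibly non-smooth) and admits an easily computable proximal mapping. (ii) There is $0<L<\infty$ with $\mathbb E_\xi\|\nabla f_i(\mathbf a;\xi)-\nabla f_i(\mathbf b;\xi)\|_2^2\le L^2\|\mathbf a-\mathbf b\|_2^2$ for all $\mathbf a,\mathbf b\in\mathbb R^{1\times p}$ and all $i$. (iii) There is $\sigma>0$ such that for all $\mathbf a\in\mathbb R^{1\times p}$ (and each $i$), $\mathbb E_\xi[\nabla f_i(\mathbf a;\xi)]=\nabla f_i(\mathbf a)$ and $\mathbb E\|\nabla f_i(\mathbf a;\xi)-\nabla f_i(\mathbf a)\|_2^2\le\sigma^2$. (iv) There is a constant $\phi^*$ with $-\infty<\phi^*\le\phi(\mathbf a)$ for all $\mathbf a\in\mathbb R^{1\times p}$. Assumption (B). $\mathcal G$ is connected and undirected and is represented by a mixing matrix $\mathbf W\in\mathbb R^{N\times N}$ such that: (i) $w_{ij}>0$ if $(i,j)\in\mathcal E$ and $w_{ij}=0$ otherwise; (ii) $\mathbf W=\mathbf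 W^\top$; (iii) $\mathrm{null}(\mathbf I-\mathbf W)=\mathrm{span}\{\mathbf e\}$, where $\mathbf e\in\mathbb R^N$ is the all-ones vector; (iv) the eigenvalues of $\mathbf W$ lie in $(-1,1]$ and $\rho:=\|\mathbf W-\frac1N\mathbf e\mathbf e^\top\|_2<1$. Mixing operator. $\mathcal W_T$ is a degree-$T$ polynomial in $\mathbf W$ satisfying (B)(ii)–(iv), given by Chebyshev acceleration: for an input $\mathbf B_0$, $\mathcal W_T(\mathbf B_0)=\mathbf B_T$, where $\mathbf B_1=\mathbf W\mathbf B_0$, $\mu_0=1$, $\mu_1=1/\rho$ and, for $1\le t\le T-1$, $\mu_{t+1}=\frac2\rho\mu_t-\mu_{t-1}$, $\mathbf B_{t+1}=\frac{2\mu_t}{\rho\mu_{t+1}}\mathbf W\mathbf B_t-\frac{\mu_{t-1}}{\mu_{t+1}}\mathbf B_{t-1}$. Thus $\mathcal W_1=\mathbf W$. Put $\tilde\rho:=\|\mathcal W_T-\frac1N\mathbf e\mathbf e^\top\|_2<1$. DEEPSTORM algorithm. Input: $\mathbf X^{(0)}\in\mathbb R^{N\times p}$, mixing rounds $T_0,T$, iteration number $K$, sequences $\{\alpha_k\},\{\beta_k\}$. Lower-case indexed vectors are rows of the corresponding matrices. Set $\mathbf d_i^{(0)}=\frac1{m_0}\sum_{\xi\in B_i^{(0)}}\nabla f_i(\mathbf x_i^{(0)};\xi)$ for all $i$ ($B_i^{(0)}$ a batch of $m_0$ samples) and $\mathbf Y^{(0)}=\mathcal W_{T_0}(\mathbf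 D^{(0)})$. For $k=0,\dots,K-1$: $\mathbf Z^{(k)}=\mathcal W_T(\mathbf X^{(k)})$; $\mathbf x_i^{(k+1)}=\mathrm{prox}_{\alpha_kr}(\mathbf z_i^{(k)}-\alpha_k\mathbf y_i^{(k)})$; $\mathbf d_i^{(k+1)}=(1-\beta_k)(\mathbf d_i^{(k)}+\mathbf v_i^{(k+1)}-\mathbf u_i^{(k+1)})+\beta_k\tilde{\mathbf v}_i^{(k+1)}$ with $\mathbf v_i^{(k+1)}=\frac1m\sum_{\xi\in B_i^{(k+1)}}\nabla f_i(\mathbf x_i^{(k+1)};\xi)$ and $\mathbf u_i^{(k+1)}=\frac1m\sum_{\xi\in B_i^{(k+1)}}\nabla f_i(\mathbf x_i^{(k)};\xi)$; $\mathbf Y^{(k+1)}=\mathcal W_T(\mathbf Y^{(k)}+\mathbf D^{(k+1)}-\mathbf D^{(k)})$. Here $B_i^{(k+1)}$ is a batch of $m$ samples at the current iteration; for all $k$ and all agents $i,j$, $B_i^{(k+1)}$ and $B_j^{(k+1)}$ contain independent and mutually independent random variables. Also $\mathrm{prox}_g(\mathbf v)=\arg\min_{\mathbf u}\{g(\mathbf u)+\frac12\|\mathbf u-\mathbf v\|_2^2\}$. Output: $\mathbf Z^{(\tau)}$ with $\tau$ chosen randomly from $\{0,\dots,K-1\}$ (for the diminishing step size used here, with $\mathrm{Prob}(\tau=k)$ proportional to $\alpha_k$). Estimator $\tilde{\mathbf v}_i^{(k+1)}$: an unbiased estimate of $\nabla f_i(\mathbf x_i^{(k+1)})$ such that, for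 some $\hat\sigma>0$, either (v1) it is evaluated on another set of samples $\tilde B_i^{(k+1)}$, defined analogously to $B_i^{(k+1)}$, with $\tilde B_i^{(k+1)}$ independent of $B_i^{(k+1)}$ and $\mathbb E\|\tilde{\mathbf v}_i^{(k+1)}-\nabla f_i(\mathbf x_i^{(k+1)})\|_2^2\le\hat\sigma^2$; or (v2) $\tilde{\mathbf v}_i^{(k+1)}=\mathbf v_i^{(k+1)}$ with $\mathbb E\|\mathbf v_i^{(k+1)}-\nabla f_i(\mathbf x_i^{(k+1)})\|_2^2\le\hat\sigma^2$. Notation. $\bar{\mathbf A}=\frac1N\mathbf e\mathbf e^\top\mathbf A$, $\mathbf A_\perp=\mathbf A-\bar{\mathbf A}$; $\bar{\mathbf x}^{(k)}=\frac1N\sum_i\mathbf x_i^{(k)}$. Proximal gradient mapping: $P(\mathbf x,\mathbf y,\eta)=\frac1\eta(\mathbf x-\mathrm{prox}_{\eta r}(\mathbf x-\eta\mathbf y))$. A stochastic matrix (i.e. a random matrix) $\mathbf X\in\mathbb R^{N\times p}$ with rows $\mathbf x_i$ is a stochastic $\varepsilon$-stationary point if $\mathbb E\big[\frac1N\sum_{i=1}^N\|P(\mathbf x_i,\nabla f(\mathbf x_i),\eta)\|_2^2+\frac{L^2}N\|\mathbf X_\perp\|_F^2\big]\le\varepsilon$, where $\eta>0$. *)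

(* Defs.v *)
From HB Require Import structures.
From mathcomp Require Import all_boot all_order all_algebra.
From mathcomp Require Import all_classical all_reals all_analysis.

Set Implicit Arguments.
Unset Strict Implicit.
Unset Printing Implicit Defensive.

Import Order.TTheory GRing.Theory Num.Theory.
Import numFieldNormedType.Exports.

Local Open Scope classical_set_scope.
Local Open Scope ring_scope.

(** * Euclidean, Frobenius and spectral norms

    The library norm on matrices is the sup norm, hence these definitions. *)

Definition sqnorm (R : realType) (m n : nat) (A : 'M[R]_(m, n)) : R :=
  \sum_i \sum_j A i j ^+ 2.

Definition opnorm2 (R : realType) (n : nat) (A : 'M[R]_n) : R :=
  sup [set Num.sqrt (sqnorm (A *m v)) | v in [set v : 'cV[R]_n | sqnorm v <= 1]].

(** [avgmx] is e e^T / N. *)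
Definition avgmx (R : realType) (N : nat) : 'M[R]_N := const_mx (N%:R^-1).

Definition perp (R : realType) (N p : nat) (A : 'M[R]_(N, p)) : 'M[R]_(N, p) :=
  A - avgmx R N *m A.

Definition avgrow (R : realType) (N p : nat) (A : 'M[R]_(N, p)) : 'rV[R]_p :=
  N%:R^-1 *: \sum_i row i A.

(** [grad f x] is the row of partial derivatives; it is only used for
    functions assumed differentiable. *)
Definition grad (R : realType) (p : nat) (f : 'rV[R]_p -> R) (x : 'rV[R]_p) :
    'rV[R]_p :=
  \row_j 'D_(delta_mx 0 j) f x.

(** * Proximal mapping

    The regularizer takes values in [\bar R] so that indicator functions of
    constraint sets are allowed. *)

Definition is_prox (R : realType) (p : nat) (g : 'rV[R]_p -> \bar R)
    (v u : 'rV[R]_p) : Prop :=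
  forall w, (g u + (2^-1 * sqnorm (u - v))%:E
             <= g w + (2^-1 * sqnorm (w - v))%:E)%E.

(** Below, [g] is eta * r with eta > 0 and r proper convex, so that there is at
    most one minimizer; its existence is part of the assumption on r. *)
Definition prox (R : realType) (p : nat) (g : 'rV[R]_p -> \bar R)
    (v : 'rV[R]_p) : 'rV[R]_p :=
  xget 0 [set u | is_prox g v u].

Definition scale_fun (R : realType) (p : nat) (eta : R)
    (r : 'rV[R]_p -> \bar R) : 'rV[R]_p -> \bar R :=
  fun x => (eta%:E * r x)%E.

Definition prox_grad_map (R : realType) (p : nat) (r : 'rV[R]_p -> \bar R)
    (x y : 'rV[R]_p) (eta : R) : 'rV[R]_p :=
  eta^-1 *: (x - prox (scale_fun eta r) (x - eta *: y)).

(** * The composite problem *)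

(** [pb_dist i] is the sampling distribution of agent [i], and [pb_loss i x z]
    its sample function f_i(x; z). *)
Record problem (R : realType) (N p : nat) (d : measure_display)
    (Xi : measurableType d) := Problem {
  pb_dist : 'I_N -> probability Xi R ;
  pb_loss : 'I_N -> 'rV[R]_p -> Xi -> R ;
  pb_reg : 'rV[R]_p -> \bar R
}.

Definition sgrad (R : realType) (N p : nat) (d : measure_display)
    (Xi : measurableType d) (pb : problem R N p Xi) (i : 'I_N)
    (x : 'rV[R]_p) (z : Xi) : 'rV[R]_p :=
  grad (fun y => pb_loss pb i y z) x.

Definition local_obj (R : realType) (N p : nat) (d : measure_display)
    (Xi : measurableType d) (pb : problem R N p Xi) (i : 'I_N)
    (x : 'rV[R]_p) : R :=
  fine (\int[pb_dist pb i]_z (pb_loss pb i x z)%:E).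

Definition smooth_obj (R : realType) (N p : nat) (d : measure_display)
    (Xi : measurableType d) (pb : problem R N p Xi) (x : 'rV[R]_p) : R :=
  N%:R^-1 * \sum_i local_obj pb i x.

Definition local_phi (R : realType) (N p : nat) (d : measure_display)
    (Xi : measurableType d) (pb : problem R N p Xi) (i : 'I_N)
    (x : 'rV[R]_p) : \bar R :=
  ((local_obj pb i x)%:E + pb_reg pb x)%E.

Definition phi (R : realType) (N p : nat) (d : measure_display)
    (Xi : measurableType d) (pb : problem R N p Xi) (x : 'rV[R]_p) : \bar R :=
  ((N%:R^-1)%:E * \sum_i local_phi pb i x)%E.

(** The standing meaning of f_i(x) = E f_i(x; z) with differentiable integrand
    and differentiable expectation. *)
Record well_posed (R : realType) (N p : nat) (d : measure_display)
    (Xi : measurableType d) (pb : problem R N p Xi) : Prop := {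
  loss_integrable : forall i x,
    (pb_dist pb i).-integrable setT (EFin \o pb_loss pb i x) ;
  loss_differentiable : forall i z x,
    differentiable (fun y : 'rV[R]_p => pb_loss pb i y z) x ;
  obj_differentiable : forall i x,
    differentiable (local_obj pb i : 'rV[R]_p -> R) x
}.

Record assumptionA (R : realType) (N p : nat) (d : measure_display)
    (Xi : measurableType d) (pb : problem R N p Xi) (L sigma phistar : R) :
    Prop := {
  reg_gtNy : forall x, (-oo < pb_reg pb x)%E ;
  reg_convex : forall (x y : 'rV[R]_p) (t : R), 0 <= t <= 1 ->
    (pb_reg pb (t *: x + (1 - t) *: y)
     <= t%:E * pb_reg pb x + (1 - t)%:E * pb_reg pb y)%E ;
  reg_prox : forall (eta : R) (v : 'rV[R]_p), 0 < eta ->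
    exists u, is_prox (scale_fun eta (pb_reg pb)) v u ;
  L_gt0 : 0 < L ;
  mean_square_smooth : forall i (a b : 'rV[R]_p),
    (\int[pb_dist pb i]_z (sqnorm (sgrad pb i a z - sgrad pb i b z))%:E
     <= (L ^+ 2 * sqnorm (a - b))%:E)%E ;
  sigma_gt0 : 0 < sigma ;
  sgrad_unbiased : forall i (a : 'rV[R]_p) j,
    (pb_dist pb i).-integrable setT (fun z => (sgrad pb i a z 0 j)%:E) /\
    (\int[pb_dist pb i]_z (sgrad pb i a z 0 j)%:E
     = (grad (local_obj pb i) a 0 j)%:E)%E ;
  sgrad_variance : forall i (a : 'rV[R]_p),
    (\int[pb_dist pb i]_z
        (sqnorm (sgrad pb i a z - grad (local_obj pb i) a))%:E
     <= (sigma ^+ 2)%:E)%E ;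
  phistar_le : forall a, (phistar%:E <= phi pb a)%E
}.

(** * Network and Chebyshev mixing *)

Definition rho_of (R : realType) (N : nat) (W : 'M[R]_N) : R :=
  opnorm2 (W - avgmx R N).

(** The edge relation may or may not contain the loops (i, i). *)
Record assumptionB (R : realType) (N : nat) (edge : rel 'I_N) (W : 'M[R]_N) :
    Prop := {
  edge_sym : symmetric edge ;
  edge_connected : forall i j, connect edge i j ;
  W_edge : forall i j, edge i j -> 0 < W i j ;
  W_nonedge : forall i j, ~~ edge i j -> W i j = 0 ;
  W_sym : W = W^T ;
  W_null : forall v : 'cV[R]_N,
    (1%:M - W) *m v = 0 <-> exists c : R, v = c *: const_mx 1 ;
  W_eigen : forall a : R, eigenvalue W a -> -1 < a <= 1 ;
  W_rho : rho_of W < 1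
}.

Fixpoint cheb_mu (R : realType) (rho : R) (t : nat) : R :=
  if t is t1.+1 then
    if t1 is t2.+1 then 2 / rho * cheb_mu rho t1 - cheb_mu rho t2
    else rho^-1
  else 1.

Fixpoint cheb (R : realType) (N q : nat) (W : 'M[R]_N) (B0 : 'M[R]_(N, q))
    (t : nat) : 'M[R]_(N, q) :=
  let rho := rho_of W in
  let mu := cheb_mu rho in
  if t is t1.+1 then
    if t1 is t2.+1 then
      (2 * mu t1 / (rho * mu t)) *: (W *m cheb W B0 t1)
      - (mu t2 / mu t) *: cheb W B0 t2
    else W *m B0
  else B0.

(** W_T as an N x N matrix, and the associated contraction factor. *)
Definition chebmx (R : realType) (N : nat) (W : 'M[R]_N) (T : nat) : 'M[R]_N :=
  cheb W 1%:M T.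

Definition rhot (R : realType) (N : nat) (W : 'M[R]_N) (T : nat) : R :=
  opnorm2 (chebmx W T - avgmx R N).

(** * Samples and randomness *)

(** [(b, k, i, s)] is the [s]-th sample of agent [i] at iteration [k]: in the
    batch B_i^(k) if [b = false], in the additional batch of the first
    estimator option if [b = true]. *)
Definition sample_idx (N : nat) : Type := (bool * nat * 'I_N * nat)%type.

(** The two admissible options for the momentum estimator: fresh samples, or
    reuse of v_i^(k+1). *)
Inductive estimator_kind := FreshSamples | SameSamples.

Definition is_fresh (e : estimator_kind) : bool :=
  if e is FreshSamples then true else false.

(** Samples drawn in a run of [K] iterations with batch size [m]. *)
Definition drawn (N : nat) (e : estimator_kind) (m K : nat)
    (j : sample_idx N) : bool :=
  let: (b, k, _, s) := j in
  [&& (k <= K)%N, (s < m)%N & b ==> (is_fresh e && (0 < k)%N)].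

Definition iter_of (N : nat) (j : sample_idx N) : nat := j.1.1.2.
Definition agent_of (N : nat) (j : sample_idx N) : 'I_N := j.1.2.
Definition is_tilde (N : nat) (j : sample_idx N) : bool := j.1.1.1.

(** Mutual independence of the classes of events [S j], [j] ranging over the
    indices satisfying [U]: product rule over all finite subfamilies. *)
Definition mutually_independent (R : realType) (d : measure_display)
    (Om : measurableType d) (P : probability Om R) (I : eqType) (U : pred I)
    (S : I -> set (set Om)) : Prop :=
  forall (J : seq I) (A : I -> set Om), uniq J -> all U J ->
    (forall j, j \in J -> S j (A j)) ->
    P (\bigcap_(j in [set j | j \in J]) A j) = (\prod_(j <- J) P (A j))%E.

Definition events_of (d d' : measure_display) (Om : measurableType d)
    (E : measurableType d') (X : Om -> E) : set (set Om) :=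
  preimage_set_system setT X measurable.

(** The index [None] stands for the output index [tau]. *)
Definition events (N : nat) (d d' : measure_display) (Om : measurableType d)
    (Xi : measurableType d') (xi : sample_idx N -> Om -> Xi) (tau : Om -> nat)
    (o : option (sample_idx N)) : set (set Om) :=
  if o is Some j then events_of (xi j) else events_of tau.

Record sampling (R : realType) (N : nat) (d d' : measure_display)
    (Om : measurableType d) (P : probability Om R) (Xi : measurableType d')
    (D : 'I_N -> probability Xi R) (e : estimator_kind) (m K : nat)
    (alpha : nat -> R) (xi : sample_idx N -> Om -> Xi) (tau : Om -> nat) :
    Prop := {
  sample_measurable : forall j, drawn e m K j -> measurable_fun setT (xi j) ;
  sample_law : forall j (B : set Xi), drawn e m K j -> measurable B ->
    P (xi j @^-1` B) = D (agent_of j) B ;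
  tau_measurable : measurable_fun setT tau ;
  tau_law : forall k, (k < K)%N ->
    P (tau @^-1` [set k]) = (alpha k / \sum_(l < K) alpha l)%:E ;
  all_independent : mutually_independent P
    (fun o => if o is Some j then drawn e m K j else true) (events xi tau)
}.

(** * The algorithm *)

Record inputs (R : realType) (N p : nat) (d d' : measure_display)
    (Xi : measurableType d) (Om : measurableType d') := Inputs {
  in_pb : problem R N p Xi ;
  in_W : 'M[R]_N ;
  in_T0 : nat ;
  in_T : nat ;
  in_m0 : nat ;
  in_m : nat ;
  in_alpha : nat -> R ;
  in_beta : nat -> R ;
  in_X0 : 'M[R]_(N, p) ;
  in_xi : sample_idx N -> Om -> Xi ;
  in_kind : estimator_kind ;
  in_vt : nat -> 'I_N -> Om -> 'rV[R]_p  (* estimators, by iteration *)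
}.

(** Besides the matrices, a state records the number of communication rounds
    used so far, and the number of sample gradients evaluated so far by each
    agent. *)
Record state (R : realType) (N p : nat) := State {
  stX : 'M[R]_(N, p) ;
  stD : 'M[R]_(N, p) ;
  stY : 'M[R]_(N, p) ;
  stZ : 'M[R]_(N, p) ;
  st_rounds : nat ;
  st_grads : nat
}.

Section Algorithm.
Context (R : realType) (N p : nat) (d d' : measure_display)
  (Xi : measurableType d) (Om : measurableType d').
Implicit Type A : inputs R N p Xi Om.

(** Average over the batch B_i^(k), of size [m], of the sample gradients at
    [x]. *)
Definition batch_grad A (m k : nat) (i : 'I_N) (x : 'rV[R]_p) (w : Om) :
    'rV[R]_p :=
  m%:R^-1 *: \sum_(s < m)
    sgrad (in_pb A) i x (in_xi A (false, k, i, nat_of_ord s) w).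

(** No round is charged for W_T(X^(0)): the theorem starts from identical
    rows, which W_T leaves unchanged. *)
Definition init A (w : Om) : state R N p :=
  let D0 := \matrix_(i < N) batch_grad A (in_m0 A) 0 i (row i (in_X0 A)) w in
  {| stX := in_X0 A ;
     stD := D0 ;
     stY := cheb (in_W A) D0 (in_T0 A) ;
     stZ := cheb (in_W A) (in_X0 A) (in_T A) ;
     st_rounds := in_T0 A ;
     st_grads := in_m0 A |}.

(** The passage from iteration [k] to [k + 1]. The matrices X^(k+1) and
    Y^(k) + D^(k+1) - D^(k) are mixed in the same [in_T A] rounds. *)
Definition step A (w : Om) (k : nat) (s : state R N p) : state R N p :=
  let X' := \matrix_(i < N)
    prox (scale_fun (in_alpha A k) (pb_reg (in_pb A)))
         (row i (stZ s) - in_alpha A k *: row i (stY s)) in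
  let D' := \matrix_(i < N)
    ((1 - in_beta A k) *:
       (row i (stD s) + batch_grad A (in_m A) k.+1 i (row i X') w
                      - batch_grad A (in_m A) k.+1 i (row i (stX s)) w)
     + in_beta A k *: in_vt A k.+1 i w) in
  {| stX := X' ;
     stD := D' ;
     stY := cheb (in_W A) (stY s + D' - stD s) (in_T A) ;
     stZ := cheb (in_W A) X' (in_T A) ;
     st_rounds := (st_rounds s + in_T A)%N ;
     st_grads := (st_grads s + 2 * in_m A
                  + (if in_kind A is FreshSamples then in_m A else 0))%N |}.

Fixpoint run A (w : Om) (k : nat) : state R N p :=
  if k is k'.+1 then step A w k' (run A w k') else init A w.

(** ** The momentum estimator *)

(** sigma-algebra of all samples drawn up to iteration [k]. *)
Definition past A (K k : nat) : set (set Om) :=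
  <<s \bigcup_(j in [set j | drawn (in_kind A) (in_m A) K j
                             /\ (iter_of j <= k)%N]) events_of (in_xi A j) >>.

(** The same with, in addition, the fresh batch of agent [i] at iteration
    [k + 1]. *)
Definition past_fresh A (K k : nat) (i : 'I_N) : set (set Om) :=
  <<s \bigcup_(j in [set j | drawn (in_kind A) (in_m A) K j
        /\ ((iter_of j <= k)%N \/
            [/\ is_tilde j, iter_of j = k.+1 & agent_of j = i])])
      events_of (in_xi A j) >>.

(** The target of the estimator at iteration [k + 1]. *)
Definition true_grad A (k : nat) (i : 'I_N) (w : Om) : 'rV[R]_p :=
  grad (local_obj (in_pb A) i) (row i (stX (run A w k.+1))).

(** Unbiasedness is conditional on the past, since x_i^(k+1) is random: the
    conditional expectation of the estimator given the past is the local
    gradient at x_i^(k+1). *)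
Definition est_unbiased A (P : probability Om R) (K : nat) : Prop :=
  forall (k : nat) (i : 'I_N) (j : 'I_p), (k < K)%N ->
    P.-integrable setT (fun w => (in_vt A k.+1 i w 0 j)%:E) /\
    (forall F : set Om, past A K k F ->
       (\int[P]_(w in F) (in_vt A k.+1 i w 0 j)%:E
        = \int[P]_(w in F) (true_grad A k i w 0 j)%:E)%E).

Definition est_variance A (P : probability Om R) (K : nat) (hsigma : R) :
    Prop :=
  forall (k : nat) (i : 'I_N), (k < K)%N ->
    (\int[P]_w (sqnorm (in_vt A k.+1 i w - true_grad A k i w))%:E
     <= (hsigma ^+ 2)%:E)%E.

Definition est_option A (K : nat) : Prop :=
  match in_kind A with
  | FreshSamples =>
      forall (k : nat) (i : 'I_N) (j : 'I_p) (B : set R), (k < K)%N ->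
        measurable B ->
        past_fresh A K k i ((fun w => in_vt A k.+1 i w 0 j) @^-1` B)
  | SameSamples =>
      forall (k : nat) (i : 'I_N) (w : Om), (k < K)%N ->
        in_vt A k.+1 i w
        = batch_grad A (in_m A) k.+1 i (row i (stX (run A w k.+1))) w
  end.

(** ** Stationarity *)

Definition stationarity (pb : problem R N p Xi) (L : R) (X : 'M[R]_(N, p))
    (eta : R) : R :=
  N%:R^-1 * (\sum_i sqnorm (prox_grad_map (pb_reg pb) (row i X)
                              (grad (smooth_obj pb) (row i X)) eta))
  + L ^+ 2 / N%:R * sqnorm (perp X).

(** The parameter [eta] may be random, so that it can be the step size
    attached to a random output index. *)
Definition stochastic_stationary (P : probability Om R)
    (pb : problem R N p Xi) (L eps : R) (X : Om -> 'M[R]_(N, p))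
    (eta : Om -> R) : Prop :=
  (forall w, 0 < eta w) /\
  (\int[P]_w (stationarity pb L (X w) (eta w))%:E <= eps%:E)%E.

(** D^(0) is random; its consensus error enters through its expectation. *)
Definition delta A (P : probability Om R) (phistar : R) : \bar R :=
  (\int[P]_w (sqnorm (perp (stD (init A w))))%:E
   + phi (in_pb A) (avgrow (in_X0 A)) - phistar%:E)%E.

End Algorithm.

(** * Parameter choices *)

Section StepSizes.
Context (R : realType).

Definition k0_of (rt : R) : nat := `|Num.ceil (2 / (1 - rt) ^+ 6)|%N.

Definition T0_of (rho rt : R) : nat :=
  `|Num.ceil (- 2 * ln (1 - rt) / Num.sqrt (1 - rho))|%N.

Definition alpha_of (L : R) (k0 k : nat) : R :=
  (64 * L)^-1 / ((k + k0)%:R `^ (3^-1)).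

Definition beta_of (L : R) (k0 k : nat) : R :=
  1 - alpha_of L k0 k.+1 / alpha_of L k0 k
  + 48 * L ^+ 2 * alpha_of L k0 k.+1 ^+ 2.

Definition complexity (L dlt sigma hsigma eps : R) (k0 : nat) : R :=
  Num.max
    (((L * dlt) `^ (3 / 2) + hsigma ^+ 3 + k0%:R `^ (2^-1) * sigma ^+ 3)
       / eps `^ (3 / 2))
    (hsigma ^+ 3 * (`|ln eps| + `|ln hsigma|) `^ (3 / 2) / eps `^ (3 / 2)).

End StepSizes.

(* Main.v *)
Require Import Defs.
From HB Require Import structures.
From mathcomp Require Import all_boot all_order all_algebra.
From mathcomp Require Import all_classical all_reals all_analysis.
From mathcomp Require Import measurable_realfun ring lra.

Set Implicit Arguments.
Unset Strict Implicit.
Unset Printing Implicit Defensive.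

Import Order.TTheory GRing.Theory Num.Theory.
Import numFieldNormedType.Exports.

Local Open Scope classical_set_scope.
Local Open Scope ring_scope.

(** The network iterates are tracked at iteration k through the four errors
    x = |X_perp|^2 / N, y = |Y_perp|^2 / N, De = |xbar' - xbar|^2 and
    e = sum_i |d_i - grad f_i(x_i)|^2 / N. With
    q = 1 - rt and a = alpha_k, mixing and nonexpansiveness of prox give
    x' <= (1 - q) x + a^2 y / q and y' <= (1 - q) y + |D' - D|^2 / (N q), while
    the unbiasedness of the samples given the past gives
    E e' <= (1 - beta)^2 E e + 2 L^2 E |X' - X|^2 / N + 2 beta^2 hsigma^2.
    Hence U = 3 x / (a q) + 6 a y / q^3 + e / (8 a L^2) decreases up to De and
    noise; the choice of beta makes the weight of e lose 6 a. Adding the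
    telescoped descent inequality for phi(xbar), which dominates De / a, bounds
    the weighted sum of all four errors, hence that of the stationarity
    measures, by L delta + k0^(1/3) sigma^2 + hsigma^2 (1 + ln K), to be
    compared with the sum of the alpha_k, of order K^(2/3) / L. *)

(** * Linear algebra *)

(** The powers of q in U are forced: the contraction of the x-term releases x / a, free of q; the
    inflow of y into it costs a y / q^2, which the weight a / q^3 returns at rate q. The increments
    of the gradients then enter with a L^2 / q^4, to be small against 1 / a: hence [k0] of order
    q^-6, so that a L <= q^2 / 64. The same size of [k0] keeps 1 / a from growing faster than the
    consensus errors contract. The initial weight a / q^3 of Y_perp is paid by the [T0] rounds,
    which give a factor q^4. Samples are evaluated at random points. X^(k+1) is determined by the
    samples up to k, so the batch k + 1 is integrated with both points frozen. The joint
    measurability this requires is not assumed; it is derived from the differentiability of the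
    loss. The stationarity measure and phi(xbar) are not shown measurable: the former is bounded by
    an adapted majorant, the latter enters through a pathwise inequality only. Chebyshev polynomials
    of W are bounded without diagonalization, by an energy identity and degree doubling. *)

Section InnerProduct.
Context (R : realType).

Definition ip (m n : nat) (A B : 'M[R]_(m, n)) : R :=
  \sum_i \sum_j A i j * B i j.

Section Fixed.
Context (m n : nat).
Implicit Types A B C : 'M[R]_(m, n).

Lemma ipC A B : ip A B = ip B A.
Proof. by apply: eq_bigr => i _; apply: eq_bigr => j _; rewrite mulrC. Qed.

Lemma ipDl A B C : ip (A + B) C = ip A C + ip B C.
Proof.
rewrite /ip -big_split; apply: eq_bigr => i _; rewrite -big_split.
by apply: eq_bigr => j _; rewrite mxE mulrDl.
Qed.

Lemma ipZl a A B : ip (a *: A) B = a * ip A B.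
Proof.
rewrite /ip mulr_sumr; apply: eq_bigr => i _; rewrite mulr_sumr.
by apply: eq_bigr => j _; rewrite mxE mulrA.
Qed.

Lemma ipNl A B : ip (- A) B = - ip A B.
Proof. by rewrite -scaleN1r ipZl mulN1r. Qed.

Lemma ipBl A B C : ip (A - B) C = ip A C - ip B C.
Proof. by rewrite ipDl ipNl. Qed.

Lemma ipDr A B C : ip C (A + B) = ip C A + ip C B.
Proof. by rewrite ipC ipDl !(ipC C). Qed.

Lemma ipZr a A B : ip A (a *: B) = a * ip A B.
Proof. by rewrite ipC ipZl ipC. Qed.

Lemma ipNr A B : ip A (- B) = - ip A B.
Proof. by rewrite ipC ipNl ipC. Qed.

Definition ip_lin := (ipDl, ipDr, ipNl, ipNr, ipZl, ipZr).

Lemma ip0l A : ip 0 A = 0.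
Proof. by rewrite -(scale0r A) ipZl mul0r. Qed.

Lemma ip_suml I (r : seq I) (F : I -> 'M[R]_(m, n)) B :
  ip (\sum_(i <- r) F i) B = \sum_(i <- r) ip (F i) B.
Proof.
elim: r => [|i r IH]; first by rewrite !big_nil ip0l.
by rewrite !big_cons ipDl IH.
Qed.

Lemma ip_self A : ip A A = sqnorm A.
Proof. by apply: eq_bigr => i _; apply: eq_bigr => j _; rewrite expr2. Qed.

Lemma sqnorm_ge0 A : 0 <= sqnorm A.
Proof. by apply: sumr_ge0 => i _; apply: sumr_ge0 => j _; exact: sqr_ge0. Qed.

Lemma sqnorm_entry A i j : A i j ^+ 2 <= sqnorm A.
Proof.
rewrite /sqnorm (bigD1 i)//= (bigD1 j)//= -addrA lerDl addr_ge0//.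
- by apply: sumr_ge0 => ? _; exact: sqr_ge0.
- by apply: sumr_ge0 => ? _; apply: sumr_ge0 => ? _; exact: sqr_ge0.
Qed.

Lemma sqnormZ a A : sqnorm (a *: A) = a ^+ 2 * sqnorm A.
Proof. by rewrite -!ip_self ipZl ipZr mulrA. Qed.

Lemma sqnormN A : sqnorm (- A) = sqnorm A.
Proof. by rewrite -scaleN1r sqnormZ sqrrN expr1n mul1r. Qed.

Lemma sqnorm0 : sqnorm (0 : 'M[R]_(m, n)) = 0.
Proof. by rewrite -ip_self ip0l. Qed.

Lemma sqnorm_eq0 A : sqnorm A = 0 -> A = 0.
Proof.
move=> A0; apply/matrixP => i j; rewrite mxE; apply/eqP.
rewrite -sqrf_eq0 eq_le sqr_ge0 andbT -A0; exact: sqnorm_entry.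
Qed.

Lemma sqnormD A B : sqnorm (A + B) = sqnorm A + 2 * ip A B + sqnorm B.
Proof. by rewrite -!ip_self !ip_lin (ipC B A); ring. Qed.

Lemma sqnormB A B : sqnorm (A - B) = sqnorm A - 2 * ip A B + sqnorm B.
Proof. by rewrite -!ip_self !ip_lin (ipC B A); ring. Qed.

Lemma sqnormBC A B : sqnorm (A - B) = sqnorm (B - A).
Proof. by rewrite -sqnormN opprB. Qed.

(** Complete the square: the gap is t |A - B / t|^2. *)
Lemma ip_young (t : R) A B : 0 < t ->
  2 * ip A B <= t * sqnorm A + t^-1 * sqnorm B.
Proof.
move=> t0; rewrite -subr_ge0.
have -> : t * sqnorm A + t^-1 * sqnorm B - 2 * ip A B
        = t * sqnorm (A - t^-1 *: B).
  rewrite sqnormB sqnormZ ipZr; field; exact: lt0r_neq0.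
by rewrite mulr_ge0 ?sqnorm_ge0 ?ltW.
Qed.

Lemma ip_young1 A B : 2 * ip A B <= sqnorm A + sqnorm B.
Proof. by have := @ip_young 1 A B ltr01; rewrite invr1 !mul1r. Qed.

(** Expand the squared norm of |B|^2 A - <A, B> B, a multiple of the part of A orthogonal to B. *)
Lemma cauchy_schwarz A B : ip A B ^+ 2 <= sqnorm A * sqnorm B.
Proof.
have [B0|B0] := eqVneq (sqnorm B) 0.
  by rewrite (sqnorm_eq0 B0) ipC ip0l expr2 mul0r mulr_ge0 ?sqnorm_ge0.
have Bp : 0 < sqnorm B by rewrite lt_def B0 sqnorm_ge0.
have := sqnorm_ge0 (sqnorm B *: A - ip A B *: B).
rewrite sqnormB !sqnormZ ipZl ipZr.
have -> : sqnorm B ^+ 2 * sqnorm A - 2 * (sqnorm B * (ip A B * ip A B))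
   + ip A B ^+ 2 * sqnorm B = sqnorm B * (sqnorm A * sqnorm B - ip A B ^+ 2).
  by ring.
by rewrite pmulr_rge0// subr_ge0.
Qed.

Lemma sqnormD_le A B : sqnorm (A + B) <= 2 * sqnorm A + 2 * sqnorm B.
Proof. have := ip_young1 A B; rewrite sqnormD; lra. Qed.

(** The gap is the mean squared deviation of the [F s] from their mean. *)
Lemma sqnorm_mean k (F : 'I_k -> 'M[R]_(m, n)) : (0 < k)%N ->
  sqnorm (k%:R^-1 *: \sum_s F s) <= k%:R^-1 * \sum_s sqnorm (F s).
Proof.
move=> k0; set M := _ *: _.
have kR : k%:R != 0 :> R by rewrite pnatr_eq0 -lt0n.
have sM : \sum_s F s = k%:R *: M by rewrite scalerA divff// scale1r.
have : 0 <= \sum_s sqnorm (F s - M).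
  by apply: sumr_ge0 => s _; exact: sqnorm_ge0.
under eq_bigr do rewrite sqnormB.
rewrite big_split/= sumrB -mulr_sumr -ip_suml sM ipZl ip_self sumr_const.
rewrite card_ord => H.
rewrite mulrC ler_pdivlMr ?ltr0n// -subr_ge0; move: H; congr (0 <= _).
by rewrite -[sqnorm M *+ k]mulr_natr; ring.
Qed.

(* The weights are those for which (r |A| + |B|)^2 contracts A by r < 1. *)
Lemma sqnorm_contract (r : R) A B : 0 <= r < 1 ->
  sqnorm (r *: A + B) <= r * sqnorm A + (1 - r)^-1 * sqnorm B.
Proof.
move=> /andP[r0 r1]; have q0 : 0 < 1 - r by rewrite subr_gt0.
rewrite sqnormD sqnormZ ipZl.
have e : r * (1 - r)^-1 = (1 - r)^-1 - 1 by field; exact: lt0r_neq0.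
have := ler_wpM2l r0 (@ip_young (1 - r) A B q0).
rewrite [leRHS]mulrDr !mulrA e; move: (1 - r)^-1 => s; lra.
Qed.

End Fixed.

Lemma ip_mull (m n k : nat) (W : 'M[R]_(m, k)) (A : 'M[R]_(k, n)) B :
  ip (W *m A) B = ip A (W^T *m B).
Proof.
rewrite /ip; under eq_bigr => i _ do under eq_bigr => j _ do
  rewrite mxE mulr_suml.
under eq_bigr => i _ do rewrite exchange_big/=.
rewrite exchange_big/=; apply: eq_bigr => l _; rewrite exchange_big/=.
apply: eq_bigr => j _; rewrite mxE mulr_sumr; apply: eq_bigr => i _.
by rewrite mxE; ring.
Qed.

Lemma sqnorm_rows (m n : nat) (A : 'M[R]_(m, n)) :
  sqnorm A = \sum_i sqnorm (row i A).
Proof.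
apply: eq_bigr => i _; rewrite /sqnorm big_ord1.
by apply: eq_bigr => j _; rewrite mxE.
Qed.

Lemma ip_rows (m n : nat) (A B : 'M[R]_(m, n)) :
  ip A B = \sum_i ip (row i A) (row i B).
Proof.
apply: eq_bigr => i _; rewrite /ip big_ord1.
by apply: eq_bigr => j _; rewrite !mxE.
Qed.

Lemma sqnorm_cols (m n : nat) (A : 'M[R]_(m, n)) :
  sqnorm A = \sum_j sqnorm (col j A).
Proof.
rewrite /sqnorm exchange_big/=; apply: eq_bigr => j _; apply: eq_bigr => i _.
by rewrite big_ord1 mxE.
Qed.

End InnerProduct.

(** * Spectral norm *)

Section OperatorNorm.
Context (R : realType) (n : nat).
Implicit Types (A : 'M[R]_n) (v : 'cV[R]_n).

Lemma sqnorm_mulmx A v : sqnorm (A *m v) <= sqnorm A * sqnorm v.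
Proof.
rewrite (sqnorm_rows A) mulr_suml sqnorm_rows; apply: ler_sum => i _.
rewrite /sqnorm [leLHS]big_ord1 [leLHS]big_ord1 !mxE.
have -> : \sum_j A i j * v j 0 = ip (row i A)^T v.
  by rewrite /ip; apply: eq_bigr => j _; rewrite big_ord1 !mxE.
apply: le_trans (cauchy_schwarz _ _) _; rewrite le_eqVlt; apply/orP; left.
apply/eqP; congr (_ * _); rewrite /sqnorm exchange_big.
by under eq_bigr do under eq_bigr do rewrite mxE.
Qed.

(** [sup] is a default value on unbounded sets; the Frobenius norm bounds this one, so that
    [opnorm2] is a true supremum. *)
Lemma opnorm2_set_bounded A : has_sup
  [set Num.sqrt (sqnorm (A *m v)) | v in [set v : 'cV[R]_n | sqnorm v <= 1]].
Proof.
split; first by exists (Num.sqrt (sqnorm (A *m (0 : 'cV_n)))), 0 => //=;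
  rewrite sqnorm0.
exists (Num.sqrt (sqnorm A)) => _ [v /= v1 <-]; rewrite ler_sqrt ?sqnorm_ge0//.
apply: le_trans (sqnorm_mulmx _ _) _.
by rewrite -[leRHS]mulr1 ler_wpM2l ?sqnorm_ge0.
Qed.

Lemma opnorm2_ge0 A : 0 <= opnorm2 A.
Proof.
apply: le_trans (ub_le_sup (proj2 (opnorm2_set_bounded A)) _).
  exact: (sqrtr_ge0 (sqnorm (A *m (0 : 'cV_n)))).

by exists 0 => //=; rewrite sqnorm0.
Qed.

Lemma opnorm2_le A (c : R) : 0 <= c ->
  (forall v, sqnorm (A *m v) <= c ^+ 2 * sqnorm v) -> opnorm2 A <= c.
Proof.
move=> c0 H; apply: ge_sup; first exact: proj1 (opnorm2_set_bounded A).
move=> _ [v /= v1 <-]; rewrite -[leRHS](ger0_norm c0) -sqrtr_sqr.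
rewrite ler_wsqrtr//; apply: le_trans (H v) _.
exact: ler_piMr (sqr_ge0 c) v1.
Qed.

Lemma sqnorm_opnorm2_col A v : sqnorm (A *m v) <= opnorm2 A ^+ 2 * sqnorm v.
Proof.
have [v0|v0] := eqVneq (sqnorm v) 0.
  by rewrite (sqnorm_eq0 v0) mulmx0 sqnorm0 mulr0.
have vp : 0 < sqnorm v by rewrite lt_def v0 sqnorm_ge0.
set s := Num.sqrt (sqnorm v); have s0 : 0 < s by rewrite sqrtr_gt0.
have sv : s ^+ 2 = sqnorm v by rewrite sqr_sqrtr ?sqnorm_ge0.
have : Num.sqrt (sqnorm (A *m (s^-1 *: v))) <= opnorm2 A.
  rewrite /opnorm2; apply: (ub_le_sup (proj2 (opnorm2_set_bounded A))).
  by exists (s^-1 *: v) => //=; rewrite sqnormZ exprVn sv mulVf.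
rewrite -ler_sqr ?nnegrE ?sqrtr_ge0 ?opnorm2_ge0//.
rewrite sqr_sqrtr ?sqnorm_ge0// -scalemxAr sqnormZ exprVn sv.
by rewrite mulrC ler_pdivrMr.
Qed.

Lemma sqnorm_opnorm2 p A (B : 'M[R]_(n, p)) :
  sqnorm (A *m B) <= opnorm2 A ^+ 2 * sqnorm B.
Proof.
rewrite !sqnorm_cols mulr_sumr; apply: ler_sum => j _.
by rewrite colE -mulmxA -colE; exact: sqnorm_opnorm2_col.
Qed.

End OperatorNorm.

(** * Averaging as an orthogonal projection *)

Section Averaging.
Context (R : realType) (N p : nat).
Hypothesis N0 : (0 < N)%N.
Implicit Types A B : 'M[R]_(N, p).
Local Notation J := (avgmx R N).

Let NR : N%:R != 0 :> R. Proof. by rewrite pnatr_eq0 -lt0n. Qed.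

Lemma avgmx_tr : J^T = J.
Proof. by apply/matrixP => i j; rewrite !mxE. Qed.

Lemma row_avgmx A i : row i (J *m A) = avgrow A.
Proof.
apply/rowP => j; rewrite !mxE summxE mulr_sumr.
by apply: eq_bigr => k _; rewrite !mxE.
Qed.

Lemma avgmx_idem : J *m J = J.
Proof.
apply/matrixP => i j; rewrite !mxE; under eq_bigr do rewrite !mxE.
by rewrite sumr_const card_ord -[_ *+ N]mulr_natr -mulrA mulVf ?mulr1.
Qed.

Lemma avgmx_perp A : J *m perp A = 0.
Proof. by rewrite /perp mulmxBr mulmxA avgmx_idem subrr. Qed.

Lemma avg_perp A : A = J *m A + perp A.
Proof. by rewrite addrC subrK. Qed.

Lemma ip_avg_perp A B : ip (J *m A) (perp B) = 0.
Proof. by rewrite ip_mull avgmx_tr avgmx_perp ipC ip0l. Qed.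

Lemma ip_avgmx A B : ip (J *m A) B = N%:R * ip (avgrow A) (avgrow B).
Proof.
rewrite [in LHS](avg_perp B) ipDr ip_avg_perp addr0 ip_rows.
under eq_bigr do rewrite !row_avgmx.
by rewrite sumr_const card_ord mulr_natl.
Qed.

(** [J] is symmetric and idempotent, so mean parts and [perp] parts are orthogonal; a mean part has
    N equal rows. *)
Lemma ip_decomp A B :
  ip A B = N%:R * ip (avgrow A) (avgrow B) + ip (perp A) (perp B).
Proof.
rewrite {1}(avg_perp A) ipDl ip_avgmx; congr (_ + _).
by rewrite [in LHS](avg_perp B) ipDr (ipC _ (J *m B)) ip_avg_perp add0r.
Qed.

Lemma sqnorm_decomp A : sqnorm A = N%:R * sqnorm (avgrow A) + sqnorm (perp A).
Proof. by rewrite -!ip_self ip_decomp. Qed.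

Lemma sqnorm_perp_le A : sqnorm (perp A) <= sqnorm A.
Proof. by rewrite [leRHS]sqnorm_decomp lerDr mulr_ge0 ?ler0n ?sqnorm_ge0. Qed.

Lemma perpD A B : perp (A + B) = perp A + perp B.
Proof. by rewrite /perp mulmxDr opprD addrACA. Qed.

Lemma perpZ a A : perp (a *: A) = a *: perp A.
Proof. by rewrite /perp -scalemxAr scalerBr. Qed.

Lemma perpB A B : perp (A - B) = perp A - perp B.
Proof. by rewrite -scaleN1r perpD perpZ scaleN1r. Qed.

Lemma avgrowD A B : avgrow (A + B) = avgrow A + avgrow B.
Proof.
rewrite /avgrow -scalerDr -big_split; congr (_ *: _); apply: eq_bigr => i _.
by rewrite linearD.
Qed.

Lemma avgrowZ a A : avgrow (a *: A) = a *: avgrow A.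
Proof.
rewrite /avgrow scalerA mulrC -scalerA; congr (_ *: _).
by rewrite scaler_sumr; apply: eq_bigr => i _; rewrite linearZ.
Qed.

Lemma avgrowB A B : avgrow (A - B) = avgrow A - avgrow B.
Proof. by rewrite -scaleN1r avgrowD avgrowZ scaleN1r. Qed.

Lemma row_perp A i : row i (perp A) = row i A - avgrow A.
Proof. by rewrite /perp linearB/= row_avgmx. Qed.

(* The mean minimises the sum of squared distances. *)
Lemma sqnorm_perp_min A (c : 'rV[R]_p) :
  sqnorm (perp A) <= \sum_i sqnorm (row i A - c).
Proof.
have -> : \sum_i sqnorm (row i A - c) = sqnorm (A - const_mx 1 *m c).
  rewrite sqnorm_rows; apply: eq_bigr => i _; congr sqnorm.
  by apply/rowP => j; rewrite !mxE big_ord1 mxE mul1r.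
apply: le_trans (sqnorm_perp_le _); rewrite perpB.
suff -> : perp (const_mx 1 *m c : 'M[R]_(N, p)) = 0 by rewrite subr0.
apply/matrixP => i j; rewrite !mxE big_ord1 mxE mul1r.
under eq_bigr do rewrite !mxE big_ord1 mxE mul1r.
by rewrite -mulr_suml sumr_const card_ord -[_ *+ N]mulr_natr mulVf// mul1r subrr.
Qed.

End Averaging.

(** * Chebyshev mixing *)

Section ChebyshevPolynomials.
Context (R : realType).

Fixpoint chebT (t : nat) : {poly R} :=
  if t is t1.+1 then
    if t1 is t2.+1 then 2%:R * 'X * chebT t1 - chebT t2 else 'X
  else 1.

Lemma chebTSS t : chebT t.+2 = 2%:R * 'X * chebT t.+1 - chebT t.
Proof. by []. Qed.

(** The quadratic form preserved by the recursion; at X = cos u its value is sin^2 u for every t. *)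
Lemma chebT_energy t :
  chebT t.+1 ^+ 2 - 2%:R * 'X * chebT t.+1 * chebT t + chebT t ^+ 2
  = 1 - 'X ^+ 2.
Proof.
elim: t => [|t IH]; first by rewrite /=; ring.
by rewrite chebTSS -IH; ring.
Qed.

(** The composition law of T_2 with T_t. The odd companion is carried along because the recursion
    has two terms. *)
Lemma chebT_double t :
  chebT t.*2 = 2%:R * chebT t ^+ 2 - 1 /\
  chebT t.*2.+1 = 2%:R * chebT t.+1 * chebT t - 'X.
Proof.
elim: t => [|t [IH1 IH2]]; first by rewrite /=; split; ring.
have E : chebT t.+1.*2 = 2%:R * chebT t.+1 ^+ 2 - 1.
  rewrite doubleS chebTSS IH1 IH2.
  have := chebT_energy t => /(congr1 (fun p => 2%:R * p)) e.
  apply/eqP; rewrite -subr_eq0; apply/eqP.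
  transitivity (2%:R * (1 - 'X ^+ 2) - 2%:R *
    (chebT t.+1 ^+ 2 - 2%:R * 'X * chebT t.+1 * chebT t + chebT t ^+ 2)).
    by ring.
  by rewrite e subrr.
split=> //; rewrite doubleS chebTSS -doubleS E IH2 chebTSS; ring.
Qed.

End ChebyshevPolynomials.

(** Stands for the limit of x <= c / k, in the norm bound for Chebyshev polynomials and in the
    variational inequality of the prox. *)
Lemma le0_archi (R : realType) (x c : R) :
  (forall k : nat, (0 < k)%N -> x * k%:R <= c) -> x <= 0.
Proof.
move=> H; rewrite leNgt; apply/negP => x0.
have c0 : 0 <= `|c| / x by rewrite divr_ge0// ltW.
have := archi_boundP c0; set k := Num.bound _ => ck.
have k0 : (0 < k)%N by rewrite -(ltr0n R); exact: le_lt_trans ck.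
move: ck; rewrite ltr_pdivrMr// mulrC => ck.
have := lt_le_trans ck (H k k0); rewrite ltNge => /negP; apply.
exact: ler_norm.
Qed.

(** * Chebyshev polynomials of a symmetric contraction *)

Section ChebyshevContraction.
Context (R : realType) (n : nat).
Variable A : 'M[R]_n.+1.
Hypothesis Asym : A^T = A.
Hypothesis Acontr : forall v : 'cV[R]_n.+1, sqnorm (A *m v) <= sqnorm v.
Implicit Type v : 'cV[R]_n.+1.

Definition chebM (t : nat) : 'M[R]_n.+1 := horner_mx A (chebT R t).

Lemma chebM0 : chebM 0 = 1%:M. Proof. by rewrite /chebM rmorph1. Qed.

Lemma chebM1 : chebM 1 = A. Proof. by rewrite /chebM horner_mx_X. Qed.

Lemma chebMSS t : chebM t.+2 = 2 *: (A *m chebM t.+1) - chebM t.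
Proof.
rewrite /chebM chebTSS; move: (chebT R t.+1) (chebT R t) => p1 p0.
by rewrite rmorphB !rmorphM/= horner_mx_X rmorph_nat -mulrA mulr_natl scaler_nat.
Qed.

Lemma chebM_double t : 2 *: (chebM t *m chebM t) = chebM t.*2 + 1%:M.
Proof.
rewrite /chebM (proj1 (chebT_double R t)) rmorphB rmorph1 rmorphM rmorphXn/=.
by rewrite rmorph_nat subrK mulr_natl scaler_nat expr2.
Qed.

Lemma chebM_comm t : A *m chebM t = chebM t *m A.
Proof.
rewrite -[X in X *m _]chebM1 -[X in _ = _ *m X]chebM1 /chebM.
by rewrite -[LHS]rmorphM -[RHS]rmorphM mulrC.
Qed.

Lemma chebM_sym t : (chebM t)^T = chebM t.
Proof.
suff : (chebM t)^T = chebM t /\ (chebM t.+1)^T = chebM t.+1 by case.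
elim: t => [|t [IH1 IH2]]; first by rewrite chebM0 chebM1 trmx1.
split=> //; rewrite chebMSS linearB linearZ/= trmx_mul IH1 IH2 Asym.
by rewrite -chebM_comm.
Qed.

(** [chebT_energy] read on vectors; symmetry moves [A] across the inner product in the induction. *)
Lemma chebM_energy t v :
  sqnorm (chebM t.+1 *m v) - 2 * ip (A *m (chebM t.+1 *m v)) (chebM t *m v)
  + sqnorm (chebM t *m v) = sqnorm v - sqnorm (A *m v).
Proof.
elim: t => [|t <-].
  by rewrite chebM0 chebM1 mul1mx ip_mull Asym ip_self; ring.
rewrite chebMSS mulmxBl -scalemxAl -mulmxA.
set b := chebM t *m v; set b' := chebM t.+1 *m v.
rewrite (ip_mull A (_ - b)) Asym sqnormB sqnormZ ipBl !ipZl ip_self.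
by rewrite (ipC b); ring.
Qed.

(** The energy identity reads |b' - A b|^2 + |b|^2 - |A b|^2 = |v|^2 - |A v|^2, so each step adds at
    most |v| to the norm. *)
Lemma chebM_growth t v : sqnorm (chebM t *m v) <= (1 + t%:R) ^+ 2 * sqnorm v.
Proof.
elim: t => [|t IH]; first by rewrite chebM0 mul1mx addr0 expr1n mul1r.
set b := chebM t *m v in IH *; set b' := chebM t.+1 *m v.
have d : sqnorm (b' - A *m b) <= sqnorm v.
  have := chebM_energy t v; rewrite -/b -/b' => e.
  have := Acontr b; have := sqnorm_ge0 (A *m v).
  rewrite sqnormB -[ip b' _]ipC ip_mull Asym ipC; move: e; rewrite ip_mull Asym.
  rewrite (ipC b' (A *m b)); lra.
have c0 : 0 < 1 + t%:R :> R by rewrite ltr_pwDl.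
have t0 : 0 < (1 + t%:R)^-1 :> R by rewrite invr_gt0.
(* With the weight 1 / (1 + t) Young's inequality reproduces the square of a sum of norms (1 + t)
   |v| and |v|. *)
have := ip_young (A *m b) (b' - A *m b) t0; rewrite invrK => y.
have -> : b' = A *m b + (b' - A *m b) by rewrite addrC subrK.
rewrite sqnormD.
have a := le_trans (Acontr b) IH.
have u : (1 + t%:R)^-1 * sqnorm (A *m b) <= (1 + t%:R) * sqnorm v.
  apply: le_trans (ler_wpM2l (ltW t0) a) _.
  by rewrite expr2 !mulrA mulVf ?mul1r// lt0r_neq0.
have w : (1 + t%:R) * sqnorm (b' - A *m b) <= (1 + t%:R) * sqnorm v.
  by rewrite ler_wpM2l// ltW.
have -> : 1 + t.+1%:R = 1 + t%:R + 1 :> R by rewrite -natr1 addrA.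
move: a u w y d; set c := 1 + t%:R; nra.
Qed.

(** By symmetry and doubling, 2 |T_t v|^2 = <T_2t v, v> + |v|^2 <= (2 + dl) |v|^2, and 1 + dl / 2 <=
    (1 + dl / 4)^2. *)
Lemma chebM_halve (dl : R) t : 0 <= dl ->
  (forall v, sqnorm (chebM t.*2 *m v) <= (1 + dl) ^+ 2 * sqnorm v) ->
  forall v, sqnorm (chebM t *m v) <= (1 + dl / 4) ^+ 2 * sqnorm v.
Proof.
move=> d0 H v.
have e : 2 * sqnorm (chebM t *m v) = ip (chebM t.*2 *m v) v + sqnorm v.
  rewrite -{1}ip_self ip_mull chebM_sym ipC -ipZl mulmxA scalemxAl chebM_double.
  by rewrite mulmxDl mul1mx ipDl ip_self.
have d1 : 0 < (1 + dl)^-1 by rewrite invr_gt0 ltr_pwDl.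
have := ip_young (chebM t.*2 *m v) v d1; rewrite invrK => y.
have u : (1 + dl)^-1 * sqnorm (chebM t.*2 *m v) <= (1 + dl) * sqnorm v.
  apply: le_trans (ler_wpM2l (ltW d1) (H v)) _.
  rewrite expr2 !mulrA mulVf ?mul1r//; move: d1; rewrite invr_gt0.
  exact: lt0r_neq0.
have := mulr_ge0 (sqr_ge0 dl) (sqnorm_ge0 v); have := sqnorm_ge0 v.
move: e y u; set a := sqnorm (chebM t *m v); set s := sqnorm v.
nra.
Qed.

(* If T_t(A) had norm 1 + d then, T_2t being 2 T_t^2 - 1, T_(2^k t)(A) would
   have norm at least 1 + 4^k d, whereas the growth in the degree is linear. *)
Lemma chebM_contr t v : sqnorm (chebM t *m v) <= sqnorm v.
Proof.
have H k : forall dl : R, forall s, 0 <= dl ->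
    (forall v, sqnorm (chebM (2 ^ k * s)%N *m v) <= (1 + dl) ^+ 2 * sqnorm v) ->
    forall v, sqnorm (chebM s *m v) <= (1 + dl / 4 ^+ k) ^+ 2 * sqnorm v.
  elim: k => [|k IH] dl s d0 h w; first by have := h w; rewrite mul1n expr0 divr1.
  have := IH (dl / 4) s; rewrite (exprS 4 k) invfM mulrA; apply; rewrite ?divr_ge0//.
  move=> u; apply: chebM_halve => // z; move: (h z).
  by rewrite expnS -mulnA mul2n.
rewrite -subr_le0; apply: (@le0_archi _ _ ((2 * t%:R + t%:R ^+ 2) * sqnorm v)).
move=> k k0.
(* Linear growth gives the excess 2^k t in degree 2^k t; k halvings, each dividing it by 4, leave t
   / 2^k in degree t. *)
have := @H k (2 ^+ k * t%:R) t; rewrite mulr_ge0 ?exprn_ge0// => /(_ isT) h.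
have {h} := h _ v.
have -> : 2 ^+ k * t%:R / 4 ^+ k = t%:R / 2 ^+ k :> R.
  have -> : (4 : R) = 2 * 2 by ring.
  by rewrite exprMn; field; rewrite expf_neq0.
set g := _ / _ => h.
have gk : g * k%:R <= t%:R.
  rewrite /g mulrAC ler_pdivrMr ?exprn_gt0// ler_wpM2l//.
  by rewrite -natrX ler_nat ltnW// ltn_expl.
have g0 : 0 <= g by rewrite /g divr_ge0// exprn_ge0.
have gt : g <= t%:R.
  apply: le_trans gk; rewrite ler_peMr//.
  by rewrite ler1n.
have {}h : sqnorm (chebM t *m v) <= (1 + g) ^+ 2 * sqnorm v.
  apply: h => w; have := chebM_growth (2 ^ k * t) w.
  by rewrite natrM natrX.
have k0' : 0 <= k%:R :> R by [].
have := sqnorm_ge0 v; move: h gk g0 gt k0'.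
set a := sqnorm (_ *m v); set s := sqnorm v; set q : R := k%:R; set r : R := t%:R.
move=> h gk g0 gt q0 s0.
have e1 : (a - s) * q <= (2 * (g * q) + g * (g * q)) * s.
  have : a - s <= (2 * g + g * g) * s by move: h; rewrite expr2; lra.
  by move=> /(ler_wpM2r q0); lra.
apply: le_trans e1 _; rewrite ler_wpM2r// lerD ?ler_wpM2l//.
by rewrite expr2 ler_pM// mulr_ge0.
Qed.

End ChebyshevContraction.

(** * The weights mu_t *)

Section ChebyshevWeights.
Context (R : realType) (rho : R).
Hypothesis rho0 : 0 < rho.
Hypothesis rho1 : rho < 1.

Let lam : R := (1 + Num.sqrt (1 - rho ^+ 2)) / rho.

Let rho2 : 0 <= 1 - rho ^+ 2.
Proof. by have := rho0; have := rho1; nra. Qed.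

Let lam_gt1 : 1 < lam.
Proof.
rewrite /lam ltr_pdivlMr// mul1r; apply: lt_le_trans rho1 _.
by rewrite lerDl sqrtr_ge0.
Qed.

Let lamV : lam + lam^-1 = 2 / rho.
Proof.
rewrite /lam; have := sqr_sqrtr rho2; have := sqrtr_ge0 (1 - rho ^+ 2).
set s := Num.sqrt _ => s0 e.
have s1 : 1 + s != 0 by apply: lt0r_neq0; rewrite ltr_pwDl.
have r0 : rho != 0 by exact: lt0r_neq0.
rewrite invfM invrK; apply: (mulIf r0); apply: (mulIf s1).
rewrite mulfVK//.
have -> : ((1 + s) / rho + (1 + s)^-1 * rho) * rho * (1 + s)
  = (1 + s) ^+ 2 + rho ^+ 2 by field; rewrite r0 s1.
lra.
Qed.

(** [lam] and its inverse are the roots of z^2 - (2 / rho) z + 1, the characteristic polynomial of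
    the recursion; thus mu_t = T_t(1 / rho). *)
Lemma cheb_muE t : cheb_mu rho t = (lam ^+ t + lam ^- t) / 2.
Proof.
have l0 : lam != 0 by apply: lt0r_neq0; exact: lt_trans lam_gt1.
suff : cheb_mu rho t = (lam ^+ t + lam ^- t) / 2 /\
       cheb_mu rho t.+1 = (lam ^+ t.+1 + lam ^- t.+1) / 2 by case.
elim: t => [|t [IH1 IH2]].
  split; first by rewrite /= expr0 invr1; field.
  by rewrite /= expr1 lamV; field; exact: lt0r_neq0.
split=> //.
have -> : cheb_mu rho t.+2 = 2 / rho * cheb_mu rho t.+1 - cheb_mu rho t by [].
rewrite IH1 IH2.
rewrite -lamV !exprS; have : lam ^+ t != 0 by rewrite expf_neq0.
move: (lam ^+ t) (lam) l0 => x l l0 x0.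
by field; rewrite l0 x0.
Qed.

Lemma cheb_mu_gt0 t : 0 < cheb_mu rho t.
Proof.
have l0 : 0 < lam := lt_trans ltr01 lam_gt1.
by rewrite cheb_muE divr_gt0// addr_gt0// ?invr_gt0 exprn_gt0.
Qed.

Lemma cheb_mu_gt1 t : (0 < t)%N -> 1 < cheb_mu rho t.
Proof.
move=> t0; have l1 : 1 < lam ^+ t by rewrite exprn_egt1// -lt0n.
rewrite cheb_muE; set x := lam ^+ t in l1 *.
have x0 : 0 < x by apply: lt_trans l1.
rewrite ltr_pdivlMr// mul1r -subr_gt0.
have -> : x + x^-1 - 2 = (x - 1) ^+ 2 / x by field; exact: lt0r_neq0.
by rewrite divr_gt0// exprn_gt0// subr_gt0.
Qed.

(** With s = sqrt (1 - rho), exp s <= 1 / (1 - s) = (1 + s) / rho <= lam, because rho = (1 - s) (1 +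
    s) and s^2 <= 1 - rho^2. *)
Lemma cheb_mu_expR t :
  2^-1 * expR (Num.sqrt (1 - rho) * t%:R) <= cheb_mu rho t.
Proof.
have l0 : 0 < lam := lt_trans ltr01 lam_gt1.
suff h : expR (Num.sqrt (1 - rho)) <= lam.
  rewrite cheb_muE [leRHS]mulrC ler_wpM2l//.
  rewrite mulrC expRM_natl; apply: le_trans (lerXn2r t _ _ h) _; last first.
  - by rewrite lerDl invr_ge0 exprn_ge0// ltW.
  - by rewrite nnegrE ltW.
  - by rewrite nnegrE expR_ge0.
have q0 : 0 <= 1 - rho by rewrite subr_ge0 ltW.
have := sqr_sqrtr q0; have := sqrtr_ge0 (1 - rho).
set s := Num.sqrt _ => s0 es.
have s1 : 0 < 1 - s.
  rewrite subr_gt0 ltNge; apply/negP => s1.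
  by have := rho0; move: s1 es; nra.
apply: (@le_trans _ _ (1 - s)^-1).
  rewrite -[leLHS]invrK lef_pV2 ?posrE ?invr_gt0 ?expR_gt0//.
  by rewrite -expRN; exact: expR_ge1Dx.
rewrite /lam ler_pdivlMr//.
have -> : rho = (1 - s) * (1 + s) by rewrite -[LHS]opprK -(subKr 1 rho) -es; ring.
rewrite mulrA mulVf ?mul1r ?lt0r_neq0// lerD2l.
rewrite -[leLHS](ger0_norm s0) -sqrtr_sqr ler_wsqrtr//.
have : 0 <= s ^+ 2 * (1 - s ^+ 2).
  by rewrite mulr_ge0 ?sqr_ge0// subr_ge0 expr_le1// -subr_ge0 ltW.
lra.
Qed.

End ChebyshevWeights.

Lemma chebSS (R : realType) (N q : nat) (W : 'M[R]_N) (B : 'M[R]_(N, q)) t :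
  cheb W B t.+2 =
  (2 * cheb_mu (rho_of W) t.+1 / (rho_of W * cheb_mu (rho_of W) t.+2))
    *: (W *m cheb W B t.+1)
  - (cheb_mu (rho_of W) t / cheb_mu (rho_of W) t.+2) *: cheb W B t.
Proof. by []. Qed.

(** * Contraction of the mixing operator *)

Section Mixing.
Context (R : realType) (N : nat) (W : 'M[R]_N).
Hypothesis N0 : (0 < N)%N.
Hypothesis Wsym : W^T = W.
Hypothesis WJ : W *m avgmx R N = avgmx R N.
Hypothesis Wrho : rho_of W < 1.
Local Notation J := (avgmx R N).
Local Notation rho := (rho_of W).

Lemma chebE q (B : 'M[R]_(N, q)) t : cheb W B t = chebmx W t *m B.
Proof.
suff : cheb W B t = chebmx W t *m B /\ cheb W B t.+1 = chebmx W t.+1 *m B by case.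
elim: t => [|t [IH1 IH2]]; first by rewrite /= /chebmx/= mul1mx mulmx1.
split=> //; rewrite chebSS IH1 IH2 /chebmx chebSS -/(chebmx W _) -/(chebmx W _).
by rewrite mulmxBl -!scalemxAl mulmxA.
Qed.

Lemma avgmxW : J *m W = J.
Proof. by rewrite -[LHS]trmxK trmx_mul Wsym avgmx_tr WJ avgmx_tr. Qed.

Lemma opnorm2_rho_ge0 : 0 <= rho.
Proof. exact: opnorm2_ge0. Qed.

(** Off the consensus direction W acts as rho A, where A = (W - J) / rho is a symmetric contraction;
    Chebyshev's recursion for A, divided by mu_t, is that of [cheb]. The witness [S] is T_t(A). *)
Lemma cheb_decomp t : 0 < rho -> exists2 S : 'M[R]_N,
  chebmx W t = J + (cheb_mu rho t)^-1 *: (S *m (1%:M - J)) &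
  forall v : 'cV[R]_N, sqnorm (S *m v) <= sqnorm v.
Proof.
(* [chebM] is stated for sizes [n.+1], hence the case analysis on [N]. *)
case: N N0 W Wsym WJ Wrho => // n _ W' sym WJ' rho1 rho0.
set J' := avgmx R n.+1 in WJ' *; set r := rho_of W' in rho0 rho1 *.
have JW' : J' *m W' = J'.
  by rewrite -[LHS]trmxK trmx_mul sym avgmx_tr WJ' avgmx_tr.
have JJ : J' *m J' = J' by exact: avgmx_idem.
pose A : 'M[R]_n.+1 := r^-1 *: (W' - J').
have As : A^T = A by rewrite /A linearZ/= linearB/= sym avgmx_tr.
have Ac (v : 'cV_n.+1) : sqnorm (A *m v) <= sqnorm v.
  rewrite -scalemxAl sqnormZ exprVn mulrC ler_pdivrMr ?exprn_gt0// [leRHS]mulrC.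
  exact: sqnorm_opnorm2_col.
exists (chebM A t); last exact: chebM_contr.
have r0 : r != 0 by exact: lt0r_neq0.
have mu0 s : cheb_mu r s != 0 by apply: lt0r_neq0; exact: cheb_mu_gt0.
have rAW : r *: A = W' - J' by rewrite /A scalerA divff// scale1r.
have JA : J' *m A = 0 by rewrite /A -scalemxAr mulmxBr JW' JJ subrr scaler0.
have AJ : A *m J' = 0 by rewrite /A -scalemxAl mulmxBl WJ' JJ subrr scaler0.
clearbody A.
have JS s : J' *m chebM A s = chebM A s *m J'.
  suff : J' *m chebM A s = chebM A s *m J' /\
         J' *m chebM A s.+1 = chebM A s.+1 *m J' by case.
  elim: s => [|s [IH1 IH2]]; first by rewrite chebM0 chebM1 mulmx1 mul1mx JA AJ.
  split=> //; rewrite chebMSS mulmxBr mulmxBl IH1 -scalemxAr -scalemxAl.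
  by rewrite mulmxA JA mul0mx (chebM_comm A) -mulmxA AJ mulmx0.
have WS s : W' *m (chebM A s *m (1%:M - J')) =
    r *: (A *m chebM A s *m (1%:M - J')).
  have -> : W' = r *: A + J' by rewrite rAW subrK.
  have J0 : J' *m (chebM A s *m (1%:M - J')) = 0.
    by rewrite mulmxA JS -mulmxA mulmxBr mulmx1 JJ subrr mulmx0.
  by rewrite mulmxDl J0 addr0 -scalemxAl mulmxA.
suff : chebmx W' t = J' + (cheb_mu r t)^-1 *: (chebM A t *m (1%:M - J')) /\
  chebmx W' t.+1 = J' + (cheb_mu r t.+1)^-1 *: (chebM A t.+1 *m (1%:M - J')).
  by case.
elim: t => [|s [IH1 IH2]].
  split; first by rewrite chebM0 mul1mx invr1 scale1r addrC subrK.
  rewrite chebM1 mulmxBr mulmx1 AJ subr0 [cheb_mu r 1]/= invrK rAW addrC subrK.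
  by rewrite /chebmx /= mulmx1.
split=> //; rewrite /chebmx chebSS -/(chebmx _ _) -/(chebmx _ _) IH1 IH2 -/r.
rewrite (mulmxDr W') -scalemxAr WS WJ' chebMSS mulmxBl -scalemxAl.
have : cheb_mu r s.+2 = 2 / r * cheb_mu r s.+1 - cheb_mu r s by [].
have := mu0 s; have := mu0 s.+1; have := mu0 s.+2.
move: (cheb_mu r s.+2) (cheb_mu r s.+1) (cheb_mu r s) => m2 m1 m0 h2 h1 h0 e.
move: (A *m chebM A s.+1 *m _) (chebM A s *m _) => X Y.
(* The recursion of mu makes the coefficient of J equal to 1 again. *)
have c1 : 2 * m1 = (m2 + m0) * r by rewrite e subrK mulrAC mulfVK.
rewrite [_ *: (J' + m1^-1 *: _)]scalerDr !scalerA.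
have -> : 2 * m1 / (r * m2) * m1^-1 * r = 2 / m2 by field; rewrite r0 h1 h2.
have -> : 2 * m1 / (r * m2) = 1 + m0 / m2 by rewrite c1; field; rewrite r0 h2.
apply/matrixP => i j; rewrite !mxE; move: (n.+1%:R^-1 : R) (X i j) (Y i j) => *.
by field; rewrite h0 h2.
Qed.

Section Rates.
Context (T : nat).
Hypothesis T1 : (1 <= T)%N.
Hypothesis rhoT : 0 < rho \/ T = 1%N.
Local Notation rt := (rhot W T).

Lemma opnorm2_chebmx t : 0 < rho -> opnorm2 (chebmx W t - J) <= (cheb_mu rho t)^-1.
Proof.
move=> r0; have [S -> Sc] := cheb_decomp t r0; rewrite addrC addKr.
have mu0 := cheb_mu_gt0 r0 Wrho t.
apply: opnorm2_le; first by rewrite invr_ge0 ltW.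
move=> v; rewrite -scalemxAl sqnormZ ler_wpM2l ?sqr_ge0// -mulmxA.
apply: le_trans (Sc _) _; rewrite mulmxBl mul1mx; exact: sqnorm_perp_le.
Qed.

Lemma rhot_ge0 : 0 <= rt.
Proof. exact: opnorm2_ge0. Qed.

Lemma rhot1 : rhot W 1 = rho.
Proof. by rewrite /rhot /chebmx /= mulmx1. Qed.

Lemma rhot_lt1 : rt < 1.
Proof.
case: rhoT => [r0|->]; last by rewrite rhot1.
apply: le_lt_trans (opnorm2_chebmx _ r0) _.
by rewrite invf_lt1 ?cheb_mu_gt1// cheb_mu_gt0.
Qed.

(** The coefficients of the recursion sum to 1, so means are preserved; up to degree 1 there is no
    division by rho, which covers rho = 0. *)
Lemma chebmx_avg t : 0 < rho \/ (t <= 1)%N ->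
  chebmx W t *m J = J /\ J *m chebmx W t = J.
Proof.
move=> [r0|].
  suff : (chebmx W t *m J = J /\ J *m chebmx W t = J) /\
    (chebmx W t.+1 *m J = J /\ J *m chebmx W t.+1 = J) by case.
  elim: t => [|t [[IH1 IH2] [IH3 IH4]]].
    by rewrite /chebmx/= !mulmx1 mul1mx avgmxW.
  split=> //; rewrite /chebmx chebSS -/(chebmx _ _) -/(chebmx _ _).
  have r0' : rho != 0 by exact: lt0r_neq0.
  have h1 : cheb_mu rho t.+1 != 0 by exact/lt0r_neq0/cheb_mu_gt0.
  have h2 : cheb_mu rho t.+2 != 0 by exact/lt0r_neq0/cheb_mu_gt0.
  have e : cheb_mu rho t.+2 = 2 / rho * cheb_mu rho t.+1 - cheb_mu rho t by [].
  have c1 : 2 * cheb_mu rho t.+1 / (rho * cheb_mu rho t.+2)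
      - cheb_mu rho t / cheb_mu rho t.+2 = 1.
    move: e h2; move: (cheb_mu rho t.+2) (cheb_mu rho t.+1) (cheb_mu rho t).
    move=> m2 m1 m0 e h2; apply: (mulIf h2); apply: (mulIf r0').
    have -> : (2 * m1 / (rho * m2) - m0 / m2) * m2 * rho = 2 * m1 - m0 * rho.
      by field; rewrite r0' h2.
    by rewrite mul1r e; field.
  rewrite mulmxBl mulmxBr -!scalemxAl -!scalemxAr -mulmxA IH3 WJ IH1.
  by rewrite mulmxA avgmxW IH2 IH4 -scalerBl c1 scale1r.
case: t => [|[|//]] _; rewrite /chebmx/=; first by rewrite mulmx1 mul1mx.
by rewrite !mulmx1 WJ avgmxW.
Qed.

Lemma avgrow_cheb_gen q (B : 'M[R]_(N, q)) t : 0 < rho \/ (t <= 1)%N ->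
  avgrow (cheb W B t) = avgrow B.
Proof.
move=> /chebmx_avg[_ h]; have i0 : 'I_N by exact: Ordinal N0.
by rewrite -(row_avgmx _ i0) chebE mulmxA h row_avgmx.
Qed.

Lemma perp_cheb q (B : 'M[R]_(N, q)) t : 0 < rho \/ (t <= 1)%N ->
  perp (cheb W B t) = (chebmx W t - J) *m perp B.
Proof.
move=> /chebmx_avg[h1 h2]; rewrite chebE /perp mulmxA h2 mulmxBl mulmxBr.
by rewrite [chebmx W t *m (J *m B)]mulmxA h1 mulmxBr mulmxA avgmx_idem// subrr subr0.
Qed.

Lemma avgrow_cheb q (B : 'M[R]_(N, q)) : avgrow (cheb W B T) = avgrow B.
Proof. by apply: avgrow_cheb_gen; case: rhoT => [|->]; [left|right]. Qed.

Lemma sqnorm_perp_cheb q (B : 'M[R]_(N, q)) :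
  sqnorm (perp (cheb W B T)) <= rt ^+ 2 * sqnorm (perp B).
Proof.
rewrite perp_cheb; first exact: sqnorm_opnorm2.
by case: rhoT => [|->]; [left|right].
Qed.

Lemma T0_of_rate : 0 < rho -> expR (- (Num.sqrt (1 - rho) * (T0_of rho rt)%:R))
  <= (1 - rt) ^+ 2.
Proof.
move=> r0; have q0 : 0 < 1 - rt by rewrite subr_gt0 rhot_lt1.
have s0 : 0 < Num.sqrt (1 - rho) by rewrite sqrtr_gt0 subr_gt0.
have -> : (1 - rt) ^+ 2 = expR (2 * ln (1 - rt)).
  by rewrite mulrC expRM_natr lnK// posrE.
rewrite ler_expR lerNl -mulNr [leRHS]mulrC -ler_pdivrMr// /T0_of.
apply: le_trans (Num.Theory.ceil_ge _) _.
by rewrite natr_absz ler_int; exact: ler_norm.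
Qed.

Lemma T0_of_rho0 : rho = 0 -> T0_of rho rt = 0%N.
Proof.
move=> r0; have T1' : T = 1%N by case: rhoT => //; rewrite r0 ltxx.
by rewrite /T0_of T1' rhot1 r0 subr0 ln1 mulr0 mul0r ceil0.
Qed.

Let T0_case : 0 < rho \/ (T0_of rho rt <= 1)%N.
Proof.
have := opnorm2_rho_ge0; rewrite le_eqVlt => /orP[/eqP r0|]; last by left.
by right; rewrite T0_of_rho0.
Qed.

Lemma avgrow_cheb0 q (B : 'M[R]_(N, q)) :
  avgrow (cheb W B (T0_of rho rt)) = avgrow B.
Proof. exact: avgrow_cheb_gen. Qed.

(** The square of 1 / mu <= 2 exp (- sqrt (1 - rho) T0) <= 2 (1 - rt)^2. The fourth power later
    cancels the weight 1 / q^3 of the tracking error. *)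
Lemma sqnorm_perp_cheb0 q (B : 'M[R]_(N, q)) :
  sqnorm (perp (cheb W B (T0_of rho rt))) <= 4 * (1 - rt) ^+ 4 * sqnorm (perp B).
Proof.
have q0 : 0 < 1 - rt by rewrite subr_gt0 rhot_lt1.
have := opnorm2_rho_ge0; rewrite le_eqVlt => /orP[/eqP r0|r0].
  (* No round is made here, but rt = 0 leaves the factor 4. *)
  have T1' : T = 1%N by case: rhoT => //; rewrite -r0 ltxx.
  rewrite (T0_of_rho0 (esym r0)) /= T1' rhot1 -r0 subr0 expr1n mulr1.
  by rewrite ler_peMl ?sqnorm_ge0// ler1n.
rewrite perp_cheb//; apply: le_trans (sqnorm_opnorm2 _ _) _.
rewrite ler_wpM2r ?sqnorm_ge0//.
have -> : 4 * (1 - rt) ^+ 4 = (2 * (1 - rt) ^+ 2) ^+ 2 by ring.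
apply: lerXn2r; rewrite ?nnegrE ?opnorm2_ge0 ?mulr_ge0 ?exprn_ge0 ?(ltW q0)//.
apply: le_trans (opnorm2_chebmx _ r0) _.
apply: le_trans (ler_wpM2l _ (T0_of_rate r0)) => //.
rewrite expRN -[2]invrK -invfM lef_pV2 ?posrE; first exact: cheb_mu_expR.
- exact: cheb_mu_gt0.
- by rewrite mulr_gt0 ?expR_gt0.
Qed.

End Rates.

End Mixing.

(** * Proximal mapping and smoothness *)

Section Prox.
Context (R : realType) (p : nat) (r : 'rV[R]_p -> \bar R).
Hypothesis rNy : forall x, (-oo < r x)%E.
Hypothesis rconv : forall (x y : 'rV[R]_p) (t : R), 0 <= t <= 1 ->
  (r (t *: x + (1 - t) *: y) <= t%:E * r x + (1 - t)%:E * r y)%E.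
Hypothesis rprox : forall (eta : R) (v : 'rV[R]_p), 0 < eta ->
  exists u, is_prox (scale_fun eta r) v u.
Variable w0 : 'rV[R]_p.
Hypothesis w0dom : (r w0 < +oo)%E.

Definition dom_reg : set 'rV[R]_p := [set x | (r x < +oo)%E].
(** Real-valued regularizer, meaningful on [dom_reg] only; the inequalities below compare points of
    the domain. *)
Definition reg (x : 'rV[R]_p) : R := fine (r x).

Lemma regE x : dom_reg x -> r x = (reg x)%:E.
Proof. by move=> rx; rewrite /reg fineK// fin_numElt rNy. Qed.

Lemma dom_reg_conv x y t : 0 <= t <= 1 -> dom_reg x -> dom_reg y ->
  dom_reg (t *: x + (1 - t) *: y) /\
  reg (t *: x + (1 - t) *: y) <= t * reg x + (1 - t) * reg y.
Proof.
move=> t01 dx dy; have := rconv x y t01.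
rewrite (regE dx) (regE dy) -!EFinM -EFinD => h.
have d : dom_reg (t *: x + (1 - t) *: y) by apply: le_lt_trans h _; exact: ltry.
by split=> //; rewrite -lee_fin -regE.
Qed.

Lemma prox_spec (eta : R) v : 0 < eta ->
  is_prox (scale_fun eta r) v (prox (scale_fun eta r) v).
Proof. by move=> e0; have [u hu] := rprox v e0; rewrite /prox; exact: (xgetI _ hu). Qed.

(** Comparison with the point [w0] of the domain excludes the value +oo. *)
Lemma dom_reg_prox (eta : R) v : 0 < eta -> dom_reg (prox (scale_fun eta r) v).
Proof.
move=> e0; have := prox_spec v e0 w0; set u := prox _ _.
rewrite /scale_fun (regE w0dom) -EFinM -EFinD => h.
rewrite /dom_reg /= ltNge leye_eq; apply/negP => /eqP ry.
by move: h; rewrite ry gt0_muley ?lte_fin// addye// leye_eq.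
Qed.

(** First-order optimality without subgradients: compare u with t w + (1 - t) u for t = 1 / k,
    divide by t and let k grow. *)
Lemma prox_ineq (eta : R) v w : 0 < eta -> dom_reg w ->
  eta * (reg (prox (scale_fun eta r) v) - reg w)
  <= ip (v - prox (scale_fun eta r) v) (prox (scale_fun eta r) v - w).
Proof.
move=> e0 dw; set u := prox _ v; rewrite -subr_le0.
apply: (@le0_archi _ _ (2^-1 * sqnorm (w - u))) => k k0.
have kR : 0 < k%:R :> R by rewrite ltr0n.
pose t : R := k%:R^-1.
have t01 : 0 <= t <= 1 by rewrite invr_ge0 ltW//= invf_le1// ler1n.
have du : dom_reg u by exact: dom_reg_prox.
have [dt ct] := dom_reg_conv t01 dw du.
have := prox_spec v e0 (t *: w + (1 - t) *: u).
rewrite -/u /scale_fun (regE du) (regE dt) -!EFinM -!EFinD lee_fin.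
have -> : t *: w + (1 - t) *: u - v = (u - v) + t *: (w - u).
  by apply/matrixP => i j; rewrite !mxE; ring.
rewrite (sqnormD (u - v)) sqnormZ ipZr.
have := ler_wpM2l (ltW e0) ct.
have -> : ip (v - u) (u - w) = ip (u - v) (w - u).
  by rewrite -[v - u]opprB -[u - w]opprB ipNl ipNr opprK.
move: (sqnorm (w - u)) (sqnorm _) (ip _ _) (reg u) (reg w) (reg _) => a b c U V X.
have tk : t * k%:R = 1 by rewrite mulVf ?lt0r_neq0.
have t0 : 0 < t by rewrite invr_gt0.
move=> h1 h2.
have : eta * (t * (U - V)) <= t * c + 2^-1 * (t ^+ 2 * a) by lra.
have -> : eta * (t * (U - V)) = t * (eta * (U - V)) by ring.
have -> : t * c + 2^-1 * (t ^+ 2 * a) = t * (c + 2^-1 * t * a) by ring.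
rewrite ler_pM2l// => h.
have : (eta * (U - V) - c) * k%:R <= (2^-1 * t * a) * k%:R.
  rewrite ler_wpM2r ?(ltW kR)//; lra.
have -> : 2^-1 * t * a * k%:R = 2^-1 * a * (t * k%:R) by ring.
by rewrite tk mulr1.
Qed.

(** Add the variational inequalities of the two points, each tested at the other. *)
Lemma prox_nonexp (eta : R) v1 v2 : 0 < eta ->
  sqnorm (prox (scale_fun eta r) v1 - prox (scale_fun eta r) v2)
  <= sqnorm (v1 - v2).
Proof.
move=> e0; set u1 := prox _ v1; set u2 := prox _ v2.
have h1 : eta * (reg u1 - reg u2) <= ip (v1 - u1) (u1 - u2).
  exact: (prox_ineq v1 e0 (dom_reg_prox v2 e0)).
have h2 : eta * (reg u2 - reg u1) <= ip (v2 - u2) (u2 - u1).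
  exact: (prox_ineq v2 e0 (dom_reg_prox v1 e0)).
have := ip_young1 (v1 - v2) (u1 - u2); clearbody u1 u2.
have : ip (v1 - u1) (u1 - u2) + ip (v2 - u2) (u2 - u1)
     = ip (v1 - v2) (u1 - u2) - sqnorm (u1 - u2).
  rewrite -[u2 - u1]opprB ipNr -ipBl -ip_self -ipBl; congr ip.
  by apply/matrixP => i j; rewrite !mxE; ring.
move: h1 h2; lra.
Qed.

(** Transfers stationarity from the step al to any larger eta. The variational inequalities of u1
    and u2, tested at each other, give al |p1|^2 + eta |p2|^2 <= (al + eta) <p1, p2>. *)
Lemma prox_grad_map_mono (x g : 'rV[R]_p) (al eta : R) : 0 < al -> al <= eta ->
  sqnorm (prox_grad_map r x g eta) <= sqnorm (prox_grad_map r x g al).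
Proof.
move=> a0 ae; have e0 : 0 < eta := lt_le_trans a0 ae.
set p1 := prox_grad_map r x g al; set p2 := prox_grad_map r x g eta.
set u1 := prox (scale_fun al r) (x - al *: g).
set u2 := prox (scale_fun eta r) (x - eta *: g).
have a0' : al != 0 by exact: lt0r_neq0.
have e0' : eta != 0 by exact: lt0r_neq0.
have eu1 : u1 = x - al *: p1.
  by rewrite /p1 /prox_grad_map scalerA divff// scale1r opprB addrC subrK.
have eu2 : u2 = x - eta *: p2.
  by rewrite /p2 /prox_grad_map scalerA divff// scale1r opprB addrC subrK.
have h1 := prox_ineq (x - al *: g) a0 (dom_reg_prox (x - eta *: g) e0).
have h2 := prox_ineq (x - eta *: g) e0 (dom_reg_prox (x - al *: g) a0).
move: h1 h2; rewrite -/u1 -/u2.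
have -> : x - al *: g - u1 = al *: (p1 - g).
  by rewrite eu1; apply/matrixP => i j; rewrite !mxE; ring.
have -> : x - eta *: g - u2 = eta *: (p2 - g).
  by rewrite eu2; apply/matrixP => i j; rewrite !mxE; ring.
move=> h1 h2; rewrite ipZl (ler_pM2l a0) in h1; rewrite ipZl (ler_pM2l e0) in h2.
clearbody u1 u2 p1 p2.
have : 0 <= ip (p1 - g) (u1 - u2) + ip (p2 - g) (u2 - u1) by move: h1 h2; lra.
have -> : ip (p1 - g) (u1 - u2) + ip (p2 - g) (u2 - u1)
    = (al + eta) * ip p1 p2 - al * sqnorm p1 - eta * sqnorm p2.
  have -> : u2 - u1 = al *: p1 - eta *: p2.
    by rewrite eu1 eu2; apply/matrixP => i j; rewrite !mxE; ring.
  have -> : u1 - u2 = eta *: p2 - al *: p1.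
    by rewrite eu1 eu2; apply/matrixP => i j; rewrite !mxE; ring.
  by rewrite -!ip_self !ip_lin (ipC p2 p1); ring.
have := cauchy_schwarz p1 p2; have := sqnorm_ge0 p1; have := sqnorm_ge0 p2.
move: (sqnorm p1) (sqnorm p2) (ip p1 p2) => a b c b0 a0'' cs h.
(* If |p2| > |p1|, both factors of the difference computed in [e] are positive, against
   Cauchy-Schwarz. *)
rewrite leNgt; apply/negP => ab.
have s0 : 0 <= al * a + eta * b by rewrite addr_ge0// mulr_ge0// ltW.
have sq : (al * a + eta * b) ^+ 2 <= (al + eta) ^+ 2 * (a * b).
  apply: (@le_trans _ _ (((al + eta) * c) ^+ 2)).
    by apply: lerXn2r; rewrite ?nnegrE//; lra.
  by rewrite exprMn ler_wpM2l ?sqr_ge0.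
have e : (al * a + eta * b) ^+ 2 - (al + eta) ^+ 2 * (a * b)
  = (b - a) * (eta ^+ 2 * b - al ^+ 2 * a) by ring.
have : 0 < (b - a) * (eta ^+ 2 * b - al ^+ 2 * a).
  rewrite mulr_gt0 ?subr_gt0//; apply: le_lt_trans (_ : al ^+ 2 * a <= eta ^+ 2 * a) _.
    by rewrite ler_wpM2r//; apply: lerXn2r; rewrite ?nnegrE// ltW.
  by rewrite ltr_pM2l// exprn_gt0.
lra.
Qed.

(** Jensen for equal weights; it also keeps the averaged iterate in the domain of r. *)
Lemma reg_mean k (F : 'I_k -> 'rV[R]_p) : (0 < k)%N ->
  (forall s, dom_reg (F s)) ->
  dom_reg (k%:R^-1 *: \sum_s F s) /\
  reg (k%:R^-1 *: \sum_s F s) <= k%:R^-1 * \sum_s reg (F s).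
Proof.
case: k F => // k F _; elim: k F => [|k IH] F dF.
  by rewrite !big_ord1 invr1 scale1r mul1r.
rewrite big_ord_recr [\sum_(s < k.+2) reg _]big_ord_recr/=.
have [|d h] := IH (fun s => F (widen_ord (leqnSn k.+1) s)).
  by move=> s; exact: dF.
pose t : R := k.+1%:R / k.+2%:R.
have k1 : k.+1%:R != 0 :> R by rewrite pnatr_eq0.
have k2 : k.+2%:R != 0 :> R by rewrite pnatr_eq0.
have et : 1 - t = k.+2%:R^-1.
  by rewrite /t -{1}(divff k2) -mulrBl -natrB// subSnn mul1r.
have t01 : 0 <= t <= 1.
  by rewrite divr_ge0//= ler_pdivrMr ?ltr0n// mul1r ler_nat.
have [d' h'] := dom_reg_conv t01 d (dF ord_max).
move: d' h'; rewrite et scalerA.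
have tk : t * k.+1%:R^-1 = k.+2%:R^-1 by rewrite /t mulrAC divff// mul1r.
rewrite tk -scalerDr => d' h'; split=> //; apply: le_trans h' _.
rewrite mulrDr lerD2r; case/andP: t01 => t0 _.
apply: le_trans (ler_wpM2l t0 h) _.
by rewrite mulrA tk.
Qed.

End Prox.

(** * Smooth functions *)

Section Smooth.
Context (R : realType) (p : nat).
Implicit Types (f : 'rV[R]_p -> R) (x y v : 'rV[R]_p).

Lemma derive_grad f x v : differentiable f x -> 'D_v f x = ip (grad f x) v.
Proof.
move=> df; rewrite deriveE// [in LHS](row_sum_delta v) linear_sum/=.
rewrite /ip big_ord1; apply: eq_bigr => j _.
by rewrite linearZ/= mxE deriveE// mulrC.
Qed.

Lemma is_derive_line f x v (t : R) : differentiable f (x + t *: v) ->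
  is_derive t 1 (fun t => f (x + t *: v)) ('D_v f (x + t *: v)).
Proof.
move=> df.
have E : (fun h : R => h^-1 *: (((fun t => f (x + t *: v)) \o shift t) (h *: 1)
    - f (x + t *: v))) =
  (fun h : R => h^-1 *: ((f \o shift (x + t *: v)) (h *: v) - f (x + t *: v))).
  apply/funext => h /=; congr (_ *: (f _ - _)).
  by rewrite -[h *: 1]/(h * 1) mulr1 scalerDl addrCA.
split; first by rewrite /derivable E; exact: diff_derivable.
by rewrite /derive E.
Qed.

Lemma descent f (L : R) x y : 0 <= L ->
  (forall x, differentiable f x) ->
  (forall a b, sqnorm (grad f a - grad f b) <= L ^+ 2 * sqnorm (a - b)) ->
  f y <= f x + ip (grad f x) (y - x) + L / 2 * sqnorm (y - x).
Proof.
have aux (a b c t : R) :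
    a - b <= L * t * c -> a - (b + L / 2 * c * (t *+ 2)) <= 0.
  by move=> h; lra.
move=> L0 df lip; set v := y - x.
(* The quadratic model is subtracted along the segment: the Lipschitz gradient makes [dg]
   nonpositive, and the mean value theorem gives g 1 <= g 0. *)
pose g (t : R) : R := f (x + t *: v) - (ip (grad f x) v * t + L / 2 * sqnorm v * t ^+ 2).
pose dg (t : R) : R := 'D_v f (x + t *: v)
  - (ip (grad f x) v + L / 2 * sqnorm v * (t *+ 2)).
have gd (t : R) : is_derive t (1 : R) (g : R -> R) (dg t : R).
  have h1 := @is_derive_line f x v t (df _).
  have -> : g = (fun t => f (x + t *: v))
      - (ip (grad f x) v \*: (@id R) + (L / 2 * sqnorm v) \*: ((@id R) * (@id R))).
    by apply/funext => s; rewrite /g expr2.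
  apply: is_deriveB.
  apply: is_derive_eq.
  by rewrite -![_ *: _]/(_ * _) !mulr1 mulr2n.
have [|t] := @MVT_segment R g dg 0 1 ler01 (fun t _ => gd t).
  apply: continuous_subspaceT => t.
  by apply: differentiable_continuous; apply/derivable1_diffP; have [] := gd t.
rewrite in_itv/= => /andP[t0 t1]; rewrite subr0 mulr1 => e.
suff d0 : dg t <= 0.
  have : g 1 <= g 0 by rewrite -subr_le0 e.
  have xv : x + v = y by rewrite /v addrC subrK.
  rewrite /g scale1r scale0r addr0 xv expr1n expr0n /= !mulr0 !mulr1 addr0 subr0.
  rewrite lerBlDr addrA; exact.
rewrite /dg derive_grad//.
have : ip (grad f (x + t *: v) - grad f x) v <= L * t * sqnorm v.
  have n0 : 0 <= L * t * sqnorm v by rewrite !mulr_ge0 ?sqnorm_ge0.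
  rewrite -[leRHS](ger0_norm n0); apply: le_trans (ler_norm _) _.
  rewrite -ler_sqr ?nnegrE ?normr_ge0// !real_normK ?num_real//.
  apply: le_trans (cauchy_schwarz _ _) _.
  have := lip (x + t *: v) x; rewrite [x + _]addrC addrK sqnormZ => h.
  have := ler_wpM2r (sqnorm_ge0 v) h; congr (_ <= _); ring.
by rewrite ipBl; exact: aux.
Qed.

End Smooth.

(** * Integration *)

Definition L1 d (T : measurableType d) (R : realType) (P : probability T R)
  (f : T -> R) : Prop := P.-integrable setT (EFin \o f).

(** Integrability of the square does not imply measurability of f, hence the separate clause. *)
Definition L2 d (T : measurableType d) (R : realType) (P : probability T R)
  (f : T -> R) : Prop :=
  measurable_fun setT f /\ L1 P (fun w => f w ^+ 2).

(** The integral of a nonnegative function is a supremum over simple functions below it. This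
    monotonicity is applied to the stationarity measure, whose measurability is unknown. *)
Lemma lower_integral_le d (T : measurableType d) (R : realType)
    (mu : {measure set T -> \bar R}) (f g : T -> \bar R) :
  (forall x, 0 <= f x)%E -> (forall x, f x <= g x)%E ->
  (\int[mu]_x f x <= \int[mu]_x g x)%E.
Proof.
move=> f0 fg; have g0 x : (0 <= g x)%E by exact: le_trans (fg x).
rewrite !ge0_integralTE//; apply: le_ereal_sup.
by move=> _ [h hf <-]; exists h => // x; exact: le_trans (hf x) (fg x).
Qed.

Section Expectation.
Context d (T : measurableType d) (R : realType) (P : probability T R).
Implicit Types f g : T -> R.
Local Notation Ex f := (\int[P]_w f w).

Lemma L1_measurable f : L1 P f -> measurable_fun setT f.
Proof. by move=> /measurable_int; move/measurable_EFinP. Qed.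

Lemma L1_cst c : L1 P (fun=> c).
Proof. exact: finite_measure_integrable_cst. Qed.

Lemma L1D f g : L1 P f -> L1 P g -> L1 P (fun w => f w + g w).
Proof. by move=> h1 h2; have := integrableD measurableT h1 h2. Qed.

Lemma L1Z c f : L1 P f -> L1 P (fun w => c * f w).
Proof. by move=> h1; have := integrableZl measurableT c h1. Qed.

Lemma L1B f g : L1 P f -> L1 P g -> L1 P (fun w => f w - g w).
Proof. by move=> h1 h2; have := integrableB measurableT h1 h2. Qed.

Lemma L1_sum I (r : seq I) (F : I -> T -> R) :
  (forall i, L1 P (F i)) -> L1 P (fun w => \sum_(i <- r) F i w).
Proof.
move=> h; elim: r => [|i r IH].
  by under [X in L1 P X]eq_fun do rewrite big_nil; exact: L1_cst.
by under [X in L1 P X]eq_fun do rewrite big_cons; exact: L1D.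
Qed.

Lemma L1_le f g : measurable_fun setT f -> (forall w, `|f w| <= g w) ->
  L1 P g -> L1 P f.
Proof.
move=> mf fg; apply: le_integrable => //; first exact/measurable_EFinP.
move=> w _ /=; rewrite lee_fin; apply: le_trans (fg w) _; exact: ler_norm.
Qed.

Lemma ExE f : L1 P f -> (\int[P]_w (f w)%:E)%E = (Ex f)%:E.
Proof. by move=> h; rewrite /Rintegral fineK//; exact: integrable_fin_num. Qed.

Lemma ExD f g : L1 P f -> L1 P g -> Ex (fun w => f w + g w) = Ex f + Ex g.
Proof. exact: RintegralD. Qed.

Lemma ExB f g : L1 P f -> L1 P g -> Ex (fun w => f w - g w) = Ex f - Ex g.
Proof. exact: RintegralB. Qed.

Lemma ExZ c f : L1 P f -> Ex (fun w => c * f w) = c * Ex f.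
Proof. by move=> h; exact: RintegralZl. Qed.

Lemma Ex_cst c : Ex (fun=> c) = c.
Proof. by rewrite Rintegral_cst//= probability_setT mulr1. Qed.

Lemma Ex_sum I (r : seq I) (F : I -> T -> R) : (forall i, L1 P (F i)) ->
  Ex (fun w => \sum_(i <- r) F i w) = \sum_(i <- r) Ex (F i).
Proof.
move=> h; elim: r => [|i r IH].
  rewrite big_nil; under eq_Rintegral do rewrite big_nil; exact: Ex_cst.
rewrite big_cons; under eq_Rintegral do rewrite big_cons.
by rewrite ExD ?IH//; exact: L1_sum.
Qed.

Lemma Ex_le f g : L1 P f -> L1 P g -> (forall w, f w <= g w) -> Ex f <= Ex g.
Proof. by move=> h1 h2 fg; exact: le_Rintegral. Qed.

Lemma Ex_ge0 f : (forall w, 0 <= f w) -> 0 <= Ex f.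
Proof. by move=> f0; exact: Rintegral_ge0. Qed.

(** Converts the assumptions, which bound extended integrals, into statements on real
    expectations. *)
Lemma L1_bounded f c : measurable_fun setT f -> (forall w, 0 <= f w) ->
  (\int[P]_w (f w)%:E <= c%:E)%E -> L1 P f /\ Ex f <= c.
Proof.
move=> mf f0 fc; have h : L1 P f.
  apply/integrableP; split; first exact/measurable_EFinP.
  rewrite (eq_integral (fun w => (f w)%:E)).
    by apply: le_lt_trans fc _; exact: ltry.
  by move=> w _ /=; rewrite ger0_norm.
by split=> //; rewrite -lee_fin -ExE.
Qed.

Lemma L2_le f g : measurable_fun setT f -> (forall w, f w ^+ 2 <= g w) ->
  L1 P g -> L2 P f.
Proof.
move=> mf fg hg; split=> //; apply: L1_le hg; first exact: measurable_funX.
by move=> w; rewrite ger0_norm ?sqr_ge0.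
Qed.

Lemma L2_cst c : L2 P (fun=> c).
Proof. by split; [exact: measurable_cst|exact: L1_cst]. Qed.

Lemma L2D f g : L2 P f -> L2 P g -> L2 P (fun w => f w + g w).
Proof.
move=> [mf hf] [mg hg].
apply: (@L2_le _ (fun w => 2 * f w ^+ 2 + 2 * g w ^+ 2)).
- exact: measurable_funD.
- by move=> w; have := sqr_ge0 (f w - g w); lra.
- by apply: L1D; exact: L1Z.
Qed.

Lemma L2Z c f : L2 P f -> L2 P (fun w => c * f w).
Proof.
move=> [mf hf]; apply: (@L2_le _ (fun w => c ^+ 2 * f w ^+ 2)).
- by apply: measurable_funM => //; exact: measurable_cst.
- by move=> w; rewrite exprMn.
- exact: L1Z.
Qed.

Lemma L2_sum I (r : seq I) (F : I -> T -> R) :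
  (forall i, L2 P (F i)) -> L2 P (fun w => \sum_(i <- r) F i w).
Proof.
move=> h; elim: r => [|i r IH].
  by under [X in L2 P X]eq_fun do rewrite big_nil; exact: L2_cst.
by under [X in L2 P X]eq_fun do rewrite big_cons; exact: L2D.
Qed.

Lemma L2M f g : L2 P f -> L2 P g -> L1 P (fun w => f w * g w).
Proof.
move=> [mf hf] [mg hg]; apply: (@L1_le _ (fun w => f w ^+ 2 + g w ^+ 2)).
- exact: measurable_funM.
- move=> w; rewrite normrM -[f w ^+ 2]real_normK ?num_real// -[g w ^+ 2]real_normK ?num_real//.
  have := sqr_ge0 (`|f w| - `|g w|); have := normr_ge0 (f w).
  have := normr_ge0 (g w); move: `|f w| `|g w| => a b; nra.
- exact: L1D.
Qed.

Lemma L2_L1 f : L2 P f -> L1 P f.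
Proof.
move=> hf; have := L2M hf (L2_cst 1).
by under [X in L1 P X -> _]eq_fun do rewrite mulr1.
Qed.

(** Integrate the tangent inequality 2 c f - c^2 <= f^2 at the mean c. *)
Lemma Ex_sqr_le f : L2 P f -> Ex f ^+ 2 <= Ex (fun w => f w ^+ 2).
Proof.
move=> hf; set c := Ex f; have h1 := L2_L1 hf.
have -> : c ^+ 2 = Ex (fun w => 2 * c * f w - c ^+ 2).
  have hz : L1 P (fun w => 2 * c * f w) by exact: L1Z.
  by rewrite ExB//; [rewrite ExZ// Ex_cst -/c; ring|exact: L1_cst].
apply: Ex_le; [by apply: L1B; [exact: L1Z|exact: L1_cst]|by case: hf|].
by move=> w; have := sqr_ge0 (f w - c); lra.
Qed.

End Expectation.

(** * Conditional centering and orthogonality *)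

Section Orthogonality.
Context d (T : measurableType d) (R : realType) (P : probability T R).
Variable G : set (set T).
Hypothesis Gm : <<s G>> `<=` measurable.
Local Notation Ex f := (\int[P]_w f w).

Definition adapted (f : T -> R) : Prop :=
  measurable_fun [set: g_sigma_algebraType G] (f : g_sigma_algebraType G -> R).

Lemma adapted_measurable f : adapted f -> measurable_fun setT f.
Proof.
move=> mf _ B mB; apply: Gm; exact: (mf measurableT B mB).
Qed.

(* The conditional expectation of Z given the sigma-algebra of G vanishes. *)
Definition mean_zero_given (Z : T -> R) : Prop :=
  forall F, <<s G>> F -> \int[P]_(w in F) Z w = 0.

Variable Z : T -> R.
Hypothesis Z2 : L2 P Z.
Hypothesis Zc : mean_zero_given Z.

Let Ex_indic F : <<s G>> F -> Ex (fun w => \1_F w * Z w) = 0.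
Proof.
move=> /[dup] GF /Zc <-; rewrite [RHS]Rintegral_mkcond; apply: eq_Rintegral.
by move=> w _; rewrite patchE indicE; case: ifP; rewrite ?mul1r ?mul0r.
Qed.

Let L1_indic F : <<s G>> F -> L1 P (fun w => \1_F w * Z w).
Proof.
move=> GF; apply: (@L1_le _ _ _ _ _ (fun w => `|Z w|)).
- apply: measurable_funM; last exact: (proj1 Z2).
  by apply: measurable_indic; exact: Gm.
- move=> w; rewrite normrM indicE; case: (w \in F) => /=.
    by rewrite normr1 mul1r.
  by rewrite normr0 mul0r.
- exact: integrable_norm (L2_L1 Z2).
Qed.

Import HBNNSimple.

Let Ex_nnsfun (s : {nnsfun (g_sigma_algebraType G) >-> R}) :
  Ex (fun w => s w * Z w) = 0.
Proof.
have E w : s w * Z w = \sum_(y <- finmap.enum_fset (fset_set (range s)))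
    y * (\1_(s @^-1` [set y]) w * Z w).
  rewrite {1}(fimfunE s w) fsbig_finite//= mulr_suml.
  by apply: eq_bigr => y _; rewrite mulrA.
have GF y : <<s G>> (s @^-1` [set y]).
  exact: (measurable_funPTI s (measurable_set1 y)).
under eq_Rintegral do rewrite E.
rewrite (@Ex_sum _ _ _ P); last by move=> y; apply: L1Z; exact: L1_indic.
by rewrite big1// => y _; rewrite ExZ ?Ex_indic ?mulr0//; exact: L1_indic.
Qed.

Let Ex_ge0_orth h : adapted h -> L2 P h -> (forall w, 0 <= h w) ->
  Ex (fun w => h w * Z w) = 0.
Proof.
move=> ah h2 h0.
have mh : measurable_fun [set: g_sigma_algebraType G] (EFin \o h).
  exact/measurable_EFinP.
pose s n := nnsfun_approx measurableT mh n.
have sh w : EFin \o s^~ w @ \oo --> (h w)%:E.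
  by apply: (cvg_nnsfun_approx measurableT mh) => // x _; rewrite lee_fin.
have s_le n w : s n w <= h w.
  have cs : s^~ w @ \oo --> h w by exact: (fine_cvg (sh w)).
  rewrite -(cvg_lim _ cs)//; apply: nondecreasing_cvgn_le.
    by move=> a b ab; exact/lefP/(nd_nnsfun_approx measurableT mh ab).
  by apply/cvg_ex; exists (h w).
have hZ : L1 P (fun w => h w * Z w) by exact: L2M.
have as_ n : measurable_fun [set: T] (s n).
  by apply: adapted_measurable; exact: measurable_funP.
(* The approximations [s n] stay below h, so |h Z| dominates all the products. *)
have [] := @dominated_convergence _ T R P setT measurableT
  (fun n w => (s n w * Z w)%:E) (fun w => (h w * Z w)%:E)
  (fun w => (`|h w * Z w|)%:E).
- by move=> n; apply/measurable_EFinP; apply: measurable_funM => //; case: Z2.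
- exact/measurable_EFinP/L1_measurable/hZ.
- apply: aeW => w _; rewrite [X in _ --> X]EFinM.
  have -> : (fun n => (s n w * Z w)%:E) = (fun n => (EFin \o s^~ w) n * (Z w)%:E)%E.
    by apply/funext => n; rewrite /= EFinM.
  by apply: cvgeZr => //; exact: sh.
- exact: integrable_norm.
- apply: aeW => w n _; rewrite lee_fin !normrM ler_wpM2r// !ger0_norm//.
move=> _ _ /cvg_lim H.
rewrite /Rintegral -H// (_ : (fun n => _) = cst 0%E) ?lim_cst//.
apply/funext => n /=; rewrite ExE ?Ex_nnsfun//.
apply: (@L1_le _ _ _ _ _ (fun w => `|h w * Z w|)).
- by apply: measurable_funM => //; case: Z2.
- by move=> w; rewrite !normrM ler_wpM2r// !ger0_norm.
- exact: integrable_norm.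
Qed.

(** Extends the definition from indicators of past events to simple functions, to nonnegative h by
    limits, then to both parts of h. Square integrability makes every product integrable. *)
Lemma mean_zero_orth h : adapted h -> L2 P h -> Ex (fun w => h w * Z w) = 0.
Proof.
move=> ah h2; have mh := adapted_measurable ah.
have E w : h w * Z w = h^\+ w * Z w - h^\- w * Z w.
  by rewrite -mulrBl -{1}(funrposBneg h).
have p2 : L2 P h^\+.
  apply: (@L2_le _ _ _ _ _ (fun w => h w ^+ 2)); [exact: measurable_funrpos| |by case: h2].
  move=> w; rewrite /funrpos /Num.max; case: ifP => // _.
  by rewrite expr0n sqr_ge0.
have n2 : L2 P h^\-.
  apply: (@L2_le _ _ _ _ _ (fun w => h w ^+ 2)); [exact: measurable_funrneg| |by case: h2].
  move=> w; rewrite /funrneg /Num.max; case: ifP => // _.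
  - by rewrite expr0n sqr_ge0.
  - by rewrite sqrrN.
under eq_Rintegral do rewrite E.
rewrite ExB ?Ex_ge0_orth ?subr0//; try exact: L2M.
- by apply: measurable_funrneg; exact: ah.
- by apply: measurable_funrpos; exact: ah.
Qed.

End Orthogonality.

(** * Freezing the past *)

Section Freezing.
Context d (T : measurableType d) (R : realType) (P : probability T R).
Variable G : set (set T).
Hypothesis Gm : <<s G>> `<=` measurable.
Context d' (E : measurableType d') (zeta : T -> E) (nu : probability E R).
Hypothesis mzeta : measurable_fun setT zeta.

(** The case F = setT says that nu is the law of zeta. *)
Definition independent_of : Prop := forall F (B : set E), <<s G>> F ->
  measurable B -> P (F `&` zeta @^-1` B) = (P F * nu B)%E.

Hypothesis ind : independent_of.

Let TG := g_sigma_algebraType G.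
(** The identity into the coarser measurable space represents the past as a random variable, with
    law [PG]. *)
Let toG : T -> TG := id.
Let mtoG : measurable_fun setT toG.
Proof. by move=> _ B mB; rewrite setTI; exact: Gm. Qed.

Let joint : T -> TG * E := fun w => (toG w, zeta w).
Let mjoint : measurable_fun setT joint.
Proof. exact: measurable_fun_pair. Qed.

Let toG_mixin := isMeasurableFun.Build _ _ _ _ _ mtoG.
Let X1 : {mfun T >-> TG} := HB.pack toG toG_mixin.
Let joint_mixin := isMeasurableFun.Build _ _ _ _ _ mjoint.
Let X2 : {mfun T >-> (TG * E)%type} := HB.pack joint joint_mixin.
Let PG : probability TG R := distribution P X1.
Let PJ : probability (TG * E)%type R := distribution P X2.

(** Independence is the product formula on rectangles, which determine the joint law. *)
Let joint_product (A : set (TG * E)) : measurable A -> (PG \x nu)%E A = PJ A.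
Proof.
move=> mA; apply: product_measure_unique => // F B mF mB; exact: ind.
Qed.

Let integral_joint (f : TG * E -> \bar R) :
  (\int[PJ]_x f x = \int[PG \x nu]_x f x)%E.
Proof.
by apply: eq_measure_integral => A mA _; apply/esym; exact: joint_product.
Qed.

Lemma freeze_ge0 (f : TG * E -> \bar R) : measurable_fun setT f ->
  (forall x, 0 <= f x)%E ->
  (\int[P]_w f (w, zeta w) = \int[P]_w \int[nu]_z f (w, z))%E.
Proof.
move=> mf f0; transitivity (\int[PJ]_x f x)%E.
  by rewrite (ge0_integral_distribution X2 mf f0).
rewrite integral_joint fubini_tonelli1//.
rewrite (ge0_integral_distribution X1)//.
- exact: measurable_fun_fubini_tonelli_F.
- by move=> w; exact: integral_ge0.
Qed.

(** Lets a bound assumed at every fixed point be used at a random point determined by the past: w is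
    frozen and only the sample is integrated. *)
Lemma freeze_le (f : TG * E -> R) (g : T -> R) : measurable_fun setT f ->
  (forall x, 0 <= f x) ->
  (forall w, \int[nu]_z (f (w, z))%:E <= (g w)%:E)%E -> L1 P g ->
  L1 P (fun w => f (w, zeta w)) /\
  \int[P]_w f (w, zeta w) <= \int[P]_w g w.
Proof.
move=> mf f0 fg g1; have mF : measurable_fun setT (EFin \o f) by exact/measurable_EFinP.
have mfz : measurable_fun setT (fun w => f (w, zeta w)).
  exact: (measurableT_comp mf mjoint).
apply: L1_bounded => //; rewrite (freeze_ge0 mF) => [|x]; last by rewrite lee_fin.
rewrite -ExE//; apply: lower_integral_le => // w; apply: integral_ge0 => z _.
by rewrite lee_fin.
Qed.

Lemma freeze_mean_zero (f : TG * E -> R) : measurable_fun setT f ->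
  L1 P (fun w => f (w, zeta w)) ->
  (forall w, \int[nu]_z (f (w, z))%:E = 0)%E ->
  mean_zero_given P G (fun w => f (w, zeta w)).
Proof.
move=> mf f1 fz F GF.
pose h (x : TG * E) : R := \1_F x.1 * f x.
have mh : measurable_fun setT h.
  apply: measurable_funM => //; apply: (measurableT_comp _ measurable_fst).
  exact: (@measurable_indic _ TG).
have hj w : h (w, zeta w) = if w \in F then f (w, zeta w) else 0.
  by rewrite /h /= indicE; case: (w \in F); rewrite ?mul1r ?mul0r.
have -> : \int[P]_(w in F) f (w, zeta w) = \int[P]_w h (w, zeta w).
  by rewrite Rintegral_mkcond; apply: eq_Rintegral => w _; rewrite hj patchE.
have h1 : L1 P (fun w => h (w, zeta w)).
  apply: (@L1_le _ _ _ _ _ (fun w => `|f (w, zeta w)|)).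
  - exact: (measurableT_comp mh mjoint).
  - by move=> w; rewrite hj; case: ifP => // _; rewrite normr0.
  - exact: integrable_norm.
have mH : measurable_fun setT (EFin \o h) by exact/measurable_EFinP.
have iJ : PJ.-integrable setT (EFin \o h) by exact: (integrable_pushforward mjoint).
have iP : (PG \x nu)%E.-integrable setT (EFin \o h).
  apply/integrableP; split=> //; rewrite -integral_joint.
  by case/integrableP : iJ.
apply: EFin_inj; rewrite -ExE//.
transitivity (\int[PJ]_x (h x)%:E)%E.
  by rewrite (integral_distribution (X := X2) mH).
rewrite integral_joint -integral12_prod_meas1// integral0_eq// => w _.
rewrite /fubini_F /= /h /= indicE; case: (w \in F).
  by under eq_integral do rewrite mul1r.
by apply: integral0_eq => z _; rewrite mul0r.
Qed.

End Freezing.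

(** * Measurability at random points *)

Section Caratheodory.
Context d (T : measurableType d) d' (E : measurableType d') (R : realType).
Context (p : nat) (X : T -> 'rV[R]_p) (zeta : T -> E).
Hypothesis mX : forall j, measurable_fun setT (fun w => X w 0 j).
Hypothesis mzeta : measurable_fun setT zeta.

(** Rounding to mesh 1 / (n + 1): the rounded point takes countably many values, each on a
    measurable set. *)
Let grid n (c : 'rV[int]_p) : 'rV[R]_p := \row_j ((c 0 j)%:~R / n.+1%:R).
Let cell n (w : T) : 'rV[int]_p := \row_j Num.floor (X w 0 j * n.+1%:R).

Let measurable_cell n c : measurable (cell n @^-1` [set c]).
Proof.
have -> : cell n @^-1` [set c] = \bigcap_(j in [set: 'I_p])
    ((fun w => X w 0 j * n.+1%:R) @^-1` `[(c 0 j)%:~R, (c 0 j + 1)%:~R[%classic).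
  apply/seteqP; split=> w /=.
    move=> <- j _ /=; rewrite mxE in_itv/=; exact: floor_itv.
  move=> h; apply/rowP => j; rewrite mxE; apply/eqP; rewrite floor_eq.
  by have := h j I; rewrite /= in_itv.
apply: fin_bigcap_measurable => // j _; rewrite -[X in measurable X]setTI.
by apply: measurable_funM => //; exact: measurable_cst.
Qed.

Let cvg_grid w : (fun n => grid n (cell n w)) @ \oo --> X w.
Proof.
apply/cvg_ballP => e e0; near=> n; split=> // i j.
rewrite (ord1 i) !mxE; set x := X w 0 j.
have /andP[h1 h2] := floor_itv (x * n.+1%:R).
have n0 : 0 < n.+1%:R :> R by rewrite ltr0n.
rewrite /ball /= ger0_norm; last by rewrite subr_ge0 ler_pdivrMr.
rewrite ltrBlDr -ltrBlDl ltr_pdivlMr//.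
apply: lt_le_trans (_ : x * n.+1%:R - 1 <= _); last first.
  by rewrite lerBlDr ltW//; move: h2; rewrite intrD.
rewrite mulrBl ltrD2l ltrN2 -ltr_pdivrMr// div1r.
by near: n; exact: (near_infty_natSinv_lt (PosNum e0)).
Unshelve. all: by end_near. Qed.

(** By continuity in x, the composite is the limit of its values at the rounded points. *)
Lemma measurable_fun_section_comp (phi : 'rV[R]_p -> E -> R) :
  (forall z, continuous (phi^~ z)) -> (forall x, measurable_fun setT (phi x)) ->
  measurable_fun setT (fun w => phi (X w) (zeta w)).
Proof.
move=> cphi mphi.
apply: (@measurable_fun_cvg _ _ _ _ (fun n w => phi (grid n (cell n w)) (zeta w))).
  move=> n _ B mB; rewrite setTI.
  have -> : (fun w => phi (grid n (cell n w)) (zeta w)) @^-1` B =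
      \bigcup_(c in [set: 'rV[int]_p]) ((cell n @^-1` [set c]) `&`
         (fun w => phi (grid n c) (zeta w)) @^-1` B).
    apply/seteqP; split=> w /=; first by move=> h; exists (cell n w).
    by move=> [c _ [/= <-]].
  apply: countable_bigcupT_measurable => [|c].
    exact: countableP.
  apply: measurableI; first exact: measurable_cell.
  rewrite -[X in measurable X]setTI.
  by have := measurableT_comp (mphi (grid n c)) mzeta; apply.
move=> w _.
have := @cvg_comp _ _ _ (fun n => grid n (cell n w)) (phi^~ (zeta w)) _ _ _
  (@cvg_grid w) (cphi (zeta w) (X w)).
by [].
Qed.

End Caratheodory.

(** The gradient is not assumed continuous in x, but the loss is, being differentiable; its
    difference quotients with h = 1 / (n + 1) are therefore measurable, and they converge to the
    partial derivative. *)
Lemma measurable_grad d (T : measurableType d) d' (E : measurableType d')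
    (R : realType) (p : nat) (X : T -> 'rV[R]_p) (zeta : T -> E)
    (loss : 'rV[R]_p -> E -> R) j :
  (forall j, measurable_fun setT (fun w => X w 0 j)) ->
  measurable_fun setT zeta ->
  (forall z x, differentiable (loss^~ z : 'rV[R]_p -> R) x) ->
  (forall x, measurable_fun setT (loss x)) ->
  measurable_fun setT (fun w => grad (loss^~ (zeta w)) (X w) 0 j).
Proof.
move=> mX mzeta dl ml.
have ml' (X' : T -> 'rV[R]_p) : (forall j, measurable_fun setT (fun w => X' w 0 j)) ->
    measurable_fun setT (fun w => loss (X' w) (zeta w)).
  move=> mX'; apply: measurable_fun_section_comp => // z x.
  exact: differentiable_continuous.
apply: (@measurable_fun_cvg _ _ _ _ (fun n w => n.+1%:R *
  (loss (n.+1%:R^-1 *: delta_mx 0 j + X w) (zeta w) - loss (X w) (zeta w)))).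
  move=> n; apply: measurable_funM; first exact: measurable_cst.
  apply: measurable_funB; last exact: ml'.
  apply: (ml' (fun w => n.+1%:R^-1 *: delta_mx 0 j + X w)) => k.
  under eq_fun do rewrite mxE.
  by apply: measurable_funD => //; exact: measurable_cst.
move=> w _; rewrite /grad mxE.
have D := @diff_derivable _ _ _ _ _ (delta_mx 0 j) (dl (zeta w) (X w)).
have h0 : (fun n : nat => n.+1%:R^-1 : R) @ \oo --> (0 : R)^'.
  move=> A hA; have h : \forall n \near \oo,
    (n.+1%:R^-1 : R) != 0 -> A (n.+1%:R^-1 : R) := cvg_harmonic hA.
  change (\forall n \near \oo, A (n.+1%:R^-1 : R)).
  by apply: filterS h => n; apply; rewrite invr_eq0 pnatr_eq0.
have e : (fun n : nat => n.+1%:R * (loss (n.+1%:R^-1 *: delta_mx 0 j + X w) (zeta w)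
    - loss (X w) (zeta w))) =
  (fun h => h^-1 *: (((loss^~ (zeta w)) \o shift (X w)) (h *: delta_mx 0 j)
    - loss (X w) (zeta w))) \o (fun n : nat => n.+1%:R^-1 : R).
  by apply/funext => n /=; rewrite invrK.
rewrite e; exact: (cvg_comp _ _ h0 D).
Qed.

(** * Independence of generated sigma-algebras *)

Section Independence.
Context d (T : measurableType d) (R : realType) (P : probability T R).
Context (I : eqType) (U : pred I) (S : I -> set (set T)).
Hypothesis Sm : forall j, U j -> S j `<=` measurable.
Hypothesis SI : forall j, setI_closed (S j).
Hypothesis ST : forall j, S j setT.
Hypothesis ind : mutually_independent P U S.

(* Two finite measures on the sigma-algebra of the family V agree on the
   pi-system of finite intersections. *)
Lemma mutually_independent_rest (V : set I) (o : I) (F A : set T) :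
  (forall j, V j -> U j) -> U o -> ~ V o ->
  <<s \bigcup_(j in V) S j >> F -> S o A -> P (F `&` A) = (P F * P A)%E.
Proof.
move=> VU Uo Vo sF SA; have mA : measurable A by exact: Sm SA.
pose H := [set B | exists J (f : I -> set T), [/\ uniq J,
  (forall j, j \in J -> V j), (forall j, j \in J -> S j (f j)) &
  B = \bigcap_(j in [set j | j \in J]) f j]].
have Hm : H `<=` measurable.
  move=> _ [J [f [_ JV Jf ->]]]; apply: fin_bigcap_measurable => [|j /= jJ].
    exact: finite_seq.
  by apply: (Sm (VU _ (JV _ jJ))); exact: Jf.
have HI : setI_closed H.
  move=> _ _ [J1 [f1 [u1 V1 S1 ->]]] [J2 [f2 [u2 V2 S2 ->]]].
  (* Both families are indexed by the union of their lists, with [setT] where an index is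
     missing. *)
  exists (undup (J1 ++ J2)), (fun j => (if j \in J1 then f1 j else setT) `&`
    (if j \in J2 then f2 j else setT)); split.
  - exact: undup_uniq.
  - by move=> j; rewrite mem_undup mem_cat => /orP[/V1|/V2].
  - by move=> j _; apply: SI; case: ifPn => //; [exact: S1|exact: S2].
  - apply/seteqP; split=> w /=.
      by move=> [h1 h2] j /= _; split; case: ifPn => // jJ; [exact: h1|exact: h2].
    move=> h; split=> j /= jJ; have := h j; rewrite /= mem_undup mem_cat jJ ?orbT.
      by move=> /(_ isT)[].
    by move=> /(_ isT)[].
have HT : H setT.
  exists [::], (fun=> setT); split=> [//|j|j|]; rewrite ?in_nil//.
  by apply/seteqP; split=> // w _ j; rewrite /= in_nil.
have sVH : <<s \bigcup_(j in V) S j >> `<=` <<s H >>.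
  apply: sub_sigma_algebra2 => B [j Vj Sj].
  exists [:: j], (fun=> B); split=> //.
  - by move=> i; rewrite inE => /eqP ->.
  - by move=> i; rewrite inE => /eqP ->.
  - apply/seteqP; split=> w /=; first by move=> Bw i _.
    by move=> /(_ j); apply; rewrite /= inE.
have PA0 : 0 <= fine (P A) by apply: fine_ge0; exact: measure_ge0.
have PAE : P A = (fine (P A))%:E by rewrite fineK// fin_num_measure.
have E2 B : mscale (NngNum PA0) P B = (P B * P A)%E.
  by rewrite /mscale /= muleC [in RHS]PAE.
have E1 B : mrestr P mA B = P (B `&` A) by [].
(* The two measures are P restricted to [A] and P scaled by [P A]. *)
have := @g_sigma_algebra_measure_unique _ R T H Hm (fun=> setT) (fun=> HT) _
  (mrestr P mA) (mscale (NngNum PA0) P) HI _ _ F (sVH _ sF).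
move=> h; rewrite -E2; apply: h.
- by apply/seteqP; split=> // w _; exists 0%N.
- move=> _ [J [f [uJ VJ SJ ->]]].
  have oJ : o \notin J by apply/negP => /VJ.
  have Uall : all U J by apply/allP => j /VJ/VU.
  suff e : P (\bigcap_(j in [set` J]) f j `&` A) = (P A * \prod_(j <- J) P (f j))%E.
    apply: etrans e (etrans _ (esym (E2 _))).
    by rewrite (ind uJ Uall SJ) muleC.
  (* Adjoining [o] with the event [A] reduces the claim to the product rule; [o] is a new index
     since it lies outside [V]. *)
  pose f' j := if j == o then A else f j.
  have -> : \bigcap_(j in [set` J]) f j `&` A =
      \bigcap_(j in [set j | j \in o :: J]) f' j.
    apply/seteqP; split=> w /=.
      move=> [h Aw] j; rewrite /= inE /f'; case: eqVneq => // _ /=; exact: h.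
    move=> h; split.
      move=> j /= jJ; have := h j; rewrite /= inE jJ orbT /f' => /(_ isT).
      by case: eqVneq => // jo; rewrite -jo jJ in oJ.
    by have := h o; rewrite /= inE eqxx /f' eqxx; apply.
  rewrite (ind (J := o :: J) (A := f')).
  - rewrite big_cons /f' eqxx; congr (_ * _)%E; rewrite big_seq [RHS]big_seq.
    apply: eq_bigr => j jJ; case: eqVneq => // jo; by rewrite -jo jJ in oJ.
  - by rewrite /= oJ.
  - by rewrite /= Uo.
  - move=> j; rewrite inE /f'; case: eqVneq => [->//|_ /=]; exact: SJ.
- move=> _; apply: (@le_lt_trans _ _ (P setT)); last by rewrite probability_setT ltry.
  have : (P (setT `&` A) <= P setT)%E.
    by apply: le_measure; rewrite ?inE//; exact: measurableI.
  exact.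
Qed.

End Independence.

(** * Square-integrable random matrices *)

Section VectorL2.
Context d (T : measurableType d) (R : realType) (P : probability T R).
Local Notation Ex f := (\int[P]_w f w).

Definition ML2 (n p : nat) (A : T -> 'M[R]_(n, p)) : Prop :=
  forall i j, L2 P (fun w => A w i j).

Section Closure.
Context (n p : nat).
Implicit Types A B : T -> 'M[R]_(n, p).

Lemma ML2D A B : ML2 A -> ML2 B -> ML2 (fun w => A w + B w).
Proof.
by move=> hA hB i j; under [X in L2 P X]eq_fun do rewrite mxE; exact: L2D.
Qed.

Lemma ML2Z c A : ML2 A -> ML2 (fun w => c *: A w).
Proof. by move=> hA i j; under [X in L2 P X]eq_fun do rewrite mxE; exact: L2Z. Qed.

Lemma ML2B A B : ML2 A -> ML2 B -> ML2 (fun w => A w - B w).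
Proof.
move=> hA hB; have := ML2D hA (ML2Z (-1) hB).
by under [X in ML2 X -> _]eq_fun do rewrite scaleN1r.
Qed.

Lemma ML2_cst (C : 'M[R]_(n, p)) : ML2 (fun=> C).
Proof. by move=> i j; exact: L2_cst. Qed.

Lemma ML2_sum I (r : seq I) (F : I -> T -> 'M[R]_(n, p)) :
  (forall i, ML2 (F i)) -> ML2 (fun w => \sum_(i <- r) F i w).
Proof.
move=> hF i j; under [X in L2 P X]eq_fun do rewrite summxE.
by apply: L2_sum => k; exact: hF.
Qed.

Lemma ML2_row A i : ML2 A -> ML2 (fun w => row i (A w)).
Proof. by move=> hA k j; under [X in L2 P X]eq_fun do rewrite mxE; exact: hA. Qed.

Lemma ML2_rows A : (forall i, ML2 (fun w => row i (A w))) -> ML2 A.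
Proof.
move=> hA i j; have := hA i 0 j.
by under [X in L2 P X -> _]eq_fun do rewrite mxE.
Qed.

Lemma L1_ip A B : ML2 A -> ML2 B -> L1 P (fun w => ip (A w) (B w)).
Proof.
move=> hA hB; apply: L1_sum => i; apply: L1_sum => j; exact: L2M.
Qed.

Lemma L1_sqnorm A : ML2 A -> L1 P (fun w => sqnorm (A w)).
Proof.
by move=> hA; have := L1_ip hA hA; under [X in L1 P X -> _]eq_fun do rewrite ip_self.
Qed.

Lemma ML2_le A (g : T -> R) :
  (forall i j, measurable_fun setT (fun w => A w i j)) ->
  (forall w, sqnorm (A w) <= g w) -> L1 P g -> ML2 A.
Proof.
move=> mA hA hg i j; apply: L2_le (mA i j) _ hg => w.
by apply: le_trans (hA w); exact: sqnorm_entry.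
Qed.

End Closure.

Lemma ML2_mul (m n p : nat) (W : 'M[R]_(m, n)) (A : T -> 'M[R]_(n, p)) :
  ML2 A -> ML2 (fun w => W *m A w).
Proof.
move=> hA i j; under [X in L2 P X]eq_fun do rewrite mxE.
by apply: L2_sum => k; apply: L2Z; exact: hA.
Qed.

Section Orthogonal.
Context (n p : nat) (G : set (set T)).
Hypothesis Gm : <<s G>> `<=` measurable.
Implicit Types A Z : T -> 'M[R]_(n, p).

Definition Madapted A := forall i j, adapted G (fun w => A w i j).
Definition Mmean_zero Z := forall i j, mean_zero_given P G (fun w => Z w i j).

Lemma Ex_ip_orth A Z : Madapted A -> ML2 A -> ML2 Z -> Mmean_zero Z ->
  Ex (fun w => ip (A w) (Z w)) = 0.
Proof.
move=> aA hA hZ zZ; rewrite /ip (Ex_sum (P := P)) => [|i].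
  rewrite big1// => i _; rewrite (Ex_sum (P := P)) => [|j]; last exact: L2M.
  by rewrite big1// => j _; exact: (mean_zero_orth Gm).
by apply: L1_sum => j; exact: L2M.
Qed.

(** Used with Z + A a batch difference and A its conditional mean: the cross term vanishes, so
    centering lowers the second moment. *)
Lemma Ex_sqnorm_centered A Z : Madapted A -> ML2 A -> ML2 Z -> Mmean_zero Z ->
  Ex (fun w => sqnorm (Z w)) <= Ex (fun w => sqnorm (Z w + A w)).
Proof.
move=> aA hA hZ zZ; under [leRHS]eq_Rintegral do rewrite sqnormD.
have h1 := L1_sqnorm hZ; have h2 := L1_sqnorm hA; have h3 := L1_ip hZ hA.
rewrite ExD//; last by apply: L1D => //; exact: L1Z.
rewrite ExD//; last exact: L1Z.
have o : Ex (fun w => ip (Z w) (A w)) = 0.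
  by rewrite -[RHS](Ex_ip_orth aA hA hZ zZ); apply: eq_Rintegral => w _; rewrite ipC.
rewrite ExZ// o mulr0 addr0 lerDl.
by apply: Ex_ge0 => w; exact: sqnorm_ge0.
Qed.

(* E|(1-b)(e + D) + b z|^2 has no cross term between e and the noise. *)
Lemma Ex_sqnorm_momentum A Z1 Z2 (b : R) : Madapted A -> ML2 A ->
  ML2 Z1 -> Mmean_zero Z1 -> ML2 Z2 -> Mmean_zero Z2 ->
  Ex (fun w => sqnorm ((1 - b) *: (A w + Z1 w) + b *: Z2 w)) <=
  (1 - b) ^+ 2 * Ex (fun w => sqnorm (A w))
  + 2 * (1 - b) ^+ 2 * Ex (fun w => sqnorm (Z1 w))
  + 2 * b ^+ 2 * Ex (fun w => sqnorm (Z2 w)).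
Proof.
move=> aA hA h1 z1 h2 z2.
have o1 := Ex_ip_orth aA hA h1 z1; have o2 := Ex_ip_orth aA hA h2 z2.
have i1 := L1_ip hA h1; have i2 := L1_ip hA h2.
have lA := L1_sqnorm hA; have l1 := L1_sqnorm h1; have l2 := L1_sqnorm h2.
pose g w := (1 - b) ^+ 2 * sqnorm (A w) + 2 * (1 - b) ^+ 2 * sqnorm (Z1 w)
  + 2 * b ^+ 2 * sqnorm (Z2 w)
  + (2 * (1 - b) ^+ 2 * ip (A w) (Z1 w) + 2 * (1 - b) * b * ip (A w) (Z2 w)).
have gE : Ex g = (1 - b) ^+ 2 * Ex (fun w => sqnorm (A w))
  + 2 * (1 - b) ^+ 2 * Ex (fun w => sqnorm (Z1 w))
  + 2 * b ^+ 2 * Ex (fun w => sqnorm (Z2 w)).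
  rewrite /g !ExD ?ExZ//; try by do ?[apply: L1D|exact: L1Z].
  by rewrite o1 o2 !mulr0 !addr0.
rewrite -gE; apply: Ex_le.
- by apply: L1_sqnorm; apply: ML2D; apply: ML2Z => //; exact: ML2D.
- by do ?[apply: L1D|exact: L1Z].
- move=> w; rewrite /g scalerDr -addrA sqnormD.
  have := sqnormD_le ((1 - b) *: Z1 w) (b *: Z2 w).
  rewrite !sqnormZ ipZl ipDr !ipZr.
  move: (sqnorm _) (sqnorm _) (sqnorm _) (sqnorm _) (ip _ _) (ip _ _) => *.
  by lra.
Qed.

End Orthogonal.

Lemma mean_zero_sum (G : set (set T)) I (r : seq I) (F : I -> T -> R) :
  <<s G>> `<=` measurable ->
  (forall i, L1 P (F i)) -> (forall i, mean_zero_given P G (F i)) ->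
  mean_zero_given P G (fun w => \sum_(i <- r) F i w).
Proof.
move=> Gm h1 hz B GB; have mB := Gm _ GB.
have hB f : L1 P f -> P.-integrable B (EFin \o f).
  by move=> hf; apply: integrableS hf.
elim: r => [|i r IH].
  by under eq_Rintegral do rewrite big_nil; rewrite Rintegral_cst// mul0r.
under eq_Rintegral do rewrite big_cons.
rewrite RintegralD//; [by rewrite hz// IH addr0|exact: hB|].
by apply: hB; exact: L1_sum.
Qed.

Lemma mean_zeroZ (G : set (set T)) c (f : T -> R) :
  <<s G>> `<=` measurable -> L1 P f -> mean_zero_given P G f ->
  mean_zero_given P G (fun w => c * f w).
Proof.
move=> Gm h1 hz B GB; have mB := Gm _ GB.
rewrite RintegralZl ?hz ?mulr0//; exact: integrableS h1.
Qed.

End VectorL2.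

Section Lipschitz.
Context (R : realType) (p : nat).

Lemma lipschitz_continuous (f : 'rV[R]_p -> R) (c : R) : 0 < c ->
  (forall a b, (f a - f b) ^+ 2 <= c * sqnorm (a - b)) -> continuous f.
Proof.
move=> c0 lf x A /nbhs_ballP[e /= e0 eA].
(* Balls are those of the sup norm, so |x - y|^2 <= p dl^2; here e = (c (p + 1) + 1) dl, whose
   square exceeds c p dl^2. *)
pose dl := e / (c * (p%:R + 1) + 1).
have p1 : 0 < p%:R + 1 :> R by rewrite ltr_wpDl.
have q0 : 0 < c * (p%:R + 1) + 1 by rewrite addr_gt0// mulr_gt0.
have dl0 : 0 < dl by rewrite divr_gt0.
apply/nbhs_ballP; exists dl => //= y [_ h]; apply: eA.
suff : (f x - f y) ^+ 2 < e ^+ 2.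
  by rewrite -[X in X < _]real_normK ?num_real// ltr_sqr ?nnegrE ?(ltW e0).
apply: le_lt_trans (lf _ _) _.
have : sqnorm (x - y) <= p%:R * dl ^+ 2.
  rewrite /sqnorm big_ord1; apply: (@le_trans _ _ (\sum_(j < p) dl ^+ 2)).
    apply: ler_sum => j _; have := h 0 j; rewrite /ball /= !mxE => /ltW hj.
    have := hj; rewrite -ler_sqr ?nnegrE ?(ltW dl0)// real_normK ?num_real//.
  by rewrite sumr_const card_ord mulr_natl.
move=> /(ler_wpM2l (ltW c0)) /le_lt_trans; apply.
have -> : e = (c * (p%:R + 1) + 1) * dl by rewrite mulrC divfK// lt0r_neq0.
clearbody dl; rewrite mulrA exprMn ltr_pM2r ?exprn_gt0//.
have pr : 0 <= p%:R :> R by [].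
have := mulr_ge0 (ltW c0) pr.
move: q0; nra.
Qed.

(** Applies [measurable_fun_section_comp] with a dummy sample; it serves for the prox and for the
    local gradients. *)
Lemma adapted_lipschitz d (T : measurableType d) (G : set (set T))
    (f : 'rV[R]_p -> R) (X : T -> 'rV[R]_p) (c : R) : 0 < c ->
  (forall a b, (f a - f b) ^+ 2 <= c * sqnorm (a - b)) ->
  Madapted G X -> adapted G (fun w => f (X w)).
Proof.
move=> c0 lf aX.
apply: (@measurable_fun_section_comp _ (g_sigma_algebraType G) _ (g_sigma_algebraType G)
   R p X id _ _ (fun x _ => f x)).
- by move=> j; exact: aX.
- exact: measurable_id.
- by move=> z; exact: lipschitz_continuous lf.
- by move=> x; exact: measurable_cst.
Qed.

End Lipschitz.

(** * Closure properties of adapted matrices *)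

Section AdaptedAlgebra.
Context d (T : measurableType d) (R : realType) (G : set (set T)).

Lemma adapted_cst (c : R) : adapted G (fun=> c).
Proof. exact: measurable_cst. Qed.

Lemma adaptedD (f g : T -> R) : adapted G f -> adapted G g ->
  adapted G (fun w => f w + g w).
Proof. exact: measurable_funD. Qed.

Lemma adaptedZ c (f : T -> R) : adapted G f -> adapted G (fun w => c * f w).
Proof. by move=> h; apply: measurable_funM => //; exact: measurable_cst. Qed.

Lemma adapted_sum I (r : seq I) (F : I -> T -> R) :
  (forall i, adapted G (F i)) -> adapted G (fun w => \sum_(i <- r) F i w).
Proof.
move=> h; elim: r => [|i r IH].
  by under [X in adapted G X]eq_fun do rewrite big_nil; exact: adapted_cst.
by under [X in adapted G X]eq_fun do rewrite big_cons; exact: adaptedD.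
Qed.

Lemma MadaptedD n p (A B : T -> 'M[R]_(n, p)) : Madapted G A -> Madapted G B ->
  Madapted G (fun w => A w + B w).
Proof.
move=> hA hB i j; under [X in adapted G X]eq_fun do rewrite mxE.
exact: adaptedD.
Qed.

Lemma MadaptedZ n p c (A : T -> 'M[R]_(n, p)) : Madapted G A ->
  Madapted G (fun w => c *: A w).
Proof.
move=> hA i j; under [X in adapted G X]eq_fun do rewrite mxE.
exact: adaptedZ.
Qed.

Lemma MadaptedB n p (A B : T -> 'M[R]_(n, p)) : Madapted G A -> Madapted G B ->
  Madapted G (fun w => A w - B w).
Proof.
move=> hA hB; have := MadaptedD hA (MadaptedZ (-1) hB).
by under [X in Madapted G X -> _]eq_fun do rewrite scaleN1r.
Qed.

Lemma Madapted_sum n p I (r : seq I) (F : I -> T -> 'M[R]_(n, p)) :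
  (forall i, Madapted G (F i)) -> Madapted G (fun w => \sum_(i <- r) F i w).
Proof.
move=> hF i j; under [X in adapted G X]eq_fun do rewrite summxE.
by apply: adapted_sum => k; exact: hF.
Qed.

Lemma Madapted_row n p (A : T -> 'M[R]_(n, p)) i : Madapted G A ->
  Madapted G (fun w => row i (A w)).
Proof.
by move=> hA k j; under [X in adapted G X]eq_fun do rewrite mxE; exact: hA.
Qed.

Lemma Madapted_rows n p (A : T -> 'M[R]_(n, p)) :
  (forall i, Madapted G (fun w => row i (A w))) -> Madapted G A.
Proof.
move=> hA i j; have := hA i 0 j.
by under [X in adapted G X -> _]eq_fun do rewrite mxE.
Qed.

Lemma Madapted_mul m n p (W : 'M[R]_(m, n)) (A : T -> 'M[R]_(n, p)) :
  Madapted G A -> Madapted G (fun w => W *m A w).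
Proof.
move=> hA i j; under [X in adapted G X]eq_fun do rewrite mxE.
by apply: adapted_sum => k; apply: adaptedZ; exact: hA.
Qed.

Lemma Madapted_cst n p (C : 'M[R]_(n, p)) : Madapted G (fun=> C).
Proof. by move=> i j; exact: adapted_cst. Qed.

Lemma Madapted_measurable n p (A : T -> 'M[R]_(n, p)) i j :
  <<s G>> `<=` measurable -> Madapted G A -> measurable_fun setT (fun w => A w i j).
Proof. by move=> Gm hA; exact: (adapted_measurable Gm (hA i j)). Qed.

Lemma Madapted_sub n p (A : T -> 'M[R]_(n, p)) (G' : set (set T)) :
  G `<=` <<s G' >> -> Madapted G A -> Madapted G' A.
Proof.
move=> GG hA i j _ B mB; have := hA i j measurableT B mB.
rewrite !setTI; apply: (smallest_sub _ GG).
exact: (@smallest_sigma_algebra _ setT G').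
Qed.

End AdaptedAlgebra.

(** * Stochastic gradients along a run *)

Section Oracle.
Context (R : realType) (N p : nat) (dXi dOm : measure_display)
  (Xi : measurableType dXi) (Om : measurableType dOm) (P : probability Om R).
Variables (A : inputs R N p Xi Om) (L sigma phistar : R).
Variables (K : nat) (tau : Om -> nat).
Local Notation pb := (in_pb A).
Local Notation m := (in_m A).
Local Notation xi := (in_xi A).
Local Notation Ex f := (\int[P]_w f w).
Local Notation lgrad i := (grad (local_obj (in_pb A) i)).
Hypothesis wp : well_posed pb.
Hypothesis hA : assumptionA pb L sigma phistar.
Hypothesis m_gt0 : (0 < m)%N.
Hypothesis samp : sampling P (pb_dist pb) (in_kind A) m K (in_alpha A) xi tau.

(** The generators of [past A K k], kept apart from the sigma-algebra because [adapted] and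
    [independent_of] take generators. *)
Definition gen (k : nat) : set (set Om) :=
  \bigcup_(j in [set j | drawn (in_kind A) m K j /\ (iter_of j <= k)%N])
    events_of (xi j).

Lemma gen_measurable k : <<s gen k>> `<=` measurable.
Proof.
apply: smallest_sub; first exact: sigma_algebra_measurable.
by move=> _ [j [dj _] [B mB <-]]; exact: (sample_measurable samp dj).
Qed.

Lemma gen_mono k k' : (k <= k')%N -> gen k `<=` <<s gen k' >>.
Proof.
move=> kk B [j [dj jk] Bj]; apply: sub_sigma_algebra; exists j => //.
by split=> //; exact: leq_trans kk.
Qed.

Lemma sample_past k j : drawn (in_kind A) m K j -> (iter_of j <= k)%N ->
  measurable_fun [set: g_sigma_algebraType (gen k)]
    (xi j : g_sigma_algebraType (gen k) -> Xi).
Proof.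
move=> dj jk _ B mB; apply: sub_sigma_algebra.
by exists j => //; exists B.
Qed.

Let U (o : option (sample_idx N)) : bool :=
  if o is Some j then drawn (in_kind A) m K j else true.

(** Treats later samples and the output index alike; [None], which stands for [tau], is independent
    of every [gen k]. *)
Let gen_independent k (o : option (sample_idx N)) F B : U o ->
  (if o is Some j then (k < iter_of j)%N else true) ->
  <<s gen k>> F -> events xi tau o B -> P (F `&` B) = (P F * P B)%E.
Proof.
move=> Uo ok sF oB.
pose V : set (option (sample_idx N)) :=
  [set Some j | j in [set j | drawn (in_kind A) m K j /\ (iter_of j <= k)%N]].
have EV : gen k = \bigcup_(o in V) events xi tau o by rewrite bigcup_image.
apply: (@mutually_independent_rest _ _ _ P _ U (events xi tau) _ _ _
  (all_independent samp) V o F B) => //.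
- move=> [j|] Uj _ [C mC <-]; first exact: (sample_measurable samp Uj).
  exact: (tau_measurable samp).
- move=> [j|] _ _ [C1 m1 <-] [C2 m2 <-]; exists (C1 `&` C2);
    rewrite ?setTI ?preimage_setI//; exact: measurableI.
- by move=> [j|]; exists setT; rewrite ?setTI ?preimage_setT//; exact: measurableT.
- by move=> _ [j [dj _] <-].
- by move=> [j [_ jk] oj]; move: ok; rewrite -oj ltnNge jk.
- by rewrite -EV.
Qed.

Lemma sample_independent k j : drawn (in_kind A) m K j -> (k < iter_of j)%N ->
  independent_of P (gen k) (xi j) (pb_dist pb (agent_of j)).
Proof.
move=> dj kj F B sF mB; rewrite (gen_independent (o := Some j) (k := k))//.
- by rewrite (sample_law samp).
- by exists B; rewrite ?setTI.
Qed.

Lemma tau_independent k F (B : set nat) : <<s gen k>> F -> measurable B ->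
  P (F `&` tau @^-1` B) = (P F * P (tau @^-1` B))%E.
Proof.
move=> sF mB; apply: (gen_independent (o := None) (k := k)) => //.
by exists B; rewrite ?setTI.
Qed.

Lemma sgrad_measurable i x j : measurable_fun setT (fun z => sgrad pb i x z 0 j).
Proof.
by have [/measurable_int/measurable_EFinP] := sgrad_unbiased hA i x j.
Qed.

Lemma loss_measurable i x : measurable_fun setT (pb_loss pb i x).
Proof. by have /measurable_int/measurable_EFinP := loss_integrable wp i x. Qed.

Lemma sgrad_mean i x j : L1 (pb_dist pb i) (fun z => sgrad pb i x z 0 j) /\
  \int[pb_dist pb i]_z sgrad pb i x z 0 j = lgrad i x 0 j.
Proof.
by have [h1 h2] := sgrad_unbiased hA i x j; split=> //; rewrite /Rintegral h2.
Qed.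

(** The local gradient is the mean of the sample gradients; Jensen in each coordinate passes
    mean-square smoothness on to it. *)
Lemma lgrad_lip i a b :
  sqnorm (lgrad i a - lgrad i b) <= L ^+ 2 * sqnorm (a - b).
Proof.
pose D := pb_dist pb i; pose s z := sgrad pb i a z - sgrad pb i b z.
have ms k j : measurable_fun setT (fun z => s z k j).
  rewrite (ord1 k); under eq_fun do rewrite mxE [X in _ + X]mxE.
  by apply: measurable_funB; exact: sgrad_measurable.
have [h1 h2] : L1 D (fun z => sqnorm (s z)) /\
    \int[D]_z sqnorm (s z) <= L ^+ 2 * sqnorm (a - b).
  apply: L1_bounded; last exact: (mean_square_smooth hA).
    apply: measurable_sum => k; apply: measurable_sum => j.
    by apply: measurable_funX; exact: ms.
  by move=> z; exact: sqnorm_ge0.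
have s2 : ML2 D s by exact: (ML2_le ms (fun z => lexx _) h1).
apply: le_trans h2; rewrite /sqnorm big_ord1.
under eq_Rintegral do rewrite big_ord1.
rewrite (@Ex_sum _ _ _ D) => [|j]; last by case: (s2 0 j).
apply: ler_sum => j _; rewrite mxE [X in (_ + X) ^+ 2]mxE.
have [l1 <-] := sgrad_mean i a j; have [l2 <-] := sgrad_mean i b j.
rewrite -ExB//; have := Ex_sqr_le (s2 0 j); rewrite /s.
by under eq_Rintegral do rewrite mxE [X in (_ + X)]mxE.
Qed.

Lemma lgrad_coord_lip i j a b :
  (lgrad i a 0 j - lgrad i b 0 j) ^+ 2 <= L ^+ 2 * sqnorm (a - b).
Proof.
apply: le_trans (lgrad_lip i a b); have := sqnorm_entry (lgrad i a - lgrad i b) 0 j.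
by rewrite mxE [X in _ + X]mxE.
Qed.

Lemma lgrad_adapted (G : set (set Om)) i (X : Om -> 'rV[R]_p) :
  Madapted G X -> Madapted G (fun w => lgrad i (X w)).
Proof.
move=> aX k j; rewrite (ord1 k).
apply: (adapted_lipschitz (f := fun x => lgrad i x 0 j) (c := L ^+ 2) _ _ aX).
  by rewrite exprn_gt0//; exact: (L_gt0 hA).
exact: lgrad_coord_lip.
Qed.

Lemma lgrad_sqnorm i x :
  sqnorm (lgrad i x) <= 2 * sqnorm (lgrad i 0) + 2 * (L ^+ 2 * sqnorm x).
Proof.
have := lgrad_lip i x 0; rewrite subr0.
have := sqnormD_le (lgrad i 0) (lgrad i x - lgrad i 0); rewrite addrC subrK.
move: (sqnorm _) (sqnorm _) (sqnorm _) => *; lra.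
Qed.

Lemma lgrad_ML2 i k (X : Om -> 'rV[R]_p) : Madapted (gen k) X -> ML2 P X ->
  ML2 P (fun w => lgrad i (X w)).
Proof.
move=> aX X2; apply: (ML2_le _ (fun w => lgrad_sqnorm i (X w))).
  move=> a b; apply: Madapted_measurable; first exact: gen_measurable.
  exact: lgrad_adapted.
apply: L1D; first exact: L1_cst.
by apply: L1Z; apply: L1Z; exact: L1_sqnorm.
Qed.

Lemma sgrad_past k j (X : Om -> 'rV[R]_p) : Madapted (gen k) X ->
  drawn (in_kind A) m K j -> (iter_of j <= k)%N ->
  Madapted (gen k) (fun w => sgrad pb (agent_of j) (X w) (xi j w)).
Proof.
move=> aX dj jk a b; rewrite (ord1 a).
apply: (@measurable_grad _ (g_sigma_algebraType (gen k)) _ Xi R p X (xi j)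
  (fun x z => pb_loss pb (agent_of j) x z)).
- by move=> l; exact: aX.
- exact: sample_past.
- by move=> z x; exact: (loss_differentiable wp).
- by move=> x; exact: loss_measurable.
Qed.

Lemma batch_grad_past k k' i (X : Om -> 'rV[R]_p) : Madapted (gen k) X ->
  (k' <= k)%N -> (k' <= K)%N ->
  Madapted (gen k) (fun w => batch_grad A m k' i (X w) w).
Proof.
move=> aX kk kK; apply: MadaptedZ; apply: Madapted_sum => s.
apply: (@sgrad_past k (false, k', i, nat_of_ord s)) => //.
by rewrite /drawn kK ltn_ord.
Qed.

Section OneStep.
Variables (k : nat) (i : 'I_N) (X X' : Om -> 'rV[R]_p).
Hypothesis kK : (k < K)%N.
Hypotheses (aX : Madapted (gen k) X) (aX' : Madapted (gen k) X').
Hypotheses (X2 : ML2 P X) (X2' : ML2 P X').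

Section Sample.
Variable s : 'I_m.
Let j : sample_idx N := (false, k.+1, i, nat_of_ord s).
Let G := g_sigma_algebraType (gen k).
Let f (x : G * Xi) := sgrad pb i (X' x.1) x.2 - sgrad pb i (X x.1) x.2.
Let g w := lgrad i (X' w) - lgrad i (X w).

Let dj : drawn (in_kind A) m K j.
Proof. by apply/and3P; split=> //; exact: ltn_ord. Qed.

Let mxij : measurable_fun setT (xi j).
Proof. exact: (sample_measurable samp dj). Qed.

Let ij : independent_of P (gen k) (xi j) (pb_dist pb i).
Proof. exact: (sample_independent dj (ltnSn k)). Qed.

Let mf a b : measurable_fun setT (fun x => f x a b).
Proof.
rewrite (ord1 a); under eq_fun do rewrite mxE [X in _ + X]mxE.
have mg (Y : Om -> 'rV[R]_p) : Madapted (gen k) Y ->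
    measurable_fun setT (fun x : G * Xi => sgrad pb i (Y x.1) x.2 0 b).
  move=> aY; apply: (@measurable_grad _ (G * Xi)%type _ Xi R p (fun x => Y x.1)
    snd (fun x z => pb_loss pb i x z)).
  - by move=> l; apply: (measurableT_comp (aY 0 l)); exact: measurable_fst.
  - exact: measurable_snd.
  - by move=> z x; exact: (loss_differentiable wp).
  - by move=> x; exact: loss_measurable.
by apply: measurable_funB; exact: mg.
Qed.

Let msq : measurable_fun setT (fun x => sqnorm (f x)).
Proof.
apply: measurable_sum => a; apply: measurable_sum => b.
by apply: measurable_funX; exact: mf.
Qed.

(** Both points are determined by the samples up to k, so they are frozen while the sample [j] of
    iteration k + 1 is integrated out. *)
Lemma sample_diff_sq :
  L1 P (fun w => sqnorm (f (w, xi j w))) /\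
  Ex (fun w => sqnorm (f (w, xi j w))) <= L ^+ 2 * Ex (fun w => sqnorm (X' w - X w)).
Proof.
have h1 : L1 P (fun w => sqnorm (X' w - X w)) by apply: L1_sqnorm; exact: ML2B.
rewrite -ExZ//.
apply: (@freeze_le _ _ _ P (gen k) (@gen_measurable k) _ _ (xi j) (pb_dist pb i)
  mxij ij (fun x => sqnorm (f x)) (fun w => L ^+ 2 * sqnorm (X' w - X w))) => //.
- by move=> x; exact: sqnorm_ge0.
- by move=> w; exact: (mean_square_smooth hA i (X' w) (X w)).
- exact: L1Z.
Qed.

Lemma sample_diff_ML2 : ML2 P (fun w => f (w, xi j w)).
Proof.
apply: (ML2_le _ (fun w => lexx _) (proj1 sample_diff_sq)) => a b.
apply: (@measurableT_comp _ _ _ _ (G * Xi)%type _ (fun x => f x a b) setT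
  (fun w : Om => ((w : G), xi j w))); first exact: mf.
apply: measurable_fun_pair => // _ B mB; rewrite setTI.
exact: (@gen_measurable k).
Qed.

Lemma sample_diff_mean_zero : Mmean_zero P (gen k) (fun w => f (w, xi j w) - g w).
Proof.
move=> a b.
apply: (@freeze_mean_zero _ _ _ P (gen k) (@gen_measurable k) _ _ (xi j)
  (pb_dist pb i) mxij ij (fun x => (f x - g x.1) a b)).
- under eq_fun do rewrite mxE [X in _ + X]mxE.
  apply: measurable_funB; first exact: mf.
  apply: (measurableT_comp (f := fun w : G => g w a b)) => //.
  exact: (MadaptedB (lgrad_adapted i aX') (lgrad_adapted i aX) a b).
- apply: L2_L1; apply: ML2B; first exact: sample_diff_ML2.
  by apply: ML2B; exact: lgrad_ML2.
- move=> w; rewrite (ord1 a).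
  have [l1 e1] := sgrad_mean i (X' w) b; have [l2 e2] := sgrad_mean i (X w) b.
  have l3 : L1 (pb_dist pb i) (fun z => sgrad pb i (X' w) z 0 b - sgrad pb i (X w) z 0 b).
    exact: L1B.
  have sub4 (u v x y : 'rV[R]_p) :
    (u - v - (x - y)) 0 b = u 0 b - v 0 b - (x 0 b - y 0 b) by rewrite !mxE.
  under eq_integral => z _ do rewrite sub4 /=.
  rewrite (@ExE _ _ _ (pb_dist pb i) (fun z => sgrad pb i (X' w) z 0 b
     - sgrad pb i (X w) z 0 b - (lgrad i (X' w) 0 b - lgrad i (X w) 0 b))).
    rewrite ExB//; last exact: L1_cst.
    by rewrite ExB// e1 e2 Ex_cst subrr.
  by apply: L1B => //; exact: L1_cst.
Qed.

End Sample.

Let bd w := batch_grad A m k.+1 i (X' w) w - batch_grad A m k.+1 i (X w) w.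

Lemma batch_diffE w : bd w = m%:R^-1 *: \sum_(s < m)
  (sgrad pb i (X' w) (xi (false, k.+1, i, nat_of_ord s) w)
   - sgrad pb i (X w) (xi (false, k.+1, i, nat_of_ord s) w)).
Proof. by rewrite /bd /batch_grad -scalerBr -sumrB. Qed.

Lemma batch_diff_ML2 : ML2 P bd.
Proof.
rewrite (funext batch_diffE : bd = _).
by apply: ML2Z; apply: ML2_sum => s; exact: sample_diff_ML2.
Qed.

(** By convexity alone, without the gain 1 / m from independence inside the batch. *)
Lemma batch_diff_sq :
  Ex (fun w => sqnorm (bd w)) <= L ^+ 2 * Ex (fun w => sqnorm (X' w - X w)).
Proof.
have mR : 0 < m%:R :> R by rewrite ltr0n.
pose F (s : 'I_m) w := sqnorm
  (sgrad pb i (X' w) (xi (false, k.+1, i, nat_of_ord s) w)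
   - sgrad pb i (X w) (xi (false, k.+1, i, nat_of_ord s) w)).
have F1 s : L1 P (F s) by have [] := sample_diff_sq s.
have FE s : Ex (F s) <= L ^+ 2 * Ex (fun w => sqnorm (X' w - X w)).
  by have [] := sample_diff_sq s.
apply: (@le_trans _ _ (Ex (fun w => m%:R^-1 * \sum_(s < m) F s w))).
  apply: Ex_le; first by apply: L1_sqnorm; exact: batch_diff_ML2.
    by apply: L1Z; exact: L1_sum.
  by move=> w; rewrite batch_diffE; exact: sqnorm_mean.
rewrite ExZ; last exact: L1_sum.
rewrite (Ex_sum (P := P))// mulrC ler_pdivrMr//.
apply: le_trans (ler_sum _ (fun s _ => FE s)) _.
by rewrite sumr_const card_ord mulr_natr.
Qed.

Lemma batch_diff_mean_zero :
  Mmean_zero P (gen k) (fun w => bd w - (lgrad i (X' w) - lgrad i (X w))).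
Proof.
have Gm := @gen_measurable k.
have mR : m%:R != 0 :> R by rewrite pnatr_eq0 -lt0n.
move=> a b.
pose F (s : 'I_m) w := (sgrad pb i (X' w) (xi (false, k.+1, i, nat_of_ord s) w)
   - sgrad pb i (X w) (xi (false, k.+1, i, nat_of_ord s) w)
   - (lgrad i (X' w) - lgrad i (X w))) a b.
have F1 s : L1 P (F s).
  apply: L2_L1; apply: ML2B; first exact: sample_diff_ML2.
  by apply: ML2B; exact: lgrad_ML2.
have E w : (bd w - (lgrad i (X' w) - lgrad i (X w))) a b
    = m%:R^-1 * \sum_(s < m) F s w.
  have -> : bd w - (lgrad i (X' w) - lgrad i (X w)) = m%:R^-1 *: \sum_(s < m)
      (sgrad pb i (X' w) (xi (false, k.+1, i, nat_of_ord s) w)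
       - sgrad pb i (X w) (xi (false, k.+1, i, nat_of_ord s) w)
       - (lgrad i (X' w) - lgrad i (X w))).
    rewrite batch_diffE [in RHS]sumrB scalerBr sumr_const card_ord.
    by rewrite -[(_ - _) *+ m]scaler_nat scalerA mulVf// scale1r.
  by rewrite mxE summxE.
under [X in mean_zero_given _ _ X]eq_fun do rewrite E.
apply: mean_zeroZ => //; first exact: L1_sum.
apply: mean_zero_sum => // s; exact: sample_diff_mean_zero.
Qed.

End OneStep.

End Oracle.

(** * Moments along a run *)

Lemma Ex_lin4 (R : realType) d (T : measurableType d) (P : probability T R)
    (c c1 c2 c3 c4 : R) (f1 f2 f3 f4 : T -> R) :
  L1 P f1 -> L1 P f2 -> L1 P f3 -> L1 P f4 ->
  \int[P]_w (c * (c1 * f1 w + c2 * f2 w + c3 * f3 w + c4 * f4 w)) =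
  c * (c1 * (\int[P]_w f1 w) + c2 * (\int[P]_w f2 w)
    + c3 * (\int[P]_w f3 w) + c4 * (\int[P]_w f4 w)).
Proof.
move=> h1 h2 h3 h4.
have k1 := L1Z c1 h1; have k2 := L1Z c2 h2; have k3 := L1Z c3 h3.
have k4 := L1Z c4 h4; have k12 := L1D k1 k2; have k123 := L1D k12 k3.
by rewrite (ExZ _ (L1D k123 k4)) (ExD k123 k4) (ExD k12 k3) (ExD k1 k2) !ExZ.
Qed.

Section Run.
Context (R : realType) (N p : nat) (dXi dOm : measure_display)
  (Xi : measurableType dXi) (Om : measurableType dOm) (P : probability Om R).
Variables (A : inputs R N p Xi Om) (L sigma hsigma phistar : R).
Variables (K : nat) (tau : Om -> nat).
Local Notation pb := (in_pb A).
Local Notation m := (in_m A).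
Local Notation xi := (in_xi A).
Local Notation Ex f := (\int[P]_w f w).
Local Notation lgrad i := (grad (local_obj (in_pb A) i)).
Hypothesis wp : well_posed pb.
Hypothesis hA : assumptionA pb L sigma phistar.
Hypothesis m_gt0 : (0 < m)%N.
Hypothesis m0E : in_m0 A = m.
Hypothesis samp : sampling P (pb_dist pb) (in_kind A) m K (in_alpha A) xi tau.
Hypothesis al_gt0 : forall k, 0 < in_alpha A k.
Hypothesis unb : est_unbiased A P K.
Hypothesis var : est_variance A P K hsigma.
Hypothesis opt : est_option A K.
Variable w0 : 'rV[R]_p.
Hypothesis w0dom : dom_reg (pb_reg pb) w0.

Local Notation gen := (gen A K).
Local Notation Gm := (gen_measurable samp).
Local Notation Xr k w := (stX (run A w k)).
Local Notation Dr k w := (stD (run A w k)).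
Local Notation Yr k w := (stY (run A w k)).
Local Notation Zr k w := (stZ (run A w k)).
Local Notation proxk k := (prox (scale_fun (in_alpha A k) (pb_reg pb))).

Lemma run_Z k w : Zr k w = cheb (in_W A) (Xr k w) (in_T A).
Proof. by case: k. Qed.

Lemma run_X k i w :
  row i (Xr k.+1 w) = proxk k (row i (Zr k w) - in_alpha A k *: row i (Yr k w)).
Proof. by rewrite /= rowK. Qed.

Lemma run_D k i w : row i (Dr k.+1 w) =
  (1 - in_beta A k) *: (row i (Dr k w)
     + (batch_grad A m k.+1 i (row i (Xr k.+1 w)) w
        - batch_grad A m k.+1 i (row i (Xr k w)) w))
  + in_beta A k *: in_vt A k.+1 i w.
Proof. by rewrite /= rowK addrA. Qed.

Lemma run_Y k w : Yr k.+1 w =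
  cheb (in_W A) (Yr k w + Dr k.+1 w - Dr k w) (in_T A).
Proof. by []. Qed.

Let prox_lip k j a b : (proxk k a 0 j - proxk k b 0 j) ^+ 2 <= 1 * sqnorm (a - b).
Proof.
rewrite mul1r.
apply: le_trans (prox_nonexp (reg_gtNy hA) (reg_convex hA) (reg_prox hA) w0dom
  a b (al_gt0 k)).
have := sqnorm_entry (proxk k a - proxk k b) 0 j.
by rewrite mxE [X in _ + X]mxE.
Qed.

Let prox_adapted k (G : set (set Om)) (V : Om -> 'rV[R]_p) :
  Madapted G V -> Madapted G (fun w => proxk k (V w)).
Proof.
move=> aV a j; rewrite (ord1 a).
exact: (adapted_lipschitz (f := fun x => proxk k x 0 j) ltr01 (prox_lip k j) aV).
Qed.

Let prox_ML2 k k' (V : Om -> 'rV[R]_p) : Madapted (gen k') V -> ML2 P V ->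
  ML2 P (fun w => proxk k (V w)).
Proof.
move=> aV V2; apply: (@ML2_le _ _ _ _ _ _ _
  (fun w => 2 * sqnorm (proxk k 0) + 2 * sqnorm (V w))).
- move=> a b; apply: Madapted_measurable; first exact: (gen_measurable samp (k:=k')).
  exact: prox_adapted.
- move=> w; have := prox_nonexp (reg_gtNy hA) (reg_convex hA) (reg_prox hA) w0dom
    (V w) 0 (al_gt0 k); rewrite subr0.
  have := sqnormD_le (proxk k 0) (proxk k (V w) - proxk k 0).
  rewrite addrC subrK; move: (sqnorm _) (sqnorm _) (sqnorm _) (sqnorm _) => *; lra.
- by apply: L1D; [exact: L1_cst|apply: L1Z; exact: L1_sqnorm].
Qed.

Let cheb_adapted (G : set (set Om)) T (B : Om -> 'M[R]_(N, p)) : Madapted G B ->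
  Madapted G (fun w => cheb (in_W A) (B w) T).
Proof.
move=> aB; have -> : (fun w => cheb (in_W A) (B w) T)
    = (fun w => chebmx (in_W A) T *m B w) by apply/funext => w; rewrite chebE.
exact: Madapted_mul.
Qed.

Let cheb_ML2 T (B : Om -> 'M[R]_(N, p)) : ML2 P B ->
  ML2 P (fun w => cheb (in_W A) (B w) T).
Proof.
move=> aB; have -> : (fun w => cheb (in_W A) (B w) T)
    = (fun w => chebmx (in_W A) T *m B w) by apply/funext => w; rewrite chebE.
exact: ML2_mul.
Qed.

Section InitialError.
Variable i : 'I_N.
Let x0 := row i (in_X0 A).

(** The starting point is deterministic, so the law of the sample suffices. *)
Let init_sample (s : 'I_m) : let j := (false, 0%N, i, nat_of_ord s) in
  L1 P (fun w => sqnorm (sgrad pb i x0 (xi j w) - lgrad i x0)) /\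
  Ex (fun w => sqnorm (sgrad pb i x0 (xi j w) - lgrad i x0)) <= sigma ^+ 2.
Proof.
move=> j; have dj : drawn (in_kind A) m K j by apply/and3P; split=> //; exact: ltn_ord.
have mx := sample_measurable samp dj.
pose F z := sqnorm (sgrad pb i x0 z - lgrad i x0).
have mF : measurable_fun setT F.
  apply: measurable_sum => a; apply: measurable_sum => b; apply: measurable_funX.
  rewrite (ord1 a); under eq_fun do rewrite mxE [X in _ + X]mxE.
  apply: measurable_funB; first exact: (sgrad_measurable hA).
  exact: measurable_cst.
have F0 z : 0 <= F z by exact: sqnorm_ge0.
apply: L1_bounded; [exact: (measurableT_comp mF mx)|by move=> w; exact: F0|].
apply: le_trans (sgrad_variance hA i x0).
rewrite -(ge0_integral_pushforward mx P (D := setT) (f := EFin \o F))//.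
- apply: (@le_trans _ _ (\int[pb_dist pb i]_z (F z)%:E)%E); last by [].
  rewrite le_eqVlt; apply/orP; left; apply/eqP.
  by apply: eq_measure_integral => B mB _; exact: (sample_law samp).
- exact/measurable_EFinP.
- by move=> z _; rewrite lee_fin.
Qed.

Let initE w : row i (Dr 0%N w) - lgrad i x0 = m%:R^-1 *:
  \sum_(s < m) (sgrad pb i x0 (xi (false, 0%N, i, nat_of_ord s) w) - lgrad i x0).
Proof.
have mR : m%:R != 0 :> R by rewrite pnatr_eq0 -lt0n.
rewrite /= rowK m0E /batch_grad sumrB scalerBr; congr (_ - _).
by rewrite sumr_const card_ord -[lgrad i x0 *+ m]scaler_nat scalerA mulVf// scale1r.
Qed.

Let init_adapted : Madapted (gen 0) (fun w => row i (Dr 0%N w)).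
Proof.
have -> : (fun w => row i (Dr 0%N w)) = (fun w => batch_grad A m 0 i x0 w).
  by apply/funext => w; rewrite /= rowK m0E.
apply: (batch_grad_past (X := fun=> x0) wp i) => //; exact: Madapted_cst.
Qed.

Let bound w := m%:R^-1 * \sum_(s < m)
  sqnorm (sgrad pb i x0 (xi (false, 0%N, i, nat_of_ord s) w) - lgrad i x0).

Let bound_le w : sqnorm (row i (Dr 0%N w) - lgrad i x0) <= bound w.
Proof. by rewrite initE; exact: sqnorm_mean. Qed.

Let bound_L1 : L1 P bound.
Proof. by apply: L1Z; apply: L1_sum => s; have [] := init_sample s. Qed.

Lemma init_error_ML2 : ML2 P (fun w => row i (Dr 0%N w) - lgrad i x0).
Proof.
apply: (ML2_le _ bound_le bound_L1) => a b.
apply: Madapted_measurable; first exact: (gen_measurable samp (k:=0%N)).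
by apply: MadaptedB; [exact: init_adapted|exact: Madapted_cst].
Qed.

Lemma init_error_le :
  Ex (fun w => sqnorm (row i (Dr 0%N w) - lgrad i x0)) <= sigma ^+ 2.
Proof.
have mR : 0 < m%:R :> R by rewrite ltr0n.
apply: le_trans (Ex_le (L1_sqnorm init_error_ML2) bound_L1 bound_le) _.
rewrite /bound ExZ; last by apply: L1_sum => s; have [] := init_sample s.
rewrite (Ex_sum (P := P)) => [|s]; last by have [] := init_sample s.
rewrite mulrC ler_pdivrMr//.
apply: (@le_trans _ _ (\sum_(s < m) sigma ^+ 2)).
  by apply: ler_sum => s _; have [] := init_sample s.
by rewrite sumr_const card_ord mulr_natr.
Qed.

Lemma init_D_adapted : Madapted (gen 0) (fun w => row i (Dr 0%N w)).
Proof. exact: init_adapted. Qed.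

Lemma init_D_ML2 : ML2 P (fun w => row i (Dr 0%N w)).
Proof.
have := ML2D init_error_ML2 (ML2_cst P (lgrad i x0)).
by under [X in ML2 _ X -> _]eq_fun do rewrite subrK.
Qed.

End InitialError.

(** The invariant of the run. Adaptedness belongs to it because square integrability of gradients at
    X^(k) includes their measurability. *)
Definition regular k : Prop :=
  [/\ Madapted (gen k) (fun w => Xr k w), Madapted (gen k) (fun w => Dr k w) &
      Madapted (gen k) (fun w => Yr k w)] /\
  [/\ ML2 P (fun w => Xr k w), ML2 P (fun w => Dr k w) & ML2 P (fun w => Yr k w)].

Lemma regular0 : regular 0.
Proof.
have aD : Madapted (gen 0) (fun w => Dr 0%N w).
  by apply: Madapted_rows => i; exact: init_D_adapted.
have D2 : ML2 P (fun w => Dr 0%N w) by apply: ML2_rows => i; exact: init_D_ML2.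
split; split.
- exact: Madapted_cst.
- exact: aD.
- exact: (cheb_adapted (in_T0 A) aD).
- exact: ML2_cst.
- exact: D2.
- exact: (cheb_ML2 (in_T0 A) D2).
Qed.

Section Step.
Variable k : nat.
Hypothesis kK : (k < K)%N.
Hypothesis reg_k : regular k.

(** X^(k+1) is computed from the iterates at k before the batch k + 1 is drawn; this allows both
    points of the batch difference to be frozen. *)
Lemma next_X_adapted : Madapted (gen k) (fun w => Xr k.+1 w).
Proof.
have [[aX aD aY] _] := reg_k; apply: Madapted_rows => i.
have -> : (fun w => row i (Xr k.+1 w)) = (fun w => proxk k
    (row i (cheb (in_W A) (Xr k w) (in_T A)) - in_alpha A k *: row i (Yr k w))).
  by apply/funext => w; rewrite run_X run_Z.
apply: prox_adapted; apply: MadaptedB; last by apply: MadaptedZ; exact: Madapted_row.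
by apply: Madapted_row; exact: cheb_adapted.
Qed.

Lemma next_X_ML2 : ML2 P (fun w => Xr k.+1 w).
Proof.
have [[aX aD aY] [X2 D2 Y2]] := reg_k; apply: ML2_rows => i.
have -> : (fun w => row i (Xr k.+1 w)) = (fun w => proxk k
    (row i (cheb (in_W A) (Xr k w) (in_T A)) - in_alpha A k *: row i (Yr k w))).
  by apply/funext => w; rewrite run_X run_Z.
apply: (@prox_ML2 k k).
  apply: MadaptedB; last by apply: MadaptedZ; exact: Madapted_row.
  by apply: Madapted_row; exact: cheb_adapted.
apply: ML2B; last by apply: ML2Z; exact: ML2_row.
by apply: ML2_row; exact: cheb_ML2.
Qed.

Let gen_S : gen k `<=` <<s gen k.+1 >>.
Proof. by apply: gen_mono. Qed.

Section Agent.
Variable i : 'I_N.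
Let x w := row i (Xr k w).
Let x' w := row i (Xr k.+1 w).
Let g w := lgrad i (x w).
Let g' w := lgrad i (x' w).
Let bd w := batch_grad A m k.+1 i (x' w) w - batch_grad A m k.+1 i (x w) w.
Let e w := row i (Dr k w) - g w.
Let b := in_beta A k.
Let zt w := in_vt A k.+1 i w - g' w.

Let ax : Madapted (gen k) x.
Proof. by have [[aX _ _] _] := reg_k; exact: Madapted_row. Qed.

Let ax' : Madapted (gen k) x'.
Proof. exact: (Madapted_row i next_X_adapted). Qed.

Let x2 : ML2 P x.
Proof. by have [_ [X2 _ _]] := reg_k; exact: ML2_row. Qed.

Let x2' : ML2 P x'.
Proof. exact: (ML2_row i next_X_ML2). Qed.

Let ag : Madapted (gen k) g. Proof. exact: (lgrad_adapted hA i ax). Qed.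
Let ag' : Madapted (gen k) g'. Proof. exact: (lgrad_adapted hA i ax'). Qed.
Let g2 : ML2 P g. Proof. exact: (lgrad_ML2 hA samp i ax x2). Qed.
Let g2' : ML2 P g'. Proof. exact: (lgrad_ML2 hA samp i ax' x2'). Qed.

Let bd2 : ML2 P bd.
Proof. exact: (batch_diff_ML2 wp hA samp i kK ax ax' x2 x2'). Qed.

(** A fresh estimator is measurable for [past_fresh], generated by some of the samples up to k + 1;
    the other option is a batch gradient. *)
Let est_adapted : Madapted (gen k.+1) (fun w => in_vt A k.+1 i w).
Proof.
move=> a j; rewrite (ord1 a); case E : (in_kind A).
- move=> _ B mB; rewrite setTI.
  have := opt; rewrite /est_option E => /(_ k i j B kK mB).
  apply: smallest_sub; first exact: smallest_sigma_algebra.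
  move=> C [s [ds hs] Cs]; apply: sub_sigma_algebra; exists s => //; split=> //.
  by case: hs => [h|[_ -> _]//]; exact: leqW.
- have -> : (fun w => in_vt A k.+1 i w 0 j)
      = (fun w => batch_grad A m k.+1 i (x' w) w 0 j).
    apply/funext => w; have := opt; rewrite /est_option E.
    by move=> /(_ k i w kK) ->.
  exact: (batch_grad_past wp i (Madapted_sub gen_S ax') (leqnn _) kK 0 j).
Qed.

Let zt2_le : ML2 P zt /\ Ex (fun w => sqnorm (zt w)) <= hsigma ^+ 2.
Proof.
have mz a j : measurable_fun setT (fun w => zt w a j).
  apply: Madapted_measurable; first exact: (gen_measurable samp (k:=k.+1)).
  by apply: MadaptedB; [exact: est_adapted|exact: (Madapted_sub gen_S)].
have [h1 h2] : L1 P (fun w => sqnorm (zt w)) /\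
    Ex (fun w => sqnorm (zt w)) <= hsigma ^+ 2.
  apply: L1_bounded; last exact: var.
    apply: measurable_sum => a; apply: measurable_sum => j.
    by apply: measurable_funX; exact: mz.
  by move=> w; exact: sqnorm_ge0.
by split=> //; exact: (ML2_le mz (fun w => lexx _) h1).
Qed.

Let zt_mean_zero : Mmean_zero P (gen k) zt.
Proof.
move=> a j F sF; rewrite (ord1 a); have mF := Gm sF.
have [vi vE] := unb i j kK.
have gi : P.-integrable setT (EFin \o (fun w => g' w 0 j)) by exact: (L2_L1 (g2' 0 j)).
have hF f : P.-integrable setT f -> P.-integrable F f by move=> h; apply: integrableS h.
under eq_Rintegral do rewrite /zt mxE [X in _ + X]mxE.
rewrite RintegralB//; [|exact: hF|exact: hF].
by rewrite /Rintegral (vE F sF) subrr.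
Qed.

(** With a and c the new and old true gradients: old error plus centered batch difference, weighted
    1 - b, and estimator noise, weighted b. *)
Let momentum_id (u v a c z : 'rV[R]_p) :
  (1 - b) *: (u + v) + b *: z - a =
  (1 - b) *: ((u - c) + (v - (a - c))) + b *: (z - a).
Proof.
by clearbody b; apply/rowP => j; rewrite !mxE; ring.
Qed.

Let increment_id (u v a c z : 'rV[R]_p) :
  (1 - b) *: (u + v) + b *: z - u =
  ((1 - b) *: v + b *: (z - a)) + (b *: (a - c) + (- b) *: (u - c)).
Proof. by clearbody b; apply/rowP => j; rewrite !mxE; ring. Qed.

Let momentum_split (v z a u : 'rV[R]_p) :
  sqnorm (((1 - b) *: v + b *: z) + (b *: a + (- b) *: u)) <=
  4 * ((1 - b) ^+ 2 * sqnorm v + b ^+ 2 * sqnorm z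
       + b ^+ 2 * sqnorm a + b ^+ 2 * sqnorm u).
Proof.
clearbody b; apply: le_trans (sqnormD_le _ _) _.
have := sqnormD_le ((1 - b) *: v) (b *: z).
have := sqnormD_le (b *: a) ((- b) *: u).
rewrite !sqnormZ sqrrN.
move: (sqnorm _) (sqnorm _) (sqnorm _) (sqnorm _) (sqnorm _) (sqnorm _) => *.
lra.
Qed.

Let err_rec w : row i (Dr k.+1 w) - g' w =
  (1 - b) *: (e w + (bd w - (g' w - g w))) + b *: zt w.
Proof.
by rewrite run_D (momentum_id _ _ (g' w) (g w)). Qed.

Let e_adapted : Madapted (gen k) e.
Proof.
by have [[_ aD _] _] := reg_k; apply: MadaptedB => //; exact: Madapted_row.
Qed.

Let e_ML2 : ML2 P e.
Proof. by have [_ [_ D2 _]] := reg_k; apply: ML2B => //; exact: ML2_row. Qed.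

Lemma next_D_row : Madapted (gen k.+1) (fun w => row i (Dr k.+1 w)) /\
  ML2 P (fun w => row i (Dr k.+1 w)).
Proof.
have E : (fun w => row i (Dr k.+1 w)) =
    (fun w => (1 - b) *: (row i (Dr k w) + bd w) + b *: in_vt A k.+1 i w).
  by apply/funext => w; rewrite run_D.
have [[_ aD _] [_ D2 _]] := reg_k; rewrite E; split.
- apply: MadaptedD; apply: MadaptedZ; last exact: est_adapted.
  apply: MadaptedD; first by apply: (Madapted_sub gen_S); exact: Madapted_row.
  apply: MadaptedB; apply: (batch_grad_past wp) => //.
    exact: (Madapted_sub gen_S).
  exact: (Madapted_sub gen_S).
- apply: ML2D; apply: ML2Z; first by apply: ML2D => //; exact: ML2_row.
  have := ML2D (proj1 zt2_le) g2'.
  by under [X in ML2 _ X -> _]eq_fun do rewrite /zt subrK.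
Qed.

(** The old error is orthogonal to both noise terms. These may come from the same batch, so between
    them only |A + B|^2 <= 2 |A|^2 + 2 |B|^2 is available, whence the factors 2. *)
Lemma error_step :
  Ex (fun w => sqnorm (row i (Dr k.+1 w) - lgrad i (row i (Xr k.+1 w)))) <=
  (1 - b) ^+ 2 * Ex (fun w => sqnorm (row i (Dr k w) - lgrad i (row i (Xr k w))))
  + 2 * (1 - b) ^+ 2 * (L ^+ 2 *
      Ex (fun w => sqnorm (row i (Xr k.+1 w) - row i (Xr k w))))
  + 2 * b ^+ 2 * hsigma ^+ 2.
Proof.
have dl2 : ML2 P (fun w => bd w - (g' w - g w)) by apply: ML2B => //; exact: ML2B.
have dl0 : Mmean_zero P (gen k) (fun w => bd w - (g' w - g w)).
  exact: (batch_diff_mean_zero wp hA m_gt0 samp i kK ax ax' x2 x2').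
have [z2 zle] := zt2_le.
have bdsq : Ex (fun w => sqnorm (bd w)) <= L ^+ 2 * Ex (fun w => sqnorm (x' w - x w)).
  exact: (batch_diff_sq wp hA m_gt0 samp i kK ax ax' x2 x2').
have ce := Ex_sqnorm_centered (gen_measurable samp (k:=k)) (MadaptedB ag' ag)
  (ML2B g2' g2) dl2 dl0.
have mom := Ex_sqnorm_momentum (gen_measurable samp (k:=k)) b e_adapted e_ML2
  dl2 dl0 z2 zt_mean_zero.
change (Ex (fun w => sqnorm (row i (Dr k.+1 w) - g' w)) <=
  (1 - b) ^+ 2 * Ex (fun w => sqnorm (e w)) + 2 * (1 - b) ^+ 2 * (L ^+ 2 *
      Ex (fun w => sqnorm (x' w - x w))) + 2 * b ^+ 2 * hsigma ^+ 2).
move: (err_rec) => rec.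
clearbody e bd g g' zt x x' b.
have cE : Ex (fun w => sqnorm (bd w - (g' w - g w) + (g' w - g w))) =
    Ex (fun w => sqnorm (bd w)) by apply: eq_Rintegral => w _; rewrite subrK.
rewrite cE in ce.
have c0 : 0 <= 2 * (1 - b) ^+ 2 by rewrite mulr_ge0 ?sqr_ge0.
have c1 : 0 <= 2 * b ^+ 2 by rewrite mulr_ge0 ?sqr_ge0.
apply: (@le_trans _ _
    (Ex (fun w => sqnorm ((1 - b) *: (e w + (bd w - (g' w - g w))) + b *: zt w)))).
  rewrite le_eqVlt; apply/orP; left; apply/eqP.
  by apply: eq_Rintegral => w _; rewrite -rec.
apply: (le_trans mom); apply: lerD; last exact: ler_wpM2l.
by rewrite lerD2l; apply: ler_wpM2l => //; exact: le_trans bdsq.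
Qed.

Lemma increment_step : 0 <= b <= 1 ->
  Ex (fun w => sqnorm (row i (Dr k.+1 w) - row i (Dr k w))) <=
  4 * (L ^+ 2 * Ex (fun w => sqnorm (row i (Xr k.+1 w) - row i (Xr k w)))
    + b ^+ 2 * hsigma ^+ 2
    + b ^+ 2 * Ex (fun w => sqnorm (row i (Dr k w) - lgrad i (row i (Xr k w))))).
Proof.
move=> /andP[b0 b1]; have [z2 zle] := zt2_le.
have lbd := L1_sqnorm bd2; have lz := L1_sqnorm z2; have le := L1_sqnorm e_ML2.
have lx := L1_sqnorm (ML2B x2' x2).
have [_ D2'] := next_D_row; have [_ [_ D2 _]] := reg_k.
pose h w := 4 * ((1 - b) ^+ 2 * sqnorm (bd w) + b ^+ 2 * sqnorm (zt w)
  + b ^+ 2 * (L ^+ 2 * sqnorm (x' w - x w)) + b ^+ 2 * sqnorm (e w)).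
have h1 : L1 P h by apply: L1Z; do ?[apply: L1D|exact: L1Z]; apply: L1Z; exact: L1Z.
apply: (@le_trans _ _ (Ex h)).
  apply: Ex_le => //; first by apply: L1_sqnorm; apply: ML2B => //; exact: ML2_row.
  move=> w; have -> : row i (Dr k.+1 w) - row i (Dr k w) =
      ((1 - b) *: bd w + b *: zt w) + (b *: (g' w - g w) + (- b) *: e w).
    by rewrite run_D (increment_id _ _ (g' w) (g w)).
  apply: le_trans (momentum_split _ _ _ _) _; rewrite /h.
  have lip := ler_wpM2l (sqr_ge0 b) (lgrad_lip hA i (x' w) (x w)).
  apply: ler_wpM2l => //; rewrite lerD2r lerD2l; exact: lip.
have bdle : Ex (fun w => sqnorm (bd w)) <= L ^+ 2 * Ex (fun w => sqnorm (x' w - x w)).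
  exact: (batch_diff_sq wp hA m_gt0 samp i kK ax ax' x2 x2').
change (Ex h <= 4 * (L ^+ 2 * Ex (fun w => sqnorm (x' w - x w))
  + b ^+ 2 * hsigma ^+ 2 + b ^+ 2 * Ex (fun w => sqnorm (e w)))).
rewrite /h; clear h h1; clearbody e bd g g' zt x x' b.
rewrite (Ex_lin4 4 _ _ _ _ lbd lz (L1Z (L ^+ 2) lx) le) (ExZ _ lx).
have s0 : 0 <= Ex (fun w => sqnorm (x' w - x w)) by apply: Ex_ge0 => w; exact: sqnorm_ge0.
apply: ler_wpM2l => //; rewrite lerD2r.
(* Merges the batch difference and the change of the true gradient into one term in L^2 |X' -
   X|^2. *)
have c1 : (1 - b) ^+ 2 + b ^+ 2 <= 1 by nra.
have L20 := sqr_ge0 L.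
have t1 := ler_wpM2l (sqr_ge0 (1 - b)) bdle.
have t2 := ler_wpM2l (sqr_ge0 b) zle.
have t3 := ler_wpM2r (mulr_ge0 L20 s0) c1.
move: t1 t2 t3.
move: (Ex (fun w => sqnorm (bd w))) (Ex (fun w => sqnorm (zt w)))
  (Ex (fun w => sqnorm (x' w - x w))) => *.
lra.
Qed.

End Agent.

Lemma regularS : regular k.+1.
Proof.
have [[aX aD aY] [X2 D2 Y2]] := reg_k.
have aD' : Madapted (gen k.+1) (fun w => Dr k.+1 w).
  by apply: Madapted_rows => i; have [] := next_D_row i.
have D2' : ML2 P (fun w => Dr k.+1 w).
  by apply: ML2_rows => i; have [] := next_D_row i.
split; split.
- exact: (Madapted_sub gen_S next_X_adapted).
- exact: aD'.
- apply: (cheb_adapted (in_T A)); apply: MadaptedB.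
    by apply: MadaptedD => //; exact: (Madapted_sub gen_S).
  exact: (Madapted_sub gen_S).
- exact: next_X_ML2.
- exact: D2'.
- by apply: (cheb_ML2 (in_T A)); apply: ML2B => //; exact: ML2D.
Qed.

End Step.

Lemma regular_le k : (k <= K)%N -> regular k.
Proof.
elim: k => [_|k IH kK]; first exact: regular0.
by apply: regularS => //; apply: IH; exact: ltnW.
Qed.

End Run.

(** * One iteration *)

Section Consensus.
Context (R : realType) (N p : nat).
Hypothesis N0 : (0 < N)%N.

(** Write A as r times A / r and apply [sqnorm_contract]; for r = 0 the hypothesis forces A = 0. *)
Lemma sqnorm_contractD (r a : R) (A B : 'M[R]_(N, p)) : 0 <= r < 1 -> 0 <= a ->
  sqnorm A <= r ^+ 2 * a -> sqnorm (A + B) <= r * a + (1 - r)^-1 * sqnorm B.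
Proof.
move=> /andP[r0 r1] a0 Aa; have [rp|rn|rz] := ltgtP r 0.
- by move: r0; rewrite leNgt rp.
- have -> : A = r *: (r^-1 *: A) by rewrite scalerA mulfV ?scale1r// gt_eqF.
  apply: le_trans (sqnorm_contract _ _ _) _; first by rewrite r0.
  rewrite lerD2r ler_wpM2l// sqnormZ exprVn ler_pdivrMl ?exprn_gt0//.
- have := sqnorm_ge0 A; rewrite le_eqVlt => /orP[/eqP A0|A0].
    rewrite [in leLHS](sqnorm_eq0 (esym A0)) add0r rz mul0r subr0 invr1 mul1r.
    by rewrite add0r.
  by move: (lt_le_trans A0 Aa); rewrite rz expr0n mul0r ltxx.
Qed.

Lemma sqnorm_perp_tracking (r : R) (Y D D' Y' : 'M[R]_(N, p)) : 0 <= r < 1 ->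
  sqnorm (perp Y') <= r ^+ 2 * sqnorm (perp (Y + D' - D)) ->
  sqnorm (perp Y') <= r * sqnorm (perp Y) + (1 - r)^-1 * sqnorm (D' - D).
Proof.
move=> /andP[r0 r1] /le_trans; apply.
have -> : r ^+ 2 * sqnorm (perp (Y + D' - D)) =
    sqnorm (r *: perp Y + r *: perp (D' - D)).
  by rewrite -scalerDr -perpD sqnormZ addrA.
apply: le_trans (sqnorm_contract _ _ _) _; first by rewrite r0.
rewrite lerD2l; apply: ler_wpM2l; first by rewrite invr_ge0 subr_ge0 ltW.
rewrite sqnormZ; apply: le_trans (sqnorm_perp_le N0 (D' - D)).
by apply: ler_piMl; [exact: sqnorm_ge0|rewrite expr_le1// ltW].
Qed.

Lemma sqnormD3 m (A B C : 'M[R]_(m, p)) :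
  sqnorm (A + B + C) <= 3 * sqnorm A + 3 * sqnorm B + 3 * sqnorm C.
Proof.
have := ip_young1 A B; have := ip_young1 A C; have := ip_young1 B C.
rewrite sqnormD sqnormD ipDl.
move: (ip _ _) (ip _ _) (ip _ _) (sqnorm _) (sqnorm _) (sqnorm _) => *; lra.
Qed.

Lemma sqnorm_increment (A B : 'M[R]_(N, p)) : sqnorm (B - A) <=
  N%:R * sqnorm (avgrow B - avgrow A) + 2 * sqnorm (perp B) + 2 * sqnorm (perp A).
Proof.
rewrite (sqnorm_decomp N0) avgrowB perpB.
have := sqnormD_le (perp B) (- perp A); rewrite sqnormN.
move: (sqnorm _) (N%:R * _) (sqnorm _) (sqnorm _) => *; lra.
Qed.

End Consensus.

(** Every term is expressed in the units x / al, al y / q^2, al e and De / al; al L <= 1 / 64 turns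
    al L^2 x into at most x / (64 al). *)
Lemma stationarity_arith (R : realType) (al q L x y e De sz x' s t : R) :
  0 < al -> 0 < q -> q <= 1 -> 0 <= L -> al * L <= 64^-1 ->
  0 <= x -> 0 <= y -> 0 <= sz -> 0 <= De -> 0 <= e ->
  s <= 2 * (al^-1 ^+ 2 * t)
       + 2 * (3 * y + 3 * (2 * (L ^+ 2 * x) + 2 * e) + 3 * (L ^+ 2 * sz)) ->
  t <= De + 2 * sz + 2 * x' -> sz <= x -> x' <= x + q^-1 * (al ^+ 2 * y) ->
  al * (s + L ^+ 2 * sz) <= 12 * (al^-1 * x + al / q ^+ 2 * y + al * e + al^-1 * De).
Proof.
move=> al0 q0 q1 L0 alL x0 y0 sz0 De0 e0 sle tle szx x'le.
have a0 : 0 < al^-1 by rewrite invr_gt0.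
have aK : al * al^-1 = 1 by rewrite mulfV// gt_eqF.
have v1 : q^-1 <= (q ^+ 2)^-1.
  by rewrite lef_pV2 ?posrE ?exprn_gt0// expr2 ler_piMl// ltW.
have v2 : 1 <= (q ^+ 2)^-1 by rewrite invf_ge1 ?exprn_gt0// expr_le1// ltW.
have Lx : al * (L ^+ 2 * x) <= al^-1 * (64^-1 * x).
  have -> : al * (L ^+ 2 * x) = al^-1 * ((al * L) ^+ 2 * x).
    by field; rewrite gt_eqF.
  have aL0 : 0 <= al * L by rewrite mulr_ge0// ltW.
  rewrite ler_pM2l//; apply: ler_wpM2r => //; apply: le_trans (alL).
  by rewrite expr2 ler_piMl//; apply: le_trans alL _; lra.
have Lsz : al * (L ^+ 2 * sz) <= al * (L ^+ 2 * x).
  by rewrite ler_pM2l// ler_wpM2l// sqr_ge0.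
have h1 := ler_wpM2l (ltW al0) sle.
have h2 := ler_wpM2l (ltW a0) tle.
have h3 := ler_wpM2l (ltW a0) x'le.
have h4 := ler_wpM2l (ltW a0) szx.
have y1 : q^-1 * (al * y) <= (q ^+ 2)^-1 * (al * y) by rewrite ler_wpM2r// mulr_ge0// ltW.
have y2 : 1 * (al * y) <= (q ^+ 2)^-1 * (al * y) by rewrite ler_wpM2r// mulr_ge0// ltW.
have e1 : al * (al^-1 ^+ 2 * t) = al^-1 * t by rewrite expr2 !mulrA aK mul1r.
have e2 : al^-1 * (q^-1 * (al ^+ 2 * y)) = q^-1 * (al * y).
  by rewrite mulrCA expr2 -mulrA [al^-1 * _]mulrA (mulrC al^-1) aK mul1r.
have aDe : 0 <= al^-1 * De by rewrite mulr_ge0// ltW.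
have ax : 0 <= al^-1 * x by rewrite mulr_ge0// ltW.
have ae : 0 <= al * e by rewrite mulr_ge0// ltW.
have ay : 0 <= al * y by rewrite mulr_ge0// ltW.
have e3 : al * (2 * (al^-1 ^+ 2 * t)
    + 2 * (3 * y + 3 * (2 * (L ^+ 2 * x) + 2 * e) + 3 * (L ^+ 2 * sz))) =
    2 * (al^-1 * t) + 6 * (al * y) + 12 * (al * (L ^+ 2 * x)) + 12 * (al * e)
    + 6 * (al * (L ^+ 2 * sz)) by rewrite -e1; ring.
rewrite e3 in h1.
rewrite mulrDr e2 in h3; rewrite !(mulrDr al^-1) in h2.
rewrite -[al / q ^+ 2 * y]mulrA (mulrCA al) mulrDr.
move: h1 h2 h3 h4 y1 y2 Lx Lsz aDe ax ae ay; rewrite !(mulrCA al^-1 2) (mulrCA al^-1 64^-1).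
move: (al * (L ^+ 2 * x)) (al * (L ^+ 2 * sz)) => lx lsz.
move: (al^-1 * De) (al^-1 * x) (al^-1 * sz) (al^-1 * x') (al^-1 * t) (al * y) (al * e)
  (al * s) => *.
lra.
Qed.

(** * Composite objective and one proximal step *)

Section ProxStep.
Context (R : realType) (N p : nat) (d : measure_display) (Xi : measurableType d).
Variables (pb : problem R N p Xi) (L sigma phistar : R).
Hypothesis N0 : (0 < N)%N.
Hypothesis wp : well_posed pb.
Hypothesis hA : assumptionA pb L sigma phistar.
Local Notation r := (pb_reg pb).
Local Notation lgrad i := (grad (local_obj pb i)).
Local Notation f := (smooth_obj pb).
Hypothesis lip : forall i a b,
  sqnorm (lgrad i a - lgrad i b) <= L ^+ 2 * sqnorm (a - b).

Let NR : 0 < N%:R :> R. Proof. by rewrite ltr0n. Qed.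

Lemma smooth_objE : f = N%:R^-1 \*: (\sum_i local_obj pb i).
Proof. by apply/funext => x; rewrite /smooth_obj /= fct_sumE. Qed.

Lemma smooth_obj_differentiable x : differentiable (f : 'rV[R]_p -> R) x.
Proof.
rewrite smooth_objE; apply: differentiableZ; apply: differentiable_sum => i.
exact: obj_differentiable.
Qed.

Lemma grad_smooth_obj x : grad f x = N%:R^-1 *: \sum_i lgrad i x.
Proof.
have dl i v : derivable (local_obj pb i : 'rV[R]_p -> R) x v.
  by apply: diff_derivable; exact: obj_differentiable.
apply/rowP => j; rewrite [LHS]mxE [RHS]mxE summxE smooth_objE deriveZ.
  by rewrite derive_sum//; congr (_ * _); apply: eq_bigr => i _; rewrite mxE.
exact: derivable_sum.
Qed.

Lemma grad_smooth_obj_lip a b :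
  sqnorm (grad f a - grad f b) <= L ^+ 2 * sqnorm (a - b).
Proof.
rewrite !grad_smooth_obj -scalerBr -sumrB.
apply: le_trans (sqnorm_mean _ N0) _.
rewrite ler_pdivrMl//; apply: le_trans (ler_sum _ (fun i _ => lip i a b)) _.
by rewrite sumr_const card_ord -[leLHS]mulr_natl.
Qed.

Definition obj (x : 'rV[R]_p) : R := f x + reg r x.

Lemma phiE x : dom_reg r x -> phi pb x = (obj x)%:E.
Proof.
move=> dx; rewrite /phi /local_phi.
under eq_bigr do rewrite (regE (reg_gtNy hA) dx) -EFinD.
rewrite sumEFin -EFinM; congr (_%:E).
rewrite big_split /= mulrDr; congr (_ + _).
by rewrite sumr_const card_ord -[reg r x *+ N]mulr_natl mulKf// gt_eqF.
Qed.

Variables (rt al : R) (X D Y Z X' : 'M[R]_(N, p)).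
Hypothesis rt01 : 0 <= rt < 1.
Hypothesis al0 : 0 < al.
Hypothesis domX : dom_reg r (avgrow X).
Hypothesis avgZ : avgrow Z = avgrow X.
Hypothesis perpZX : sqnorm (perp Z) <= rt ^+ 2 * sqnorm (perp X).
Hypothesis track : avgrow Y = avgrow D.
Hypothesis stepX : forall i,
  row i X' = prox (scale_fun al r) (row i Z - al *: row i Y).

Let nexp a b := prox_nonexp (reg_gtNy hA) (reg_convex hA) (reg_prox hA) domX a b al0.

Let rt2 : rt ^+ 2 <= 1.
Proof. by have /andP[h1 h2] := rt01; rewrite expr_le1// ltW. Qed.

Let perpZ_le : sqnorm (perp Z) <= sqnorm (perp X).
Proof. by apply: le_trans perpZX _; apply: ler_piMl => //; exact: sqnorm_ge0. Qed.

(** The prox of the averaged argument is a common comparison point for all rows: the mean minimizes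
    the squared distances, and the prox is nonexpansive. *)
Lemma sqnorm_perp_prox_step : sqnorm (perp X') <=
  rt * sqnorm (perp X) + (1 - rt)^-1 * (al ^+ 2 * sqnorm (perp Y)).
Proof.
apply: le_trans (sqnorm_perp_min N0 X'
  (prox (scale_fun al r) (avgrow Z - al *: avgrow Y))) _.
apply: (@le_trans _ _ (sqnorm (perp (Z - al *: Y)))).
  rewrite [leRHS]sqnorm_rows; apply: ler_sum => i _; rewrite row_perp stepX.
  apply: le_trans (nexp _ _) _; rewrite avgrowB avgrowZ.
  by rewrite (_ : row i (Z - _) = row i Z - al *: row i Y) // linearB linearZ.
rewrite perpB perpZ; apply: le_trans (sqnorm_contractD _ rt01 _ perpZX) _.
  exact: sqnorm_ge0.
by rewrite sqnormN sqnormZ.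
Qed.

Lemma next_domX : dom_reg r (avgrow X').
Proof.
have [] := reg_mean (reg_gtNy hA) (reg_convex hA) N0 (F := fun i => row i X') => //.
move=> i; rewrite stepX; exact: (dom_reg_prox (reg_gtNy hA) (reg_prox hA) domX).
Qed.

Let De := sqnorm (avgrow X' - avgrow X).
Let x := N%:R^-1 * sqnorm (perp X).
Let y := N%:R^-1 * sqnorm (perp Y).
Let e := N%:R^-1 * \sum_i sqnorm (row i D - lgrad i (row i X)).

Lemma gradient_error : sqnorm (grad f (avgrow X) - avgrow Y) <= 2 * (L ^+ 2 * x) + 2 * e.
Proof.
rewrite track grad_smooth_obj /avgrow -/(avgrow X) -scalerBr -sumrB.
apply: le_trans (sqnorm_mean _ N0) _.
have -> : 2 * (L ^+ 2 * x) + 2 * e = N%:R^-1 *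
    (2 * (L ^+ 2 * sqnorm (perp X)) + 2 * \sum_i sqnorm (row i D - lgrad i (row i X))).
  by rewrite /x /e; move: (sqnorm _) (\sum_i _) (N%:R^-1) => *; ring.
rewrite ler_wpM2l ?invr_ge0 ?(ltW NR)// sqnorm_rows.
rewrite 2!mulr_sumr [X in _ <= _ + X]mulr_sumr -big_split /=.
apply: ler_sum => i _; rewrite row_perp.
have -> : lgrad i (avgrow X) - row i D =
    (lgrad i (avgrow X) - lgrad i (row i X)) - (row i D - lgrad i (row i X)).
  by rewrite opprB addrA subrK.
apply: le_trans (sqnormD_le _ _) _; rewrite sqnormN lerD2r ler_wpM2l//.
by rewrite (sqnormBC (row i X)).
Qed.

(** Sum over the agents the variational inequality tested at xbar and split into mean and perp
    parts; the term - |X'_perp|^2 pays for both Young inequalities. *)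
Lemma reg_step : al * (reg r (avgrow X') - reg r (avgrow X)) <=
  - De - al * ip (avgrow Y) (avgrow X' - avgrow X) + 2^-1 * x + 2^-1 * (al ^+ 2 * y).
Proof.
have domX' i : dom_reg r (row i X').
  by rewrite stepX; exact: (dom_reg_prox (reg_gtNy hA) (reg_prox hA) domX).
have [_ rm] := reg_mean (reg_gtNy hA) (reg_convex hA) N0 domX'.
pose V := Z - al *: Y; pose U := X' - avgmx R N *m X.
have h : al * (\sum_i reg r (row i X') - N%:R * reg r (avgrow X)) <= ip (V - X') U.
  rewrite ip_rows mulrBr mulr_sumr mulrCA mulr_natl -[N in _ *+ N]card_ord.
  rewrite -sumr_const -sumrB; apply: ler_sum => i _.
  rewrite -mulrBr !linearB/= linearZ/= row_avgmx stepX.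
  exact: (prox_ineq (reg_gtNy hA) (reg_convex hA) (reg_prox hA) domX).
have aU : avgrow U = avgrow X' - avgrow X.
  rewrite avgrowB; congr (_ - _); rewrite /avgrow.
  under eq_bigr do rewrite row_avgmx.
  by rewrite sumr_const card_ord -[avgrow X *+ N]scaler_nat scalerA mulVf ?scale1r// gt_eqF.
have pU : perp U = perp X' by rewrite perpB {2}/perp mulmxA (avgmx_idem _ N0) subrr subr0.
have ipE : ip (V - X') U = N%:R * (- De - al * ip (avgrow Y) (avgrow X' - avgrow X))
    + (ip (perp Z) (perp X') - al * ip (perp Y) (perp X') - sqnorm (perp X')).
  rewrite (ip_decomp N0) aU pU /V !avgrowB avgrowZ avgZ.
  rewrite (perpB (Z - _)) (perpB Z) perpZ (ipBl (perp Z - _)) (ipBl (perp Z)) ipZl.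
  rewrite (ip_self (perp X')); congr (N%:R * _ + _).
  have -> : avgrow X - al *: avgrow Y - avgrow X' =
      - (avgrow X' - avgrow X) - al *: avgrow Y by rewrite opprB addrAC.
  by rewrite ipBl ipNl ip_self ipZl.
have y1 := ip_young1 (perp Z) (perp X').
have y2 := ip_young1 (- al *: perp Y) (perp X').
rewrite ipZl sqnormZ sqrrN in y2.
have rm' : N%:R * reg r (avgrow X') <= \sum_i reg r (row i X').
  by rewrite -ler_pdivlMl.
have h2 : al * (N%:R * reg r (avgrow X')) <= al * (\sum_i reg r (row i X')).
  by rewrite ler_pM2l.
rewrite -(ler_pM2l NR) /x /y.
have -> : N%:R * (- De - al * ip (avgrow Y) (avgrow X' - avgrow X)
    + 2^-1 * (N%:R^-1 * sqnorm (perp X)) + 2^-1 * (al ^+ 2 * (N%:R^-1 * sqnorm (perp Y))))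
  = N%:R * (- De - al * ip (avgrow Y) (avgrow X' - avgrow X))
    + 2^-1 * sqnorm (perp X) + 2^-1 * (al ^+ 2 * sqnorm (perp Y)).
  move: (ip _ _) (sqnorm (perp X)) (sqnorm (perp Y)) => u v w; clearbody De.
  by field; rewrite gt_eqF.
move: h; rewrite ipE.
move: y1 y2 h2 perpZ_le; move: (N%:R * (- De - _)) (reg r (avgrow X))
  (reg r (avgrow X')) (\sum_i _) (sqnorm (perp Z)) (sqnorm (perp X))
  (sqnorm (perp X')) (al ^+ 2 * _) (ip (perp Z) _) (ip (perp Y) _)=> *; lra.
Qed.

Lemma obj_step : 0 <= L -> obj (avgrow X') + (3 / 4 * al^-1 - L / 2) * De <=
  obj (avgrow X) + 2^-1 * (al^-1 * x) + 2^-1 * (al * y)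
  + 2 * (al * L ^+ 2 * x) + 2 * (al * e).
Proof.
move=> L0; have h1 := descent (avgrow X) (avgrow X') L0 smooth_obj_differentiable
  grad_smooth_obj_lip.
have h2 := gradient_error.
have h3 := reg_step.
have ai : 0 < al^-1 by rewrite invr_gt0.
(* The weight 2 al spends De / (4 al) of the De / al gained in [reg_step], which leaves 3 / 4. *)
have h4 := ip_young (grad f (avgrow X) - avgrow Y) (avgrow X' - avgrow X)
  (mulr_gt0 (ltr0n R 2) al0).
rewrite ipBl -/De in h4.
have h3' := ler_wpM2l (ltW ai) h3.
have h2' := ler_wpM2l (ltW al0) h2.
rewrite /obj; rewrite -/De in h1.
move: h1 h2' h3' h4.
move: (ip (grad f (avgrow X)) _) (ip (avgrow Y) _) (f (avgrow X)) (f (avgrow X'))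
  (reg r (avgrow X)) (reg r (avgrow X')) (sqnorm (grad f _ - _)) => t1 t2 t3 t4 t5 t6 t7.
clearbody De x y e.
have aK : al^-1 * al = 1 by rewrite mulVf// gt_eqF.
have -> : (2 * al)^-1 = 2^-1 * al^-1 by rewrite invfM.
have -> : al^-1 * (al * (t6 - t5)) = t6 - t5 by rewrite mulrA aK mul1r.
have -> : al^-1 * (- De - al * t2 + 2^-1 * x + 2^-1 * (al ^+ 2 * y)) =
  - (al^-1 * De) - t2 + 2^-1 * (al^-1 * x) + 2^-1 * (al * y).
  by field; rewrite gt_eqF.
by move: (al^-1) => a; lra.
Qed.

Lemma stationarity_step : 0 <= L -> al * L <= 64^-1 ->
  al * stationarity pb L Z al <=
  12 * (al^-1 * x + al / (1 - rt) ^+ 2 * y + al * e + al^-1 * De).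
Proof.
move=> L0 alL.
pose sz := N%:R^-1 * sqnorm (perp Z).
pose x' := N%:R^-1 * sqnorm (perp X').
have NV : 0 <= N%:R^-1 :> R by rewrite invr_ge0 ltW.
have szx : sz <= x by rewrite ler_wpM2l.
have q0 : 0 < 1 - rt by have /andP[_ h] := rt01; rewrite subr_gt0.
have q1 : 1 - rt <= 1 by have /andP[h _] := rt01; rewrite gerBl.
have x'le : x' <= x + (1 - rt)^-1 * (al ^+ 2 * y).
  rewrite /x' /x /y !(mulrCA _ N%:R^-1) -mulrDr ler_wpM2l//.
  apply: le_trans sqnorm_perp_prox_step _; rewrite lerD2r.
  by apply: ler_piMl; [exact: sqnorm_ge0|have /andP[_ /ltW] := rt01].
have ge : sqnorm (avgrow Y - grad f (avgrow X)) <= 2 * (L ^+ 2 * x) + 2 * e.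
  by rewrite sqnormBC; exact: gradient_error.
(* The step actually taken, z_i - x_i', uses y_i in place of grad f(z_i). Nonexpansiveness bounds
   the discrepancy by y_i - grad f(z_i), split through ybar and grad f(xbar). *)
have nz i : sqnorm (prox_grad_map r (row i Z) (grad f (row i Z)) al) <=
    2 * (al^-1 ^+ 2 * sqnorm (row i (Z - X')))
    + 2 * (3 * sqnorm (row i (perp Y)) + 3 * sqnorm (avgrow Y - grad f (avgrow X))
      + 3 * (L ^+ 2 * sqnorm (row i (perp Z)))).
  rewrite /prox_grad_map; set u := prox _ _.
  have -> : al^-1 *: (row i Z - u) = al^-1 *: row i (Z - X') + al^-1 *: (row i X' - u).
    by rewrite -scalerDr (linearB (row i)) subrKA.
  apply: le_trans (sqnormD_le _ _) _; rewrite sqnormZ lerD2l ler_wpM2l//.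
  have h1 : sqnorm (al^-1 *: (row i X' - u)) <= sqnorm (row i Y - grad f (row i Z)).
    rewrite sqnormZ exprVn ler_pdivrMl ?exprn_gt0// -sqnormZ.
    rewrite stepX /u; apply: le_trans (nexp _ _) _.
    have -> : row i Z - al *: row i Y - (row i Z - al *: grad f (row i Z)) =
        - (al *: (row i Y - grad f (row i Z))).
      by rewrite opprB scalerBr opprB [RHS]addrC addrCA addrAC subrr add0r addrC.
    by rewrite sqnormN.
  apply: le_trans h1 _.
  have -> : row i Y - grad f (row i Z) = (row i (perp Y)
      + (avgrow Y - grad f (avgrow X))) + (grad f (avgrow X) - grad f (row i Z)).
    by rewrite row_perp !subrKA.
  apply: le_trans (sqnormD3 _ _ _) _.
  apply: lerD; first exact: lexx.
  apply: ler_wpM2l => //; apply: le_trans (grad_smooth_obj_lip _ _) _.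
  by rewrite row_perp avgZ sqnormBC.
have nsum : N%:R^-1 * \sum_i sqnorm (prox_grad_map r (row i Z) (grad f (row i Z)) al)
   <= 2 * (al^-1 ^+ 2 * (N%:R^-1 * sqnorm (Z - X'))) +
      2 * (3 * y + 3 * (2 * (L ^+ 2 * x) + 2 * e) + 3 * (L ^+ 2 * sz)).
  rewrite ler_pdivrMl//; apply: le_trans (ler_sum _ (fun i _ => nz i)) _.
  have -> : N%:R * (2 * (al^-1 ^+ 2 * (N%:R^-1 * sqnorm (Z - X'))) +
      2 * (3 * y + 3 * (2 * (L ^+ 2 * x) + 2 * e) + 3 * (L ^+ 2 * sz))) =
    2 * (al^-1 ^+ 2 * sqnorm (Z - X')) +
      2 * (3 * sqnorm (perp Y) + 3 * (N%:R * (2 * (L ^+ 2 * x) + 2 * e))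
           + 3 * (L ^+ 2 * sqnorm (perp Z))).
    rewrite /y /sz; move: (sqnorm (Z - X')) (sqnorm (perp Y)) (sqnorm (perp Z)) (al^-1)
      (2 * (L ^+ 2 * x) + 2 * e) => *.
    by field; rewrite gt_eqF.
  rewrite big_split/= -!mulr_sumr !big_split/= -!mulr_sumr -!sqnorm_rows.
  rewrite sumr_const card_ord -[_ *+ N]mulr_natl.
  rewrite lerD2l ler_wpM2l// lerD2r lerD2l ler_wpM2l//.
  by rewrite ler_wpM2l// ltW.
have dzx : N%:R^-1 * sqnorm (Z - X') <= De + 2 * sz + 2 * x'.
  have dE : sqnorm (avgrow Z - avgrow X') = De by rewrite avgZ sqnormBC.
  have h := sqnorm_increment N0 X' Z; rewrite dE in h.
  rewrite ler_pdivrMl//; apply: le_trans h _.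
  rewrite /sz /x'; have Nn : N%:R != 0 :> R by rewrite gt_eqF.
  have -> : N%:R * (De + 2 * (N%:R^-1 * sqnorm (perp Z)) + 2 * (N%:R^-1 * sqnorm (perp X')))
    = N%:R * De + 2 * sqnorm (perp Z) + 2 * sqnorm (perp X').
    by clearbody De; move: (sqnorm _) (sqnorm _) => *; field.
  exact: lexx.
have x0 : 0 <= x by rewrite mulr_ge0// sqnorm_ge0.
have y0 : 0 <= y by rewrite mulr_ge0// sqnorm_ge0.
have sz0 : 0 <= sz by rewrite mulr_ge0// sqnorm_ge0.
have De0 : 0 <= De by exact: sqnorm_ge0.
have e0 : 0 <= e.
  by rewrite mulr_ge0// sumr_ge0// => i _; exact: sqnorm_ge0.
rewrite /stationarity -mulrA -/sz.
move: nsum dzx szx x'le; move: (N%:R^-1 * \sum_i _) (N%:R^-1 * sqnorm (Z - X')).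
move=> s t; clearbody sz x' x y De e.
exact: (stationarity_arith al0 q0 q1 L0 alL).
Qed.

End ProxStep.

(** * Summation of the Lyapunov inequality *)

Section LyapunovStep.
Context (R : realType).
Variables (q L hs2 a a' b x x' y y' e e' De S d : R).
Hypothesis q0 : 0 < q.
Hypothesis q1 : q <= 1.
Hypothesis L0 : 0 < L.
Hypothesis hs0 : 0 <= hs2.
Hypothesis a'0 : 0 < a'.
Hypothesis a'a : a' <= a.
Hypothesis aL : (a * L) ^+ 2 <= q ^+ 4 / 4096.
Hypothesis aa' : a <= a' * (1 + q ^+ 6 / 6).
Hypothesis bE : b = 1 - a' / a + 48 * L ^+ 2 * a' ^+ 2.
Hypotheses (x0 : 0 <= x) (y0 : 0 <= y) (e0 : 0 <= e) (S0 : 0 <= S).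
Hypotheses (x'0 : 0 <= x') (y'0 : 0 <= y').
Hypothesis stepx : x' <= (1 - q) * x + q^-1 * (a ^+ 2 * y).
Hypothesis stepy : y' <= (1 - q) * y + q^-1 * d.
Hypothesis stepd : d <= 4 * (L ^+ 2 * S + b ^+ 2 * hs2 + b ^+ 2 * e).
Hypothesis stepe :
  e' <= (1 - b) ^+ 2 * e + 2 * (1 - b) ^+ 2 * (L ^+ 2 * S) + 2 * b ^+ 2 * hs2.
Hypothesis stepS : S <= De + 2 * x' + 2 * x.

Let a0 : 0 < a. Proof. exact: lt_le_trans a'a. Qed.
Let A := a^-1.
Let A' := a'^-1.
Let iq := q^-1.
Let iL := (L ^+ 2)^-1.
Let A0 : 0 < A. Proof. by rewrite invr_gt0. Qed.
Let A'0 : 0 < A'. Proof. by rewrite invr_gt0. Qed.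
Let iq0 : 0 < iq. Proof. by rewrite invr_gt0. Qed.
Let L20 : 0 < L ^+ 2. Proof. by rewrite exprn_gt0. Qed.
Let iL0 : 0 < iL. Proof. by rewrite invr_gt0. Qed.
Let aA : a * A = 1. Proof. by rewrite mulfV// gt_eqF. Qed.
Let a'A' : a' * A' = 1. Proof. by rewrite mulfV// gt_eqF. Qed.
Let qiq : q * iq = 1. Proof. by rewrite mulfV// gt_eqF. Qed.
Let LiL : L ^+ 2 * iL = 1. Proof. by rewrite mulfV// gt_eqF. Qed.

Let qn n : 0 < q ^+ n. Proof. by rewrite exprn_gt0. Qed.
Let qn1 n : q ^+ n <= 1. Proof. by rewrite exprn_ile1// ltW. Qed.

Let t0 : 0 <= q ^+ 6 / 6. Proof. by have := qn 6; lra. Qed.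

Let A'le : A' <= A * (1 + q ^+ 6 / 6).
Proof.
have h := ler_wpM2l (ltW (mulr_gt0 A0 A'0)) aa'.
move: h; rewrite (mulrC A A') -[X in X <= _]mulrA (mulrC A a) aA mulr1.
by rewrite (mulrC A' A) -mulrA (mulrA A' a') (mulrC A' a') a'A' mul1r.
Qed.

Let AA' : A <= A'.
Proof. by rewrite lef_pV2 ?posrE. Qed.

Let a'lb : 6 / 7 * a <= a'.
Proof.
have h : a <= a' * (7 / 6).
  by apply: le_trans aa' _; rewrite ler_pM2l//; have := qn1 6; lra.
by move: h; move: (a) (a') => *; lra.
Qed.

(** 1 - a' / a is at most q^6 / 6 by slow decrease, and 48 (a' L)^2 at most 48 q^4 / 4096. *)
Let bq : b <= q ^+ 4 * (1 / 6 + 48 / 4096).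
Proof.
have h1 : (1 - a' / a) <= q ^+ 6 / 6.
  have h := ler_wpM2l (ltW A0) aa'; rewrite mulrC aA in h.
  have h2 : A * (a' * (1 + q ^+ 6 / 6)) <= A * a' + q ^+ 6 / 6.
    have Aa' : A * a' <= 1 by rewrite -aA mulrC ler_wpM2r// ltW.
    rewrite mulrA mulrDr mulr1 lerD2l; exact: ler_piMl.
  by rewrite mulrC; move: h h2; rewrite -/A; move: (A * a') (A * _) => *; lra.
have h2 : 48 * L ^+ 2 * a' ^+ 2 <= 48 * (q ^+ 4 / 4096).
  rewrite -mulrA ler_wpM2l// mulrC -exprMn; apply: le_trans aL.
  by rewrite ler_pXn2r// ?nnegrE ?mulr_ge0 ?ler_wpM2r// ltW.
have h3 : q ^+ 6 <= q ^+ 4 by rewrite ler_wiXn2l// ltW.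
rewrite bE; move: h1 h2 h3; move: (a' / a) (q ^+ 6) (q ^+ 4) (48 * L ^+ 2 * _) => *; lra.
Qed.

Let b0 : 0 <= b.
Proof.
rewrite bE addr_ge0//; last by rewrite mulr_ge0 ?sqr_ge0// mulr_ge0 ?sqr_ge0.
by rewrite subr_ge0 ler_pdivrMr// mul1r.
Qed.

Let b1 : b <= 1.
Proof. by apply: le_trans bq _; have := qn1 4; have := qn 4; move: (q ^+ 4) => *; lra. Qed.

Let b2q : b ^+ 2 <= q ^+ 4 / 30.
Proof.
have h : b ^+ 2 <= (q ^+ 4 * (1 / 6 + 48 / 4096)) ^+ 2.
  have c0 : 0 <= q ^+ 4 * (1 / 6 + 48 / 4096) by apply: mulr_ge0; [exact: ltW (qn 4)|lra].
  by rewrite ler_pXn2r ?nnegrE.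
apply: le_trans h _; rewrite exprMn expr2 -mulrA ler_wpM2l ?(ltW (qn 4))//.
have := qn1 4; have := qn 4; move: (q ^+ 4) => z *.
apply: (@le_trans _ _ (1 * (1 / 6 + 48 / 4096) ^+ 2)); last lra.
by lra.
Qed.

(** Reason for the form of beta: 1 - a' / a offsets the growth of 1 / a, and 48 is 8 times the
    wanted loss 6. *)
Let bA : (1 - b) * A' = A - 48 * L ^+ 2 * a'.
Proof. by rewrite bE /A /A'; field; rewrite !gt_eqF. Qed.

Let bA2 : (1 - b) ^+ 2 * A' <= A - 48 * L ^+ 2 * a'.
Proof.
rewrite -bA expr2 -mulrA ler_piMl// ?mulr_ge0 ?subr_ge0 ?(ltW A'0)//.
by rewrite gerBl.
Qed.

Let bA3 : (1 - b) ^+ 2 * A' <= A.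
Proof. by apply: le_trans bA2 _; rewrite gerBl mulr_ge0 ?(ltW a'0)// mulr_ge0 ?sqr_ge0. Qed.

(** Contraction releases 3 x / a, of which the growth of 1 / a takes at most 1 / 2; the inflow from
    y is at most 3 + q / 2 <= 7 / 2 times a y / q^2. *)
Let T1 : 3 * A' * iq * x' <=
  3 * A * iq * x - 5 / 2 * (A * x) + 7 / 2 * (a * iq ^+ 2 * y).
Proof.
have A'q : A' <= A * (1 + q / 6).
  apply: le_trans A'le _; rewrite ler_pM2l// lerD2l ler_wpM2r//.
  by rewrite -[leRHS]expr1 ler_wiXn2l// ltW.
apply: (@le_trans _ _ (3 * (A * (1 + q / 6)) * iq *
    ((1 - q) * x + q^-1 * (a ^+ 2 * y)))).
  apply: ler_pM => //; first by rewrite !mulr_ge0 ?ltW.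
  by rewrite ler_wpM2r ?(ltW iq0)// ler_wpM2l.
rewrite -/iq.
have -> : 3 * (A * (1 + q / 6)) * iq * ((1 - q) * x + iq * (a ^+ 2 * y)) =
  3 * A * iq * x - 5 / 2 * ((q * iq) * (A * x)) - 2^-1 * ((q * iq) * (A * (q * x)))
  + 3 * ((a * A) * (a * iq ^+ 2 * y)) + 2^-1 * ((a * A) * (q * (a * iq ^+ 2 * y))).
  by move: A iq a q x y => *; field.
rewrite qiq aA !mul1r.
have h1 : 0 <= A * (q * x) by rewrite !mulr_ge0// ltW.
have h2 : q * (a * iq ^+ 2 * y) <= 1 * (a * iq ^+ 2 * y).
  by rewrite ler_wpM2r// !mulr_ge0 ?sqr_ge0// ltW.
move: h1 h2; move: (3 * A * iq * x) (A * x) (A * (q * x)) (a * iq ^+ 2 * y) (q * (_ * y)).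
by move=> *; lra.
Qed.

(** (a L)^2 <= q^4 / 4096 turns 24 a L^2 S / q^4 into 24 / 4096 times S / a, and b^2 <= q^4 / 30
    bounds the inflow from e. *)
Let T2 : 6 * a' * iq ^+ 3 * y' <= 6 * a * iq ^+ 3 * y - 6 * (a * iq ^+ 2 * y)
  + 24 / 4096 * (A * S) + 24 / 4096 * (A * iL * (b ^+ 2 * hs2)) + 24 / 30 * (a * e).
Proof.
have iq3 : 0 <= iq ^+ 3 by rewrite exprn_ge0// ltW.
have iq4 : 0 <= iq ^+ 4 by rewrite exprn_ge0// ltW.
have q4 : q ^+ 4 * iq ^+ 4 = 1 by rewrite -exprMn qiq expr1n.
apply: (@le_trans _ _ (6 * a * iq ^+ 3 * ((1 - q) * y + q^-1 * d))).
  apply: ler_pM => //; first by do 2!rewrite mulr_ge0 ?(ltW a'0)//.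
  by rewrite ler_wpM2r// ler_wpM2l.
apply: (@le_trans _ _ (6 * a * iq ^+ 3 *
    ((1 - q) * y + q^-1 * (4 * (L ^+ 2 * S + b ^+ 2 * hs2 + b ^+ 2 * e))))).
  apply: ler_wpM2l; first by rewrite mulr_ge0// mulr_ge0// ltW.
  by rewrite lerD2l; apply: ler_wpM2l => //; exact: ltW.
rewrite -/iq.
have -> : 6 * a * iq ^+ 3 *
    ((1 - q) * y + iq * (4 * (L ^+ 2 * S + b ^+ 2 * hs2 + b ^+ 2 * e))) =
  6 * a * iq ^+ 3 * y - 6 * ((q * iq) * (a * iq ^+ 2 * y))
  + 24 * (a * L ^+ 2 * iq ^+ 4 * S) + 24 * (a * iq ^+ 4 * (b ^+ 2 * hs2))
  + 24 * (iq ^+ 4 * b ^+ 2 * (a * e)).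
  by move: iq a q y L S b hs2 e => *; ring.
rewrite qiq mul1r.
have k1 : (a * L) ^+ 2 * iq ^+ 4 <= 1 / 4096.
  by have := ler_wpM2r iq4 aL; rewrite [X in _ <= X]mulrAC q4.
have k2 : a * L ^+ 2 * iq ^+ 4 <= 1 / 4096 * A.
  have -> : a * L ^+ 2 * iq ^+ 4 = ((a * L) ^+ 2 * iq ^+ 4) * A.
    transitivity (a * L ^+ 2 * iq ^+ 4 * (a * A)); first by rewrite aA mulr1.
    by move: iq a L A => *; ring.
  by rewrite ler_wpM2r// ltW.
have k3 : a * iq ^+ 4 <= 1 / 4096 * (A * iL).
  have -> : a * iq ^+ 4 = (a * L ^+ 2 * iq ^+ 4) * iL.
    transitivity (a * iq ^+ 4 * (L ^+ 2 * iL)); first by rewrite LiL mulr1.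
    by move: iq a L iL => *; ring.
  by rewrite mulrA ler_wpM2r// ltW.
have k4 : iq ^+ 4 * b ^+ 2 <= 1 / 30.
  by have := ler_wpM2l iq4 b2q; rewrite [X in _ <= X]mulrA (mulrC _ (q ^+ 4)) q4.
have m2 := ler_wpM2r S0 k2.
have m3 := ler_wpM2r (mulr_ge0 (sqr_ge0 b) hs0) k3.
have m4 := ler_wpM2r (mulr_ge0 (ltW a0) e0) k4.
move: m2 m3 m4; rewrite -[1 / 4096 * A * S]mulrA -[1 / 4096 * (A * iL) * _]mulrA.
move: (6 * a * iq ^+ 3 * y) (a * iq ^+ 2 * y) (A * S) (A * iL * _) (a * e)
  (a * L ^+ 2 * iq ^+ 4 * S) (a * iq ^+ 4 * _).
move: (iq ^+ 4 * b ^+ 2) => z z1 z2 z3 z4 z5 z6 z7.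
move: (z * z5) => z8.
by move=> *; lra.
Qed.

(** The loss 6 a' is at least 36 a / 7, since a' >= 6 a / 7. *)
Let T3 : 8^-1 * (A' * iL * e') <= 8^-1 * (A * iL * e) - 36 / 7 * (a * e)
  + 4^-1 * (A * S) + 4^-1 * (A' * iL * (b ^+ 2 * hs2)).
Proof.
have AiL : 0 <= A' * iL by rewrite mulr_ge0// ltW.
have h := ler_wpM2l AiL stepe.
have E : A' * iL * ((1 - b) ^+ 2 * e + 2 * (1 - b) ^+ 2 * (L ^+ 2 * S) + 2 * b ^+ 2 * hs2)
  = (1 - b) ^+ 2 * A' * (iL * e) + 2 * ((L ^+ 2 * iL) * ((1 - b) ^+ 2 * A' * S))
    + 2 * (A' * iL * (b ^+ 2 * hs2)).
  by move: A' iL L b e S hs2 => *; ring.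
rewrite E LiL mul1r in h.
have m1 := ler_wpM2r (mulr_ge0 (ltW iL0) e0) bA2.
have E2 : (A - 48 * L ^+ 2 * a') * (iL * e) = A * iL * e - 48 * ((L ^+ 2 * iL) * (a' * e)).
  by move: A iL L a' e => *; ring.
rewrite E2 LiL mul1r in m1.
have m2 := ler_wpM2r S0 bA3.
have m3 := ler_wpM2r e0 a'lb; rewrite -[6 / 7 * a * e]mulrA in m3.
move: h m1 m2 m3; move: (A' * iL * e') (A * iL * e) (a * e) (A * S) (A' * iL * _)
  ((1 - b) ^+ 2 * A' * (iL * e)) ((1 - b) ^+ 2 * A' * S) (a' * e).
by move=> *; lra.
Qed.

Let TS : A * S <= A * De + 4 * (A * x) + 2 * (a * iq ^+ 2 * y).
Proof.
have h1 := ler_wpM2l (ltW A0) stepS.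
have h2 := ler_wpM2l (ltW A0) stepx; rewrite -/iq in h2.
have E : A * ((1 - q) * x + iq * (a ^+ 2 * y)) = A * x - q * (A * x)
    + (a * A) * (q * iq) * (a * iq * y) + (a * A) * (1 - q * iq) * (a * iq * y).
  by move: A q x iq a y => *; ring.
rewrite E aA qiq subrr mulr0 mul0r addr0 !mul1r in h2.
have h3 : 0 <= q * (A * x) by rewrite !mulr_ge0// ltW.
have h4 : a * iq * y <= a * iq ^+ 2 * y.
  rewrite ler_wpM2r// ler_wpM2l ?(ltW a0)// expr2 ler_peMl ?(ltW iq0)//.
  by rewrite /iq invf_ge1.
rewrite !mulrDr in h1; move: h1 h2 h3 h4; rewrite !(mulrCA A 2).
move: (A * S) (A * De) (A * x) (A * x') (q * _) (a * iq * y) (a * iq ^+ 2 * y).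
by move=> *; lra.
Qed.

(** Add [T1], [T2], [T3] and insert [TS] with the total weight 1 / 4 + 24 / 4096 < 256 / 1000 of S /
    a. There remain 5 / 2 - 4 * 0.256 for x, 6 - 7 / 2 - 2 * 0.256 for y and 36 / 7 - 24 / 30 for
    e. *)
Lemma lyapunov_step :
  3 * A' * iq * x' + 6 * a' * iq ^+ 3 * y' + 8^-1 * (A' * iL * e')
  + (147 / 100 * (A * x) + 198 / 100 * (a * iq ^+ 2 * y) + 43 / 10 * (a * e)) <=
  3 * A * iq * x + 6 * a * iq ^+ 3 * y + 8^-1 * (A * iL * e)
  + (256 / 1000 * (A * De) + 26 / 100 * (A' * iL * (b ^+ 2 * hs2))).
Proof.
have n1 : A * iL * (b ^+ 2 * hs2) <= A' * iL * (b ^+ 2 * hs2).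
  apply: ler_wpM2r; first by rewrite mulr_ge0 ?sqr_ge0.
  by apply: ler_wpM2r => //; exact: ltW.
have n0 : 0 <= A * iL * (b ^+ 2 * hs2) by rewrite !mulr_ge0 ?sqr_ge0// ltW.
have p1 : 0 <= A * x by rewrite mulr_ge0// ltW.
have p2 : 0 <= a * iq ^+ 2 * y by rewrite !mulr_ge0 ?sqr_ge0// ltW.
have p3 : 0 <= a * e by rewrite mulr_ge0// ltW.
have p4 : 0 <= A * S by rewrite mulr_ge0// ltW.
move: n0 n1 p1 p2 p3 p4 T1 T2 T3 TS.
move: (3 * A' * iq * x') (6 * a' * iq ^+ 3 * y') (A' * iL * e') (A * x)
  (a * iq ^+ 2 * y) (a * e) (A * De) (A' * iL * _) (A * iL * _)
  (3 * A * iq * x) (6 * a * iq ^+ 3 * y) (A * iL * e) (A * S).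
by move=> *; lra.
Qed.

End LyapunovStep.

Section LyapunovSum.
Context (R : realType).
Variables (K : nat) (q L hs2 Phi : R) (al b x y e De S d : nat -> R).
Hypothesis q0 : 0 < q.
Hypothesis q1 : q <= 1.
Hypothesis L0 : 0 < L.
Hypothesis hs0 : 0 <= hs2.
Hypothesis al0 : forall k, 0 < al k.
Hypothesis al_dec : forall k, al k.+1 <= al k.
Hypothesis alL : forall k, (al k * L) ^+ 2 <= q ^+ 4 / 4096.
Hypothesis al_slow : forall k, al k <= al k.+1 * (1 + q ^+ 6 / 6).
Hypothesis bE : forall k, b k = 1 - al k.+1 / al k + 48 * L ^+ 2 * al k.+1 ^+ 2.
Hypotheses (x0 : forall k, 0 <= x k) (y0 : forall k, 0 <= y k)
  (e0 : forall k, 0 <= e k) (S0 : forall k, 0 <= S k) (De0 : forall k, 0 <= De k).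
Hypothesis stepx : forall k, (k < K)%N ->
  x k.+1 <= (1 - q) * x k + q^-1 * (al k ^+ 2 * y k).
Hypothesis stepy : forall k, (k < K)%N -> y k.+1 <= (1 - q) * y k + q^-1 * d k.
Hypothesis stepd : forall k, (k < K)%N ->
  d k <= 4 * (L ^+ 2 * S k + b k ^+ 2 * hs2 + b k ^+ 2 * e k).
Hypothesis stepe : forall k, (k < K)%N ->
  e k.+1 <= (1 - b k) ^+ 2 * e k + 2 * (1 - b k) ^+ 2 * (L ^+ 2 * S k)
            + 2 * b k ^+ 2 * hs2.
Hypothesis stepS : forall k, (k < K)%N -> S k <= De k + 2 * x k.+1 + 2 * x k.
Hypothesis descent_sum :
  \sum_(k < K) (3 / 4 * (al k)^-1 - L / 2) * De k <= Phi +
  \sum_(k < K) (2^-1 * ((al k)^-1 * x k) + 2^-1 * (al k * y k)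
     + 2 * (al k * L ^+ 2 * x k) + 2 * (al k * e k)).

Let A k := (al k)^-1.
Let iq := q^-1.
Let iL := (L ^+ 2)^-1.
Let U k := 3 * A k * iq * x k + 6 * al k * iq ^+ 3 * y k + 8^-1 * (A k * iL * e k).
Let diss k := 147 / 100 * (A k * x k) + 198 / 100 * (al k * iq ^+ 2 * y k)
  + 43 / 10 * (al k * e k).
Let noise k := A k.+1 * iL * (b k ^+ 2 * hs2).

Let A0 k : 0 < A k. Proof. by rewrite invr_gt0. Qed.

Let tele n : (n <= K)%N -> U n + \sum_(k < n) diss k <=
  U 0%N + \sum_(k < n) (256 / 1000 * (A k * De k) + 26 / 100 * noise k).
Proof.
elim: n => [_|n IH nK]; first by rewrite !big_ord0.
have h := IH (ltnW nK); rewrite !big_ord_recr /=.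
have := lyapunov_step q0 q1 L0 hs0 (al0 n.+1) (al_dec n) (alL n) (al_slow n) (bE n)
  (x0 n) (y0 n) (e0 n) (S0 n) (x0 n.+1) (y0 n.+1) (stepx nK) (stepy nK)
  (stepd nK) (stepe nK) (stepS nK).
move: h; rewrite -/iq -/iL -/(A n) -/(A n.+1) -/(U n) -/(U n.+1) -/(noise n) -/(diss n).
move: (U n) (U n.+1) (U 0%N) (\sum_(i < n) _) (\sum_(i < n) _) (diss n)
  (256 / 1000 * _) (26 / 100 * _).
by move=> *; lra.
Qed.

Let U0 k : 0 <= U k.
Proof.
have iq0 : 0 < iq by rewrite invr_gt0.
have iL0 : 0 < iL by rewrite invr_gt0 exprn_gt0.
apply: addr_ge0; first apply: addr_ge0.
- by rewrite mulr_ge0// mulr_ge0 ?(ltW iq0)// mulr_ge0// ltW.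
- rewrite mulr_ge0// mulr_ge0 ?exprn_ge0 ?(ltW iq0)// mulr_ge0// ltW//.
- by rewrite mulr_ge0// mulr_ge0// mulr_ge0// ltW.
Qed.

Let alL1 k : al k * L <= 64^-1.
Proof.
have q4 : q ^+ 4 <= 1 by rewrite exprn_ile1// ltW.
have h : (al k * L) ^+ 2 <= (64^-1) ^+ 2 by apply: le_trans (alL k) _; lra.
by move: h; rewrite ler_pXn2r// nnegrE ?invr_ge0// mulr_ge0 ?ltW.
Qed.

(** [De] decides the constant: of the 3 / 4 in the descent inequality, L / 2 takes at most 1 / 128
    and the Lyapunov step 256 / 1000, leaving more than 48 / 100. *)
Lemma lyapunov_sum :
  48 / 100 * \sum_(k < K) (A k * x k + al k / q ^+ 2 * y k + al k * e k + A k * De k)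
  <= U 0%N + Phi + 26 / 100 * \sum_(k < K) noise k.
Proof.
have h := tele (leqnn K); have uK := U0 K.
have pt (k : 'I_K) : 48 / 100 * (A k * x k + al k / q ^+ 2 * y k + al k * e k + A k * De k)
  <= diss k - 256 / 1000 * (A k * De k) + (3 / 4 * (al k)^-1 - L / 2) * De k
    - (2^-1 * ((al k)^-1 * x k) + 2^-1 * (al k * y k)
     + 2 * (al k * L ^+ 2 * x k) + 2 * (al k * e k)).
  rewrite /diss -/(A k) -exprVn -/iq.
  have aA : al k * A k = 1 by rewrite mulfV// gt_eqF.
  have LA : L * De k <= 64^-1 * (A k * De k).
    rewrite mulrA ler_wpM2r//.
    have := ler_wpM2r (ltW (A0 k)) (alL1 k); rewrite mulrAC aA mul1r; exact.
  have Lx : al k * L ^+ 2 * x k <= 64^-1 * (A k * x k).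
    rewrite mulrA ler_wpM2r//.
    have -> : al k * L ^+ 2 = (al k * L) * (al k * L) * A k.
      by rewrite -[LHS]mulr1 -aA; move: (al k) (A k) => *; ring.
    rewrite ler_wpM2r ?(ltW (A0 k))//; apply: le_trans (alL1 k).
    have aL0 : 0 <= al k * L by rewrite mulr_ge0 ?ltW.
    apply: ler_piMl => //; apply: le_trans (alL1 k) _; lra.
  have yy : al k * y k <= al k * iq ^+ 2 * y k.
    rewrite ler_wpM2r//; apply: ler_peMr; first exact: ltW.
    by rewrite exprn_ege1// invf_ge1.
  have ay0 : 0 <= al k * y k by rewrite mulr_ge0// ltW.
  have ax0 : 0 <= A k * x k by rewrite mulr_ge0// ltW.
  have ae0 : 0 <= al k * e k by rewrite mulr_ge0// ltW.
  have ad0 : 0 <= A k * De k by rewrite mulr_ge0// ltW.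
  rewrite [(_ - _) * De k]mulrBl -[3 / 4 * _ * De k]mulrA -[L / 2 * De k]mulrA (mulrCA L).
  move: LA Lx yy ay0 ax0 ae0 ad0.
  move: (L * De k) (A k * De k) (al k * L ^+ 2 * x k) (A k * x k) (al k * y k)
    (al k * iq ^+ 2 * y k) (al k * e k).
  by move=> *; lra.
have := ler_sum (index_enum 'I_K) (fun k (_ : xpredT k) => pt k).
rewrite -mulr_sumr.
have -> : \sum_(k < K) (diss k - 256 / 1000 * (A k * De k) + (3 / 4 * (al k)^-1 - L / 2) * De k
    - (2^-1 * ((al k)^-1 * x k) + 2^-1 * (al k * y k)
     + 2 * (al k * L ^+ 2 * x k) + 2 * (al k * e k))) =
  \sum_(k < K) diss k - \sum_(k < K) 256 / 1000 * (A k * De k)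
  + \sum_(k < K) (3 / 4 * (al k)^-1 - L / 2) * De k
  - \sum_(k < K) (2^-1 * ((al k)^-1 * x k) + 2^-1 * (al k * y k)
     + 2 * (al k * L ^+ 2 * x k) + 2 * (al k * e k)).
  by rewrite sumrB big_split/= sumrB.
have hs : \sum_(k < K) (256 / 1000 * (A k * De k) + 26 / 100 * noise k) =
    \sum_(k < K) 256 / 1000 * (A k * De k) + 26 / 100 * \sum_(k < K) noise k.
  by rewrite big_split/= mulr_sumr.
rewrite hs in h; move: h descent_sum uK.
move: (U 0%N) (U K) (\sum_(i < K) diss i) (\sum_(i < K) noise i)
  (\sum_(i < K) 256 / 1000 * _) (\sum_(i < K) (3 / 4 * _ - _) * _)
  (\sum_(i < K) (2^-1 * _ + _ + _ + _)) (48 / 100 * _).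
by move=> *; lra.
Qed.

End LyapunovSum.

(** * Step sizes *)

Section StepSize.
Context (R : realType).
Local Notation cb n := (n%:R `^ 3^-1 : R).

Lemma cbrt_cube (n : nat) : cb n ^+ 3 = n%:R.
Proof.
by rewrite -powR_mulrn ?powR_ge0// -powRrM mulVf ?powRr1.
Qed.

Lemma cbrt_ge0 (n : nat) : 0 <= cb n. Proof. exact: powR_ge0. Qed.

Lemma cbrt_gt0 (n : nat) : (0 < n)%N -> 0 < cb n.
Proof. by move=> n0; rewrite powR_gt0// ltr0n. Qed.

Lemma cube_le (a b : R) : 0 <= a -> 0 <= b -> a ^+ 3 <= b ^+ 3 -> a <= b.
Proof. by move=> a0 b0; rewrite ler_pXn2r ?nnegrE. Qed.

Lemma cbrt_le (m n : nat) : (m <= n)%N -> cb m <= cb n.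
Proof.
by move=> mn; apply: cube_le; rewrite ?cbrt_ge0// !cbrt_cube ler_nat.
Qed.

Variables (L q : R) (k0 : nat).
Hypothesis L1 : 1 <= L.
Hypothesis q0 : 0 < q.
Hypothesis q1 : q <= 1.
Hypothesis k0q : 2 / q ^+ 6 <= k0%:R.
Local Notation al := (alpha_of L k0).
Local Notation be := (beta_of L k0).

Let L0 : 0 < L. Proof. exact: lt_le_trans L1. Qed.

Lemma k0_ge2 : (2 <= k0)%N.
Proof.
rewrite -(ler_nat R); apply: le_trans k0q.
have q6 : q ^+ 6 <= 1 by rewrite exprn_ile1// ltW.
by rewrite ler_pdivlMr ?exprn_gt0// ler_piMr.
Qed.

Let n0 k : (0 < k + k0)%N.
Proof. by rewrite addn_gt0 (leq_trans _ k0_ge2) ?orbT. Qed.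

Let nq k : 2 / q ^+ 6 <= (k + k0)%:R.
Proof. by apply: le_trans k0q _; rewrite ler_nat leq_addl. Qed.

Let c0 k : 0 < cb (k + k0). Proof. exact: cbrt_gt0. Qed.

Lemma alphaE k : al k = (64 * L * cb (k + k0))^-1.
Proof. by rewrite /alpha_of -invfM. Qed.

Lemma alpha_gt0 k : 0 < al k.
Proof. by rewrite alphaE invr_gt0 mulr_gt0// mulr_gt0. Qed.

Lemma alpha_noninc k : al k.+1 <= al k.
Proof.
rewrite !alphaE lef_pV2 ?posrE ?mulr_gt0// ler_pM2l ?mulr_gt0//.
by apply: cbrt_le; rewrite leq_add2r.
Qed.

Lemma alpha_le0 k : al k <= al 0%N.
Proof. by elim: k => // k IH; apply: le_trans (alpha_noninc k) IH. Qed.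

Let cq k : 1 <= q ^+ 2 * cb (k + k0).
Proof.
apply: cube_le => //; first by rewrite mulr_ge0 ?sqr_ge0// ltW.
rewrite expr1n exprMn cbrt_cube -exprM.
have := nq k; rewrite ler_pdivrMr ?exprn_gt0// mulrC; lra.
Qed.

Let alLE k : al k * L = (64 * cb (k + k0))^-1.
Proof. by rewrite alphaE; field; rewrite !gt_eqF. Qed.

(** k0 >= 2 / q^6 gives q^2 (k + k0)^(1/3) >= 1, and al L is 1 / 64 of the inverse cube root. *)
Lemma alpha_L k : (al k * L) ^+ 2 <= q ^+ 4 / 4096.
Proof.
rewrite alLE exprVn exprMn invfM mulrC.
have -> : (64 ^+ 2 : R) = 4096 by ring.
have h : (cb (k + k0) ^+ 2)^-1 <= q ^+ 4.
  rewrite -exprVn (_ : q ^+ 4 = (q ^+ 2) ^+ 2); last by rewrite -exprM.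
  rewrite ler_pXn2r ?nnegrE ?invr_ge0 ?sqr_ge0 ?(ltW (c0 k))//.
  by rewrite -[X in X <= _]mul1r ler_pdivrMr.
by move: h; move: (_ ^-1) (q ^+ 4) => u v ?; lra.
Qed.

(** After cubing: 1 + 1 / (k + k0) <= 1 + q^6 / 2 <= (1 + q^6 / 6)^3. *)
Lemma alpha_slow k : al k <= al k.+1 * (1 + q ^+ 6 / 6).
Proof.
have q6 : 0 < q ^+ 6 by rewrite exprn_gt0.
rewrite !alphaE [X in _ <= X]mulrC ler_pdivlMr ?mulr_gt0// mulrC ler_pdivrMr ?mulr_gt0//.
rewrite (mulrCA (1 + _)) ler_pM2l ?mulr_gt0//.
apply: cube_le; rewrite ?(ltW (c0 _))// ?mulr_ge0 ?(ltW (c0 _))//; first lra.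
rewrite exprMn !cbrt_cube addSn -natr1.
have := nq k; rewrite ler_pdivrMr// => h.
have n1 : 0 <= (k + k0)%:R :> R by [].
have h2 : 1 + q ^+ 6 / 2 <= (1 + q ^+ 6 / 6) ^+ 3.
  move: q6; move: (q ^+ 6) => z z0; rewrite !exprS expr0 mulr1.
  nra.
apply: (@le_trans _ _ ((1 + q ^+ 6 / 2) * (k + k0)%:R)); last by rewrite ler_wpM2r.
move: h; move: (q ^+ 6) (k + k0)%:R => u v; lra.
Qed.

Let c1 k : 1 <= cb (k + k0).
Proof.
apply: cube_le; rewrite ?(ltW (c0 _))// expr1n cbrt_cube ler1n; exact: n0.
Qed.

Let c'c k : cb (k.+1 + k0) <= 2 * cb (k + k0).
Proof.
apply: cube_le; rewrite ?mulr_ge0 ?(ltW (c0 _))//.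
rewrite exprMn !cbrt_cube -natrX -natrM ler_nat.
by rewrite addSn; exact: ltn_Pmull (n0 k).
Qed.

(** For consecutive cube roots c'^3 - c^3 = 1, so c' - c <= 1 / (3 c^2); the other summand of beta
    is 48 / 4096 times 1 / c'^2. *)
Lemma beta_le k : 0 <= be k <= (cb (k + k0) ^+ 2)^-1.
Proof.
have cc : cb (k + k0) <= cb (k.+1 + k0) by apply: cbrt_le; rewrite leq_add2r.
have c3 : cb (k.+1 + k0) ^+ 3 = cb (k + k0) ^+ 3 + 1.
  by rewrite !cbrt_cube addSn natr1.
have r : al k.+1 / al k = cb (k + k0) / cb (k.+1 + k0).
  by rewrite !alphaE; field; rewrite !gt_eqF.
have s : 48 * L ^+ 2 * al k.+1 ^+ 2 = 48 / 4096 * (cb (k.+1 + k0) ^+ 2)^-1.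
  by rewrite alphaE; field; rewrite !gt_eqF.
rewrite /beta_of r s; move: cc c3 (c1 k) (c1 k.+1).
move: (cb (k + k0)) (cb (k.+1 + k0)) => c c' cc c3 h1 h2.
have cp : 0 < c by exact: lt_le_trans h1.
have c'p : 0 < c' by exact: lt_le_trans h2.
have c2 : 0 < c ^+ 2 by rewrite exprn_gt0.
have c'2 : 0 < c' ^+ 2 by rewrite exprn_gt0.
have i0 : 0 < (c' ^+ 2)^-1 by rewrite invr_gt0.
apply/andP; split.
  have : 0 <= 1 - c / c' by rewrite subr_ge0 ler_pdivrMr// mul1r.
  by move: i0; move: (c' ^+ 2)^-1 (c / c') => *; lra.
have i1 : (c' ^+ 2)^-1 <= (c ^+ 2)^-1.
  by rewrite lef_pV2 ?posrE// ler_pXn2r ?nnegrE// ltW.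
have i2 : 1 - c / c' <= 3^-1 * (c ^+ 2)^-1.
  have -> : 1 - c / c' = (c' - c) / c' by field; rewrite gt_eqF.
  rewrite ler_pdivrMr// mulrAC ler_pdivlMr//.
  apply: (@le_trans _ _ (3^-1 * 1)); last by rewrite ler_wpM2l.
  have e3 : (c' - c) * (c' ^+ 2 + c' * c + c ^+ 2) = 1.
    transitivity (c' ^+ 3 - c ^+ 3); first ring.
    by rewrite c3; ring.
  have d0 : 0 <= c' - c by rewrite subr_ge0.
  have m1 : c ^+ 2 <= c' ^+ 2 by rewrite ler_pXn2r ?nnegrE// ltW.
  have m2 : c ^+ 2 <= c' * c by rewrite expr2 ler_pM2r.
  have m3 : 3 * c ^+ 2 <= c' ^+ 2 + c' * c + c ^+ 2.
    by move: m1 m2; move: (c ^+ 2) (c' ^+ 2) (c' * c) => *; lra.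
  have := ler_wpM2l d0 m3; rewrite e3 mulrCA.
  by move: ((c' - c) * c ^+ 2) => *; lra.
have i3 : 0 < (c ^+ 2)^-1 by rewrite invr_gt0.
by move: i0 i1 i2 i3; move: (c' ^+ 2)^-1 (c ^+ 2)^-1 (c / c') => *; lra.
Qed.

(** beta^2 / alpha decays like k^(-4/3) k^(1/3); its sum is the logarithm in the final bound. *)
Lemma noise_le k : (al k.+1)^-1 / L ^+ 2 * be k ^+ 2 <= 128 / L * (k + k0)%:R^-1.
Proof.
have /andP[b0 b1] := beta_le k.
have -> : (al k.+1)^-1 / L ^+ 2 = 64 / L * cb (k.+1 + k0).
  by rewrite alphaE invrK; field; rewrite gt_eqF.
have b2 : be k ^+ 2 <= ((cb (k + k0) ^+ 2)^-1) ^+ 2.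
  by rewrite ler_pXn2r ?nnegrE// invr_ge0 sqr_ge0.
apply: (@le_trans _ _ (64 / L * (2 * cb (k + k0)) * ((cb (k + k0) ^+ 2)^-1) ^+ 2)).
  have h64 : 0 <= 64 / L by rewrite mulr_ge0// invr_ge0 ltW.
  apply: ler_pM => //; rewrite ?sqr_ge0//; first by rewrite mulr_ge0// cbrt_ge0.
  apply: ler_wpM2l => //; exact: c'c.
move: (c0 k) (cbrt_cube (k + k0)); move: (cb (k + k0)) => c cp <-.
by rewrite le_eqVlt; apply/orP; left; apply/eqP; field; rewrite !gt_eqF.
Qed.

(** Telescopes 1 / m <= ln m - ln (m - 1); k0 >= 2 keeps m - 1 positive. *)
Lemma sum_inv_le n : \sum_(k < n) (k + k0)%:R^-1 <= ln ((n + k0).-1%:R : R).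
Proof.
have k2 := k0_ge2.
elim: n => [|n IH].
  by rewrite big_ord0 add0n ln_ge0// ler1n -ltnS prednK// ltnW.
rewrite big_ord_recr /=; apply: le_trans (lerD IH (lexx _)) _.
have m2 : (1 < n + k0)%N by exact: leq_trans k2 (leq_addl _ _).
set m := (n + k0)%N in m2 *.
have m0 : 0 < m%:R :> R by rewrite ltr0n ltnW.
have m1 : 0 < m.-1%:R :> R by rewrite ltr0n -ltnS prednK// ltnW.
have := @le_ln1Dx R (- m%:R^-1) ; rewrite -lerBrDr.
have E : 1 - m%:R^-1 = m.-1%:R / m%:R :> R.
  have -> : m.-1%:R = m%:R - 1 :> R by rewrite -subn1 natrB// ltnW.
  by field; rewrite gt_eqF.
rewrite E ltrNl opprK invf_lt1// ltr1n => /(_ m2).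
rewrite ln_div ?posrE//; lra.
Qed.

Lemma inv_alpha0 : (al 0%N)^-1 = 64 * L * cb k0.
Proof. by rewrite alphaE invrK. Qed.

(** Here k + k0 <= 2 K, so each of the K terms is at least 1 / (128 L K^(1/3)). *)
Lemma sum_alpha_ge K : (k0 <= K)%N ->
  cb K ^+ 2 / (128 * L) <= \sum_(k < K) al k.
Proof.
move=> kK; have K0 : (0 < K)%N by rewrite (leq_trans _ kK)// ltnW// k0_ge2.
have cK := cbrt_gt0 K0.
have h (k : 'I_K) : (128 * L * cb K)^-1 <= al k.
  rewrite alphaE lef_pV2 ?posrE ?mulr_gt0//.
  apply: (@le_trans _ _ (64 * L * (2 * cb K))); last first.
    by rewrite [X in _ <= X]mulrC; rewrite le_eqVlt; apply/orP; left; apply/eqP; ring.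
  rewrite ler_pM2l ?mulr_gt0//; apply: cube_le; rewrite ?mulr_ge0 ?cbrt_ge0//.
  rewrite exprMn !cbrt_cube -natrX -natrM ler_nat.
  apply: leq_trans (leq_add (ltnW (ltn_ord k)) kK) _.
  by rewrite addnn -mul2n leq_mul2r orbT.
apply: le_trans (ler_sum _ (fun k _ => h k)).
rewrite sumr_const card_ord -[(128 * L * cb K)^-1 *+ K]mulr_natl.
move: cK (cbrt_cube K); move: (cb K) => c cp <-.
by rewrite le_eqVlt; apply/orP; left; apply/eqP; field; rewrite !gt_eqF.
Qed.

End StepSize.

(** * Complexity *)

Section Complexity.
Context (R : realType).
Local Notation cb n := (n%:R `^ 3^-1 : R).

Lemma powR32 (a : R) : 0 <= a -> a `^ (3 / 2) = Num.sqrt a ^+ 3.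
Proof.
move=> a0; rewrite -(powR12_sqrt a0) -powR_mulrn ?powR_ge0// -powRrM.
by congr (_ `^ _); rewrite mulrC.
Qed.

Lemma powR32_sqr (a : R) : 0 <= a -> (a ^+ 2) `^ (3 / 2) = a ^+ 3.
Proof. by move=> a0; rewrite powR32 ?sqr_ge0// sqrtr_sqr ger0_norm. Qed.

(** Raises the bound on K to the power 2 / 3. *)
Lemma powR32_le (c a eps : R) (K : nat) : 0 < c -> 0 <= a -> 0 < eps ->
  c ^+ 3 * (a `^ (3 / 2) / eps `^ (3 / 2)) <= K%:R -> c ^+ 2 * a <= eps * cb K ^+ 2.
Proof.
move=> c0 a0 e0; rewrite !powR32 ?(ltW e0)// => h.
have se : 0 < Num.sqrt eps by rewrite sqrtr_gt0.
have h1 : c * Num.sqrt a / Num.sqrt eps <= cb K.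
  apply: cube_le; rewrite ?cbrt_ge0//.
    by rewrite mulr_ge0 ?invr_ge0 ?sqrtr_ge0// mulr_ge0 ?sqrtr_ge0// ltW.
  by rewrite cbrt_cube !exprMn exprVn -mulrA.
rewrite ler_pdivrMr// in h1.
have h2 : (c * Num.sqrt a) ^+ 2 <= (cb K * Num.sqrt eps) ^+ 2.
  by rewrite ler_pXn2r ?nnegrE ?mulr_ge0 ?sqrtr_ge0 ?cbrt_ge0// ltW.
by move: h2; rewrite !exprMn !sqr_sqrtr ?(ltW e0)// [X in _ <= X]mulrC.
Qed.

(** ln w = 2 ln (sqrt w) <= 2 sqrt w, and sqrt w >= c. It lets ln K be absorbed by K^(2/3) / c. *)
Lemma ln_le_sqrt (c w : R) : 0 < c -> c ^+ 2 <= w -> ln w <= 2 * (w / c).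
Proof.
move=> c0 cw; have w0 : 0 < w by apply: lt_le_trans cw; rewrite exprn_gt0.
have s0 : 0 < Num.sqrt w by rewrite sqrtr_gt0.
have cs : c <= Num.sqrt w by rewrite -(ger0_norm (ltW c0)) -sqrtr_sqr ler_sqrt// ?(ltW w0).
have ww : w = Num.sqrt w ^+ 2 by rewrite sqr_sqrtr// ltW.
have h : ln w = 2 * ln (Num.sqrt w).
  by rewrite {1}ww lnXn// mulr_natl.
have h1 : ln (Num.sqrt w) <= Num.sqrt w.
  have := @le_ln1Dx R (Num.sqrt w - 1); rewrite addrCA subrr addr0 => h1.
  by apply: le_trans (h1 _) _; [rewrite ltrBrDl subrr|rewrite gerBl].
rewrite h ler_wpM2l//; apply: le_trans h1 _.
rewrite ler_pdivlMr// {2}ww expr2 ler_wpM2l// ltW//.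
Qed.

Lemma complexity_le (C1 L dl s h eps : R) (k0 K : nat) :
  0 < C1 -> 1 <= C1 -> 0 <= L -> 0 <= dl -> 0 < s -> 0 < h -> 0 < eps -> (0 < K)%N ->
  (9 * C1) ^+ 3 * complexity L dl s h eps k0 <= K%:R ->
  C1 * (L * dl + cb k0 * s ^+ 2 + h ^+ 2 * (1 + ln K%:R)) <= eps * cb K ^+ 2.
Proof.
(* The 9 counts the shares B / c spent below: one each for [L * dl], the term in [s] and [h ^+ 2],
   and six for h^2 ln K. *)
move=> C0 C1' L0 dl0 s0 h0 e0 K0; set c := 9 * C1; set Th := complexity _ _ _ _ _ _ => cT.
have c0 : 0 < c by rewrite mulr_gt0.
have c1 : 1 <= c by rewrite /c; lra.
have c30 : 0 <= c ^+ 3 by rewrite exprn_ge0// ltW.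
have ei : 0 < (eps `^ (3 / 2))^-1 by rewrite invr_gt0 powR_gt0.
have h2 : 0 <= h ^+ 2 by exact: sqr_ge0.
set g := `|ln eps| + `|ln h|.
have g0 : 0 <= g by rewrite addr_ge0.
have p1 : 0 <= (L * dl) `^ (3 / 2) by exact: powR_ge0.
have p2 : 0 <= h ^+ 3 by rewrite exprn_ge0// ltW.
have p3 : 0 <= k0%:R `^ 2^-1 * s ^+ 3 by rewrite mulr_ge0 ?powR_ge0// exprn_ge0// ltW.
have use a : 0 <= a -> a `^ (3 / 2) / eps `^ (3 / 2) <= Th -> c ^+ 2 * a <= eps * cb K ^+ 2.
  move=> a0 aT; apply: powR32_le => //; apply: le_trans cT.
  by rewrite ler_wpM2l.
have k1 : c ^+ 2 * (L * dl) <= eps * cb K ^+ 2.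
  apply: use; first by rewrite mulr_ge0.
  rewrite /Th /complexity le_max; apply/orP; left.
  by rewrite ler_pM2r// -addrA lerDl addr_ge0.
have k2 : c ^+ 2 * h ^+ 2 <= eps * cb K ^+ 2.
  apply: use => //; rewrite powR32_sqr ?(ltW h0)//.
  rewrite /Th /complexity le_max; apply/orP; left.
  by rewrite ler_pM2r// addrAC lerDr addr_ge0.
have k3 : c ^+ 2 * (cb k0 * s ^+ 2) <= eps * cb K ^+ 2.
  apply: use; first by rewrite mulr_ge0 ?powR_ge0 ?sqr_ge0.
  rewrite powRM ?powR_ge0 ?sqr_ge0// powR32_sqr ?(ltW s0)// -powRrM.
  have -> : 3^-1 * (3 / 2) = 2^-1 :> R by rewrite mulKf.
  rewrite /Th /complexity le_max; apply/orP; left.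
  by rewrite ler_pM2r// lerDr addr_ge0.
have k4 : c ^+ 2 * (h ^+ 2 * g) <= eps * cb K ^+ 2.
  apply: use; first by rewrite mulr_ge0.
  rewrite powRM// powR32_sqr ?(ltW h0)//.
  by rewrite /Th /complexity le_max lexx orbT.
set B := eps * cb K ^+ 2 in k1 k2 k3 k4 *.
have K20 : 0 < cb K ^+ 2 by rewrite exprn_gt0// cbrt_gt0.
have B0 : 0 < B by rewrite mulr_gt0.
have hh0 : 0 < h ^+ 2 by rewrite exprn_gt0.
have lw : ln (B / h ^+ 2) <= 2 * (B / h ^+ 2 / c).
  by apply: ln_le_sqrt => //; rewrite ler_pdivlMr.
have lK3 : ln K%:R = 3 * ln (cb K).
  by rewrite -{1}(cbrt_cube R K) lnXn ?cbrt_gt0// mulr_natl.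
(* K is eliminated through B = eps K^(2/3): the logarithm of B / h^2 is absorbed into B / c, and
   those of eps and h form the second branch of [complexity]. *)
have lK : ln K%:R = 3 / 2 * (ln (B / h ^+ 2) + (2 * ln h - ln eps)).
  rewrite lK3 /B lnM ?posrE ?invr_gt0// lnM ?posrE// lnV ?posrE// !lnXn ?cbrt_gt0//.
  by move: (ln (cb K)) (ln h) (ln eps) => *; field.
have lg : 2 * ln h - ln eps <= 2 * g.
  rewrite /g; have := ler_norm (ln h); have := ler_norm (- ln eps); rewrite normrN.
  have := normr_ge0 (ln eps).
  by move: (ln h) (ln eps) (`|ln h|) (`|ln eps|) => *; lra.
have hK : h ^+ 2 * ln K%:R <= 3 * (B / c) + 3 * (h ^+ 2 * g).
  have E : h ^+ 2 * (B / h ^+ 2 / c) = B / c by field; rewrite !gt_eqF.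
  move: lg lK; move: (2 * ln h - ln eps) => z lg lK.
  have m1 := ler_wpM2l h2 lw; have m2 := ler_wpM2l h2 lg.
  rewrite lK; move: m1 m2; rewrite !(mulrCA _ 2) E.
  have -> : h ^+ 2 * (3 / 2 * (ln (B / h ^+ 2) + z)) =
    3 / 2 * (h ^+ 2 * ln (B / h ^+ 2) + h ^+ 2 * z).
    by move: (ln _) => *; ring.
  by move: (h ^+ 2 * ln _) (h ^+ 2 * z) (h ^+ 2 * g) (B / c) => *; lra.
have c2c a : 0 <= a -> c ^+ 2 * a <= B -> a <= B / c.
  move=> a0 aB; rewrite ler_pdivlMr// mulrC; apply: le_trans aB.
  by rewrite ler_wpM2r// expr2 ler_peMr// ltW.
have j1 := c2c _ (mulr_ge0 L0 dl0) k1.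
have j2 := c2c _ h2 k2.
have j3 := c2c _ (mulr_ge0 (powR_ge0 _ _) (sqr_ge0 s)) k3.
have j4 := c2c _ (mulr_ge0 h2 g0) k4.
have -> : B = C1 * (9 * (B / c)) by rewrite /c; field; rewrite gt_eqF.
rewrite ler_pM2l// mulrDr mulr1.
by move: hK j1 j2 j3 j4; move: (h ^+ 2 * ln K%:R) (h ^+ 2 * g) (L * dl) (_ * s ^+ 2) (h ^+ 2)
  (B / c) => *; lra.
Qed.

End Complexity.

(** * Assembling the constants *)

Section WeightedSum.
Context (R : realType).
Local Notation cb n := (n%:R `^ 3^-1 : R).
Variables (L q s h dl eps E0 Phi e0 y0 : R) (k0 K : nat) (G : nat -> R).
Hypothesis L1 : 1 <= L.
Hypothesis q0 : 0 < q.
Hypothesis q1 : q <= 1.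
Hypothesis k0q : 2 / q ^+ 6 <= k0%:R.
Hypothesis kK : (k0 <= K)%N.
Hypotheses (s0 : 0 < s) (h0 : 0 < h) (eps0 : 0 < eps) (E00 : 0 <= E0).
Hypothesis y0E : y0 <= 4 * q ^+ 4 * E0.
Hypothesis e0E : e0 <= s ^+ 2.
Hypothesis dlE : E0 + Phi <= dl.
Hypothesis dl0 : 0 <= dl.
Local Notation al := (alpha_of L k0).
Local Notation be := (beta_of L k0).
Hypothesis Gsum : \sum_(k < K) al k * G k <= 25 *
  (6 * al 0%N * (q^-1) ^+ 3 * y0 + 8^-1 * ((al 0%N)^-1 * (L ^+ 2)^-1 * e0) + Phi
   + 26 / 100 * \sum_(k < K) (al k.+1)^-1 * (L ^+ 2)^-1 * (be k ^+ 2 * h ^+ 2)).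
Hypothesis enough : (9 * (25 * 34 * 128)) ^+ 3 * complexity L dl s h eps k0 <= K%:R.

Let L0 : 0 < L. Proof. exact: lt_le_trans L1. Qed.
Let k02 : (2 <= k0)%N. Proof. exact: k0_ge2 q0 q1 k0q. Qed.
Let K0 : (0 < K)%N. Proof. by apply: leq_trans kK; apply: leq_trans k02. Qed.

Lemma weighted_stationarity : \sum_(k < K) al k * G k <= eps * \sum_(k < K) al k.
Proof.
have sal := sum_alpha_ge L1 q0 q1 k0q kK.
have cK : 0 < cb K by exact: cbrt_gt0.
have c01 : 1 <= cb k0.
  apply: cube_le; rewrite ?cbrt_ge0// expr1n cbrt_cube ler1n; exact: leq_trans k02.
have noise : \sum_(k < K) (al k.+1)^-1 * (L ^+ 2)^-1 * (be k ^+ 2 * h ^+ 2) <=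
    128 / L * (h ^+ 2 * (1 + ln K%:R)).
  apply: (@le_trans _ _ (\sum_(k < K) 128 / L * h ^+ 2 * (k + k0)%:R^-1)).
    apply: ler_sum => k _; rewrite mulrA [X in _ <= X]mulrAC.
    by rewrite ler_wpM2r ?sqr_ge0//; exact: (noise_le L1 q0 q1 k0q).
  rewrite -mulr_sumr -mulrA; apply: ler_wpM2l; first by rewrite mulr_ge0 ?invr_ge0 ?(ltW L0).
  apply: ler_wpM2l; first exact: sqr_ge0.
  apply: le_trans (sum_inv_le q0 q1 k0q K) _.
  (* K + k0 - 1 is at most 2 K, and ln 2 is absorbed by the 1. *)
  have l2 : ln (2 : R) <= 1 by have := @le_ln1Dx R 1 (lt_trans (ltrN10 R) ltr01).
  apply: (@le_trans _ _ (ln (2 * K%:R))); last first.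
    by rewrite lnM ?posrE ?ltr0n// lerD2r.
  rewrite ler_ln ?posrE ?mulr_gt0 ?ltr0n//; last first.
    by rewrite -ltnS prednK ?(leq_trans _ (leq_add K0 k02))// addn_gt0 K0.
  rewrite -natrM ler_nat mul2n -addnn; apply: leq_trans (leq_pred _) _.
  by rewrite leq_add2l.
(* The initial rounds pay for the weight 1 / q^3: what remains is 24 times al 0 times q, at most 24
   / 64. *)
have t1 : 6 * al 0%N * q^-1 ^+ 3 * y0 <= E0.
  have a0 := alpha_gt0 L1 q0 q1 k0q 0%N.
  have aL : al 0%N <= 64^-1.
    rewrite alphaE lef_pV2 ?posrE ?mulr_gt0 ?(lt_le_trans _ c01)//.
    by rewrite -mulrA ler_peMr// mulr_ege1.
  have qV : q^-1 ^+ 3 * q ^+ 4 = q.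
    by rewrite exprVn (exprS q 3) mulrCA mulVf ?mulr1// gt_eqF// exprn_gt0.
  apply: (@le_trans _ _ (6 * al 0%N * q^-1 ^+ 3 * (4 * q ^+ 4 * E0))).
    have iq0 : 0 <= q^-1 ^+ 3 by rewrite exprn_ge0// invr_ge0 ltW.
    apply: ler_wpM2l => //; apply: mulr_ge0 => //; apply: mulr_ge0 => //; exact: ltW.
  have -> : 6 * al 0%N * q^-1 ^+ 3 * (4 * q ^+ 4 * E0) =
      24 * al 0%N * (q^-1 ^+ 3 * q ^+ 4) * E0.
    by move: (al 0%N) (q^-1 ^+ 3) (q ^+ 4) => *; ring.
  rewrite qV; apply: ler_piMl => //.
  apply: (@le_trans _ _ (24 * 64^-1 * 1)); last lra.
  apply: ler_pM => //; [apply: mulr_ge0 => //; exact: ltW|exact: ltW|].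
  by apply: ler_wpM2l.
(* The weight 1 / al 0 carries k0^(1/3), the source of k0^(1/2) sigma^3 in the complexity. *)
have t2 : 8^-1 * ((al 0%N)^-1 * (L ^+ 2)^-1 * e0) <= 8 / L * (cb k0 * s ^+ 2).
  rewrite inv_alpha0.
  have -> : 8^-1 * (64 * L * cb k0 * (L ^+ 2)^-1 * e0) = 8 / L * (cb k0 * e0).
    by field; rewrite gt_eqF.
  rewrite ler_wpM2l ?mulr_ge0 ?invr_ge0 ?(ltW L0)// ler_wpM2l//.
have ln0 : 0 <= 1 + ln K%:R :> R.
  by rewrite addr_ge0// ln_ge0// ler1n.
(* 34 exceeds 26 / 100 * 128, the constant of the noise term. *)
have main : \sum_(k < K) al k * G k <=
    25 * 34 / L * (L * dl + cb k0 * s ^+ 2 + h ^+ 2 * (1 + ln K%:R)).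
  apply: le_trans Gsum _.
  have n1 : 0 <= cb k0 * s ^+ 2 by rewrite mulr_ge0 ?cbrt_ge0 ?sqr_ge0.
  have n2 : 0 <= h ^+ 2 * (1 + ln K%:R) by rewrite mulr_ge0 ?sqr_ge0.
  move: n1 n2 noise t1 t2 dlE dl0.
  move: (6 * _ * _ * y0) (8^-1 * (_ * e0)) (\sum_(k < K) _) (cb k0 * _) (h ^+ 2 * (1 + _)).
  move=> u v w n m n0 m0 wm uE vn uP d0.
  have -> : 25 * 34 / L * (L * dl + n + m) =
      25 * (34 * dl + 34 * (L^-1 * n) + 34 * (L^-1 * m)) by field; rewrite gt_eqF.
  have i0 : 0 <= L^-1 by rewrite invr_ge0 ltW.
  move: (mulr_ge0 i0 n0) (mulr_ge0 i0 m0) wm vn.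
  rewrite -(mulrA 128) -(mulrA 8); move: (L^-1 * n) (L^-1 * m) => *.
  by rewrite ler_pM2l//; lra.
(* The factor 128 comes from [sum_alpha_ge]. *)
have C0 : 0 < 25 * 34 * 128 :> R by lra.
have C1 : 1 <= 25 * 34 * 128 :> R by lra.
have fin := complexity_le C0 C1 (ltW L0) dl0 s0 h0 eps0 K0 enough.
apply: le_trans main _.
apply: (@le_trans _ _ (eps * (cb K ^+ 2 / (128 * L)))); last by rewrite ler_pM2l.
rewrite mulrA ler_pdivlMr ?mulr_gt0//; apply: le_trans fin.
rewrite le_eqVlt; apply/orP; left; apply/eqP.
by move: (_ + _) => z; field; rewrite gt_eqF.
Qed.

End WeightedSum.

(** * Random output index *)

Section RandomIndex.
Context d (T : measurableType d) (R : realType) (P : probability T R).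
Variables (tau : T -> nat).
Hypothesis mtau : measurable_fun setT tau.

Let tau_mixin := isMeasurableFun.Build _ _ _ _ _ mtau.
Let tauM : {mfun T >-> nat} := HB.pack tau tau_mixin.
Let law : probability nat R := distribution P tauM.

Let mtau1 (B : set nat) : measurable (tau @^-1` B).
Proof. by rewrite -[X in measurable X]setTI; exact: mtau. Qed.

Let in_singleton (n k : nat) : (n \in [set k]) = (n == k).
Proof. by apply/idP/eqP; rewrite inE. Qed.

(** Freezing, with [tau] in the role of the sample. *)
Lemma integral_random_index (G : set (set T)) (k : nat) (H : T -> R) :
  <<s G>> `<=` measurable ->
  (forall F (B : set nat), <<s G>> F -> measurable B ->
     P (F `&` tau @^-1` B) = (P F * P (tau @^-1` B))%E) ->
  adapted G H -> (forall w, 0 <= H w) ->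
  (\int[P]_w ((tau w == k)%:R * H w)%:E =
   P (tau @^-1` [set k]) * \int[P]_w (H w)%:E)%E.
Proof.
move=> Gm ind aH H0.
have indl : independent_of P G tau law by move=> F B sF mB; exact: ind.
pose f (x : g_sigma_algebraType G * nat) : \bar R := (\1_[set k] x.2 * H x.1)%:E.
have mf : measurable_fun setT f.
  apply/measurable_EFinP; apply: measurable_funM.
    exact: (measurableT_comp (measurable_indic _) measurable_snd).
  exact: (measurableT_comp aH measurable_fst).
have f0 x : (0 <= f x)%E by rewrite lee_fin mulr_ge0.
have fr := freeze_ge0 Gm mtau indl mf f0.
transitivity (\int[P]_w f (w, tau w))%E.
  apply: eq_integral => w _; rewrite /f /= indicE; congr ((_ * _)%:E).
  by rewrite in_singleton.
rewrite fr -ge0_integralZl//.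
- apply: eq_integral => w _; rewrite /f /=.
  under eq_integral do rewrite mulrC EFinM.
  rewrite ge0_integralZl_EFin//.
  by rewrite integral_indic// setIT muleC.
- exact/measurable_EFinP/(adapted_measurable Gm).
- by move=> w _; rewrite lee_fin.
Qed.

(** f will be the stationarity measure at the random index, known only through a pointwise bound;
    hence a comparison of lower integrals. *)
Lemma random_index_le (K : nat) (H : nat -> T -> R) (f : T -> \bar R) :
  (\sum_(k < K) P (tau @^-1` [set nat_of_ord k]) = 1)%E ->
  (forall k w, 0 <= H k w) -> (forall k, (k < K)%N -> measurable_fun setT (H k)) ->
  (forall w, 0 <= f w)%E -> (forall w, (tau w < K)%N -> (f w <= (H (tau w) w)%:E)%E) ->
  (\int[P]_w f w <= \sum_(k < K) \int[P]_w ((tau w == k)%:R * H k w)%:E)%E.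
Proof.
move=> sum1 H0 mH f0 fH.
pose B := tau @^-1` [set n | (n < K)%N].
have mB : measurable B by exact: mtau1.
have PB : P B = 1%E.
  rewrite -sum1; have -> : B = \big[setU/set0]_(k < K) tau @^-1` [set nat_of_ord k].
    rewrite -(bigcup_mkord K (fun k => tau @^-1` [set k])).
    apply/seteqP; split => [w /= wK|w [k /= kK] tk]; first by exists (tau w).
    by rewrite /B /= tk.
  apply: measure_semi_additive_ord => [k||]; first exact: mtau1.
    by apply/trivIsetP => i j _ _ ij; apply/seteqP; split => // w [/= -> /val_inj ji];
      move: ij; rewrite ji eqxx.
  by apply: bigsetU_measurable => k _; exact: mtau1.
have PC : P (~` B) = 0%E by rewrite probability_setC// PB subee.
pose g := fun w => (\sum_(k < K) ((tau w == k)%:R * H k w)%:E)%E.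
(* The law of [tau] puts mass 1 on the indices below K; on the remaining null set f is bounded by
   +oo. *)
pose u := (cst +oo%E : T -> \bar R) \_ (~` B).
have term0 k w : (0 <= ((tau w == k)%:R * H k w)%:E)%E by rewrite lee_fin mulr_ge0.
have mterm (k : 'I_K) : measurable_fun setT (fun w => ((tau w == k)%:R * H k w)%:E).
  apply/measurable_EFinP; apply: measurable_funM; last exact: mH.
  have -> : (fun w => (tau w == k)%:R) = (\1_(tau @^-1` [set nat_of_ord k]) : T -> R).
    apply/funext => w; rewrite indicE; have := in_singleton (tau w) k.
    by move=> <-; congr (_%:R); congr (nat_of_bool _); apply/idP/idP; rewrite !inE.
  exact: measurable_indic.
have g0 w : (0 <= g w)%E by apply: sume_ge0 => k _; exact: term0.
have u0 w : (0 <= u w)%E by apply: erestrict_ge0 => x _ /=; rewrite leey.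
have mu' : measurable_fun setT u.
  by apply/(measurable_restrictT _ _).1; [exact: measurableC|exact: measurable_cst].
apply: (@le_trans _ _ (\int[P]_w (g w + u w))%E).
  apply: lower_integral_le => // w; have [wK|wK] := ltnP (tau w) K.
    apply: le_trans (fH _ wK) _; apply: (@le_trans _ _ (g w)); last exact: leeDl.
    rewrite /g (bigD1 (Ordinal wK))//= eqxx mul1r leeDl//.
    by apply: sume_ge0 => k _; exact: term0.
  rewrite /u patchE mem_set/=; last by rewrite /B /= ltnNge wK.
  by rewrite addey ?leey// gt_eqF// (lt_le_trans _ (g0 w)).
rewrite ge0_integralD//; last by exact: emeasurable_sum.
have -> : (\int[P]_x u x = 0)%E.
  by rewrite /u -integral_mkcond; apply: null_set_integral => //; exact: measurableC.
by rewrite adde0 ge0_integral_sum.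
Qed.

End RandomIndex.

(** * Convergence *)

Section Expectations.
Context d (T : measurableType d) (R : realType) (P : probability T R).
Local Notation Ex f := (\int[P]_w f w).

Lemma Ex_le_lin2 (a b : R) (f g h : T -> R) : L1 P f -> L1 P g -> L1 P h ->
  (forall w, f w <= a * g w + b * h w) -> Ex f <= a * Ex g + b * Ex h.
Proof.
move=> f1 g1 h1 fgh; rewrite -(ExZ a g1) -(ExZ b h1) -(ExD (L1Z a g1) (L1Z b h1)).
by apply: Ex_le => //; apply: L1D; exact: L1Z.
Qed.

Lemma Ex_lin3 (a b c : R) (f g h : T -> R) : L1 P f -> L1 P g -> L1 P h ->
  Ex (fun w => a * f w + b * g w + c * h w) = a * Ex f + b * Ex g + c * Ex h.
Proof.
move=> f1 g1 h1; have fg := L1D (L1Z a f1) (L1Z b g1).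
by rewrite (ExD fg (L1Z c h1)) (ExD (L1Z a f1) (L1Z b g1)) !ExZ.
Qed.

Lemma adapted_sqnorm (G : set (set T)) n p (A : T -> 'M[R]_(n, p)) :
  Madapted G A -> adapted G (fun w => sqnorm (A w)).
Proof.
move=> aA; apply: measurable_sum => i; apply: measurable_sum => j.
by apply: measurable_funX; exact: aA.
Qed.

End Expectations.

Lemma mean_le_lin2 (R : realType) (N : nat) (a b c : R) (f g h : 'I_N -> R) :
  (0 < N)%N -> (forall i, f i <= a * g i + b * h i + c) ->
  N%:R^-1 * \sum_i f i <= a * (N%:R^-1 * \sum_i g i) + b * (N%:R^-1 * \sum_i h i) + c.
Proof.
move=> N0 fgh; have NR : 0 < N%:R :> R by rewrite ltr0n.
rewrite ler_pdivrMl//; apply: le_trans (ler_sum _ (fun i _ => fgh i)) _.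
rewrite !big_split/= -!mulr_sumr sumr_const card_ord -[c *+ N]mulr_natl.
rewrite le_eqVlt; apply/orP; left; apply/eqP.
by move: (\sum_i g i) (\sum_i h i) => u v; field; rewrite gt_eqF.
Qed.

Section Network.
Context (R : realType) (N : nat) (edge : rel 'I_N) (W : 'M[R]_N).
Hypothesis hB : assumptionB edge W.

Lemma mixing_avgmx : W *m avgmx R N = avgmx R N.
Proof.
have /(W_null hB) h : exists c : R, const_mx 1 = c *: const_mx 1 :> 'cV[R]_N.
  by exists 1; rewrite scale1r.
have e : W *m const_mx 1 = const_mx 1 :> 'cV[R]_N.
  by apply/eqP; rewrite eq_sym -subr_eq0 -{1}[const_mx 1]mul1mx -mulmxBl h.
apply/matrixP => i j; rewrite mxE [RHS]mxE.
have ei : \sum_k W i k = 1.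
  have := congr1 (fun v : 'cV[R]_N => v i 0) e; rewrite mxE [RHS]mxE => ei.
  by rewrite -[RHS]ei; apply: eq_bigr => k _; rewrite mxE mulr1.
rewrite -[RHS]mul1r -[X in X * _]ei mulr_suml; apply: eq_bigr => k _.
by rewrite mxE.
Qed.

End Network.

Section Convergence.
Context (R : realType) (N p : nat) (dXi dOm : measure_display)
  (Xi : measurableType dXi) (Om : measurableType dOm) (P : probability Om R).
Variables (A : inputs R N p Xi Om) (L sigma hsigma phistar : R).
Variables (K : nat) (tau : Om -> nat) (edge : rel 'I_N).
Local Notation pb := (in_pb A).
Local Notation m := (in_m A).
Local Notation W := (in_W A).
Local Notation rt := (rhot (in_W A) (in_T A)).
Local Notation k0 := (k0_of (rhot (in_W A) (in_T A))).
Local Notation q := (1 - rhot (in_W A) (in_T A)).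
Local Notation Ex f := (\int[P]_w f w).
Local Notation lgrad i := (grad (local_obj (in_pb A) i)).
Local Notation al := (in_alpha A).
Local Notation be := (in_beta A).
Hypothesis N0 : (0 < N)%N.
Hypothesis L1' : 1 <= L.
Hypothesis wp : well_posed pb.
Hypothesis hA : assumptionA pb L sigma phistar.
Hypothesis hB : assumptionB edge W.
Hypothesis T1 : (1 <= in_T A)%N.
Hypothesis rhoT : 0 < rho_of W \/ in_T A = 1%N.
Hypothesis T0E : in_T0 A = T0_of (rho_of W) rt.
Hypothesis m_gt0 : (0 < m)%N.
Hypothesis m0E : in_m0 A = m.
Hypothesis alE : in_alpha A = alpha_of L k0.
Hypothesis beE : in_beta A = beta_of L k0.
Hypothesis X0c : forall i j, row i (in_X0 A) = row j (in_X0 A).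
Hypothesis dltoo : (delta A P phistar < +oo)%E.
Hypothesis samp : sampling P (pb_dist pb) (in_kind A) m K (in_alpha A) (in_xi A) tau.
Hypothesis hs0 : 0 < hsigma.
Hypothesis unb : est_unbiased A P K.
Hypothesis var : est_variance A P K hsigma.
Hypothesis opt : est_option A K.
Hypothesis kK : (k0 <= K)%N.

Local Notation gen := (gen A K).
Local Notation Xr k w := (stX (run A w k)).
Local Notation Dr k w := (stD (run A w k)).
Local Notation Yr k w := (stY (run A w k)).
Local Notation Zr k w := (stZ (run A w k)).

Let L0 : 0 < L. Proof. exact: lt_le_trans L1'. Qed.
Let NR : 0 < N%:R :> R. Proof. by rewrite ltr0n. Qed.
Let NV : 0 <= N%:R^-1 :> R. Proof. by rewrite invr_ge0 ltW. Qed.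
Let Wsym : W^T = W. Proof. exact: esym (W_sym hB). Qed.
Let WJ := mixing_avgmx hB.
Let Wrho := W_rho hB.
Let rt01 : 0 <= rt < 1.
Proof. by rewrite rhot_ge0 (rhot_lt1 N0 Wsym WJ Wrho T1 rhoT). Qed.
Let q0 : 0 < q. Proof. by case/andP: rt01 => _; rewrite subr_gt0. Qed.
Let q1 : q <= 1. Proof. by case/andP: rt01 => h _; rewrite gerBl. Qed.

Let k0q : 2 / q ^+ 6 <= k0%:R.
Proof.
apply: le_trans (ceil_ge _) _; rewrite /k0_of natr_absz ler_int.
exact: ler_norm.
Qed.

Let al_gt0 k : 0 < al k. Proof. by rewrite alE; exact: (alpha_gt0 L1' q0 q1 k0q). Qed.

Let x0 := avgrow (in_X0 A).

Let X0_row i : row i (in_X0 A) = x0.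
Proof.
rewrite /x0 /avgrow (eq_bigr (fun=> row i (in_X0 A))) => [|j _]; last exact: X0c.
by rewrite sumr_const card_ord -[row i _ *+ N]scaler_nat scalerA mulVf ?scale1r// gt_eqF.
Qed.

Let perp_X0 : perp (in_X0 A) = 0.
Proof. by apply/row_matrixP => i; rewrite row_perp X0_row subrr row0. Qed.

(** Otherwise phi(x0) is +oo, and so is delta, its consensus term being nonnegative. *)
Let x0dom : dom_reg (pb_reg pb) x0.
Proof.
rewrite /dom_reg /= ltey; apply/eqP => rx.
move: dltoo; rewrite /delta /phi /local_phi.
rewrite -/x0; have s : (\sum_(i < N) ((local_obj pb i x0)%:E + pb_reg pb x0) = +oo)%E.
  rewrite rx (eq_bigr (fun=> +oo%E)) => [|i _]; last by rewrite addey.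
  rewrite (bigD1 (Ordinal N0))//= addye// gt_eqF//.
  by apply: lt_le_trans (ltNyr 0) _; apply: sume_ge0 => i _; rewrite leey.
rewrite s gt0_muley ?lte_fin ?invr_gt0// addey ?addye// gt_eqF//.
by apply: lt_le_trans (ltNyr 0) _; apply: integral_ge0 => w _; rewrite lee_fin sqnorm_ge0.
Qed.

Let regk k : (k <= K)%N -> regular P A K k.
Proof. exact: (regular_le wp hA m_gt0 m0E samp al_gt0 var opt x0dom). Qed.

Let rx k w := N%:R^-1 * sqnorm (perp (Xr k w)).
Let ry k w := N%:R^-1 * sqnorm (perp (Yr k w)).
Let re k w := N%:R^-1 * \sum_i sqnorm (row i (Dr k w) - lgrad i (row i (Xr k w))).
Let rD k w := sqnorm (avgrow (Xr k.+1 w) - avgrow (Xr k w)).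
Let rS k w := N%:R^-1 * \sum_i sqnorm (row i (Xr k.+1 w) - row i (Xr k w)).
Let rd k w := N%:R^-1 * \sum_i sqnorm (row i (Dr k.+1 w) - row i (Dr k w)).

Let ML2_perp n (B : Om -> 'M[R]_(N, n)) : ML2 P B -> ML2 P (fun w => perp (B w)).
Proof. by move=> h; apply: ML2B => //; exact: ML2_mul. Qed.

Let ML2_avg n (B : Om -> 'M[R]_(N, n)) : ML2 P B -> ML2 P (fun w => avgrow (B w)).
Proof. by move=> h; apply: ML2Z; apply: ML2_sum => i; exact: ML2_row. Qed.

Let rx1 k : (k <= K)%N -> L1 P (rx k).
Proof. by move=> /regk [_ [h _ _]]; apply/L1Z/L1_sqnorm/ML2_perp. Qed.

Let ry1 k : (k <= K)%N -> L1 P (ry k).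
Proof. by move=> /regk [_ [_ _ h]]; apply/L1Z/L1_sqnorm/ML2_perp. Qed.

Let re1i k i : (k <= K)%N ->
  L1 P (fun w => sqnorm (row i (Dr k w) - lgrad i (row i (Xr k w)))).
Proof.
move=> /regk [[aX aD aY] [X2 D2 Y2]]; apply: L1_sqnorm; apply: ML2B.
  exact: ML2_row.
exact: (lgrad_ML2 hA samp i (Madapted_row i aX) (ML2_row i X2)).
Qed.

Let re1 k : (k <= K)%N -> L1 P (re k).
Proof. by move=> kK'; apply: L1Z; apply: L1_sum => i; exact: re1i. Qed.

Let rD1 k : (k < K)%N -> L1 P (rD k).
Proof.
move=> kK'; have [_ [h _ _]] := regk kK'; have [_ [h' _ _]] := regk (ltnW kK').
by apply: L1_sqnorm; apply: ML2B; exact: ML2_avg.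
Qed.

Let rS1i k i : (k < K)%N -> L1 P (fun w => sqnorm (row i (Xr k.+1 w) - row i (Xr k w))).
Proof.
move=> kK'; have [_ [h _ _]] := regk kK'; have [_ [h' _ _]] := regk (ltnW kK').
by apply: L1_sqnorm; apply: ML2B; exact: ML2_row.
Qed.

Let rS1 k : (k < K)%N -> L1 P (rS k).
Proof. by move=> kK'; apply: L1Z; apply: L1_sum => i; exact: rS1i. Qed.

Let rd1i k i : (k < K)%N -> L1 P (fun w => sqnorm (row i (Dr k.+1 w) - row i (Dr k w))).
Proof.
move=> kK'; have [_ [_ h _]] := regk kK'; have [_ [_ h' _]] := regk (ltnW kK').
by apply: L1_sqnorm; apply: ML2B; exact: ML2_row.
Qed.

Let rd1 k : (k < K)%N -> L1 P (rd k).
Proof. by move=> kK'; apply: L1Z; apply: L1_sum => i; exact: rd1i. Qed.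

Let avgZ k w : avgrow (Zr k w) = avgrow (Xr k w).
Proof. by rewrite run_Z (avgrow_cheb N0 Wsym WJ Wrho rhoT). Qed.

Let perpZ k w : sqnorm (perp (Zr k w)) <= rt ^+ 2 * sqnorm (perp (Xr k w)).
Proof. by rewrite run_Z; exact: (sqnorm_perp_cheb N0 Wsym WJ Wrho rhoT). Qed.

Let track k w : avgrow (Yr k w) = avgrow (Dr k w).
Proof.
elim: k => [|k IH].
  by rewrite /= T0E (avgrow_cheb0 N0 Wsym WJ Wrho rhoT).
rewrite run_Y (avgrow_cheb N0 Wsym WJ Wrho rhoT) avgrowB avgrowD IH.
by rewrite addrAC subrr add0r.
Qed.

Let stepX k w i : row i (Xr k.+1 w) =
  prox (scale_fun (al k) (pb_reg pb)) (row i (Zr k w) - al k *: row i (Yr k w)).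
Proof. exact: run_X. Qed.

Let domX k w : dom_reg (pb_reg pb) (avgrow (Xr k w)).
Proof.
elim: k => [|k IH]; first exact: x0dom.
exact: (next_domX N0 hA (al_gt0 k) IH (stepX k w)).
Qed.

Let stepx k : (k < K)%N ->
  Ex (rx k.+1) <= (1 - q) * Ex (rx k) + q^-1 * (al k ^+ 2 * Ex (ry k)).
Proof.
move=> kK'; rewrite subKr (mulrA q^-1); apply: Ex_le_lin2.
- exact: rx1.
- exact/rx1/ltnW.
- exact/ry1/ltnW.
move=> w; have := sqnorm_perp_prox_step N0 hA rt01 (al_gt0 k) (domX k w) (perpZ k w)
  (stepX k w).
move=> /(ler_wpM2l NV); rewrite mulrDr /rx /ry; move/le_trans; apply.
rewrite le_eqVlt; apply/orP; left; apply/eqP.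
by move: (sqnorm _) (sqnorm _) (q^-1) (N%:R^-1) => *; ring.
Qed.

Let rdE k w : rd k w = N%:R^-1 * sqnorm (Dr k.+1 w - Dr k w).
Proof.
by rewrite /rd sqnorm_rows; congr (_ * _); apply: eq_bigr => i _; rewrite linearB.
Qed.

Let rSE k w : rS k w = N%:R^-1 * sqnorm (Xr k.+1 w - Xr k w).
Proof.
by rewrite /rS sqnorm_rows; congr (_ * _); apply: eq_bigr => i _; rewrite linearB.
Qed.

Let stepy k : (k < K)%N -> Ex (ry k.+1) <= (1 - q) * Ex (ry k) + q^-1 * Ex (rd k).
Proof.
move=> kK'; rewrite subKr; apply: Ex_le_lin2.
- exact: ry1.
- exact/ry1/ltnW.
- exact: rd1.
move=> w; have cY := sqnorm_perp_cheb N0 Wsym WJ Wrho rhoT (Yr k w + Dr k.+1 w - Dr k w).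
rewrite -run_Y in cY.
have := sqnorm_perp_tracking N0 rt01 cY.
move=> /(ler_wpM2l NV); rewrite mulrDr rdE /ry; move/le_trans; apply.
rewrite le_eqVlt; apply/orP; left; apply/eqP.
by move: (sqnorm _) (sqnorm _) (q^-1) (N%:R^-1) => *; ring.
Qed.

Let stepS k : (k < K)%N -> Ex (rS k) <= Ex (rD k) + 2 * Ex (rx k.+1) + 2 * Ex (rx k).
Proof.
move=> kK'; have x1 := rx1 (ltnW kK'); have x1' := rx1 kK'; have D1 := rD1 kK'.
rewrite -(ExZ 2 x1) -(ExZ 2 x1') -(ExD D1 (L1Z 2 x1')) -ExD; last exact: L1Z.
  apply: Ex_le; [exact: rS1|by apply: L1D; [apply: L1D => //; exact: L1Z|exact: L1Z]|].
  move=> w; rewrite rSE /rD /rx ler_pdivrMl//.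
  apply: le_trans (sqnorm_increment N0 _ _) _.
  rewrite le_eqVlt; apply/orP; left; apply/eqP.
  by move: (sqnorm _) (sqnorm _) (sqnorm _) => *; field; rewrite gt_eqF.
by apply: L1D => //; exact: L1Z.
Qed.

Let ExM (f : 'I_N -> Om -> R) : (forall i, L1 P (f i)) ->
  Ex (fun w => N%:R^-1 * \sum_i f i w) = N%:R^-1 * \sum_i Ex (f i).
Proof. by move=> f1; rewrite ExZ; [rewrite Ex_sum|exact: L1_sum]. Qed.

Let be01 k : 0 <= be k <= 1.
Proof.
rewrite beE; have /andP[-> h] := beta_le L1' q0 q1 k0q k.
apply: le_trans h _; have n0 : (0 < k + k0)%N.
  by rewrite addn_gt0 (leq_trans _ (k0_ge2 q0 q1 k0q)) ?orbT.
rewrite invf_le1 ?exprn_gt0 ?cbrt_gt0// exprn_ege1//.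
by apply: cube_le; rewrite ?cbrt_ge0// expr1n cbrt_cube ler1n.
Qed.

Let reM k : (k <= K)%N -> Ex (re k) =
  N%:R^-1 * \sum_i Ex (fun w => sqnorm (row i (Dr k w) - lgrad i (row i (Xr k w)))).
Proof. by move=> kK'; exact: (ExM (fun i => re1i i kK')). Qed.

Let rSM k : (k < K)%N -> Ex (rS k) =
  N%:R^-1 * \sum_i Ex (fun w => sqnorm (row i (Xr k.+1 w) - row i (Xr k w))).
Proof. by move=> kK'; exact: (ExM (fun i => rS1i i kK')). Qed.

Let rdM k : (k < K)%N -> Ex (rd k) =
  N%:R^-1 * \sum_i Ex (fun w => sqnorm (row i (Dr k.+1 w) - row i (Dr k w))).
Proof. by move=> kK'; exact: (ExM (fun i => rd1i i kK')). Qed.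

Let stepe k : (k < K)%N -> Ex (re k.+1) <= (1 - be k) ^+ 2 * Ex (re k)
  + 2 * (1 - be k) ^+ 2 * (L ^+ 2 * Ex (rS k)) + 2 * be k ^+ 2 * hsigma ^+ 2.
Proof.
move=> kK'; rewrite (mulrA _ (L ^+ 2)).
rewrite [leLHS](reM kK') [X in _ * X + _ + _](reM (ltnW kK')).
rewrite [X in _ + _ * X + _](rSM kK'); apply: mean_le_lin2 => // i.
have := error_step wp hA m_gt0 samp al_gt0 unb var opt x0dom kK' (regk (ltnW kK')) i.
by rewrite (mulrA _ (L ^+ 2)).
Qed.

Let stepd k : (k < K)%N -> Ex (rd k) <=
  4 * (L ^+ 2 * Ex (rS k) + be k ^+ 2 * hsigma ^+ 2 + be k ^+ 2 * Ex (re k)).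
Proof.
move=> kK'.
have E s b e : 4 * (L ^+ 2 * s + be k ^+ 2 * b + be k ^+ 2 * e) =
   4 * L ^+ 2 * s + 4 * be k ^+ 2 * e + 4 * be k ^+ 2 * b by ring.
rewrite E.
rewrite (rdM kK') (reM (ltnW kK')) (rSM kK').
apply: mean_le_lin2 => // i; rewrite -E.
exact: (increment_step wp hA m_gt0 samp al_gt0 var opt x0dom kK' (regk (ltnW kK')) i
  (be01 k)).
Qed.

Let gap := obj pb x0 - phistar.

(** Kept pathwise: phi(xbar) is eliminated through phistar before expectations are taken, and only
    the error terms are integrated. *)
Let descent_path n w : obj pb (avgrow (Xr n w)) +
  \sum_(k < n) (3 / 4 * (al k)^-1 - L / 2) * rD k w <= obj pb x0 +
  \sum_(k < n) (2^-1 * ((al k)^-1 * rx k w) + 2^-1 * (al k * ry k w)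
     + 2 * (al k * L ^+ 2 * rx k w) + 2 * (al k * re k w)).
Proof.
elim: n => [|n IH]; first by rewrite !big_ord0 !addr0.
rewrite !big_ord_recr/=.
have := obj_step N0 wp hA (lgrad_lip hA) rt01 (al_gt0 n) (domX n w) (avgZ n w)
  (perpZ n w) (track n w) (stepX n w) (ltW L0).
move: IH; rewrite -/(rx n w) -/(ry n w) -/(re n w) -/(rD n w).
move: (obj _ _) (obj _ _) (obj _ _) (\sum_(i < n) _) (\sum_(i < n) _) (_ * rD n w).
move=> u1 u2 u3 v1 v2 v3.
move: (2^-1 * _) (2^-1 * _) (2 * _) (2 * _) => *; lra.
Qed.

Let descent_sum : \sum_(k < K) (3 / 4 * (al k)^-1 - L / 2) * Ex (rD k) <= gap +
  \sum_(k < K) (2^-1 * ((al k)^-1 * Ex (rx k)) + 2^-1 * (al k * Ex (ry k))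
     + 2 * (al k * L ^+ 2 * Ex (rx k)) + 2 * (al k * Ex (re k))).
Proof.
pose c (k : 'I_K) := 3 / 4 * (al k)^-1 - L / 2.
pose a1 (k : 'I_K) := 2^-1 * (al k)^-1 + 2 * (al k * L ^+ 2).
pose F (k : 'I_K) w := a1 k * rx k w + 2^-1 * al k * ry k w + 2 * al k * re k w.
have lx (k : 'I_K) := rx1 (ltnW (ltn_ord k)).
have ly (k : 'I_K) := ry1 (ltnW (ltn_ord k)).
have le (k : 'I_K) := re1 (ltnW (ltn_ord k)).
have lD (k : 'I_K) := L1Z (c k) (rD1 (ltn_ord k)).
have F1 k : L1 P (F k) by apply: L1D; [apply: L1D|]; exact: L1Z.
have FE k : Ex (F k) = 2^-1 * ((al k)^-1 * Ex (rx k)) + 2^-1 * (al k * Ex (ry k))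
     + 2 * (al k * L ^+ 2 * Ex (rx k)) + 2 * (al k * Ex (re k)).
  rewrite (Ex_lin3 _ _ _ (lx k) (ly k) (le k)) /a1.
  by move: (Ex (rx k)) (Ex (ry k)) (Ex (re k)) (al k)^-1 => *; ring.
have FE' k w : F k w = 2^-1 * ((al k)^-1 * rx k w) + 2^-1 * (al k * ry k w)
     + 2 * (al k * L ^+ 2 * rx k w) + 2 * (al k * re k w).
  by rewrite /F /a1; move: (rx k w) (ry k w) (re k w) (al k)^-1 => *; ring.
have -> : \sum_(k < K) (3 / 4 * (al k)^-1 - L / 2) * Ex (rD k) =
    Ex (fun w => \sum_(k < K) c k * rD k w).
  by rewrite (Ex_sum (P := P))//; apply: eq_bigr => k _; rewrite (ExZ _ (rD1 (ltn_ord k))).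
rewrite -(eq_bigr _ (fun k _ => FE k)) -(Ex_sum (P := P))// -(Ex_cst P gap).
rewrite -ExD; [|exact: L1_cst|exact: L1_sum].
apply: Ex_le; [exact: L1_sum|by apply: L1D; [exact: L1_cst|exact: L1_sum]|].
move=> w; have := descent_path K w; rewrite -(eq_bigr _ (fun k _ => FE' k w)) /gap.
have : phistar <= obj pb (avgrow (Xr K w)).
  by rewrite -lee_fin -(phiE N0 hA (domX K w)); exact: (phistar_le hA).
move: (obj _ _) (obj _ _) (\sum_k _) (\sum_k _) => *; lra.
Qed.

Let dltE : delta A P phistar = (Ex (fun w => sqnorm (perp (Dr 0%N w))) + gap)%:E.
Proof.
have [_ [_ D2 _]] := regk (leq0n K).
have l1 : L1 P (fun w => sqnorm (perp (stD (init A w)))).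
  by apply: L1_sqnorm; exact: ML2_perp.
have aux (a b c : R) : (a%:E + b%:E - c%:E = (a + (b - c))%:E)%E by rewrite addrA.
by rewrite /delta (phiE N0 hA x0dom) (ExE l1) aux.
Qed.

Let gap0 : 0 <= gap.
Proof. by rewrite subr_ge0 -lee_fin -(phiE N0 hA x0dom); exact: (phistar_le hA). Qed.

(** Majorant of the stationarity measure up to 12 / al. It involves X^(k+1), still determined by the
    samples up to k, so [tau] is independent of it. *)
Let H k w := (al k)^-1 * rx k w + al k / q ^+ 2 * ry k w + al k * re k w
  + (al k)^-1 * rD k w.

Let rx0 k w : 0 <= rx k w. Proof. by rewrite mulr_ge0// sqnorm_ge0. Qed.
Let ry0 k w : 0 <= ry k w. Proof. by rewrite mulr_ge0// sqnorm_ge0. Qed.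
Let re0 k w : 0 <= re k w.
Proof. by rewrite mulr_ge0// sumr_ge0// => i _; exact: sqnorm_ge0. Qed.
Let rD0 k w : 0 <= rD k w. Proof. exact: sqnorm_ge0. Qed.
Let rS0 k w : 0 <= rS k w.
Proof. by rewrite mulr_ge0// sumr_ge0// => i _; exact: sqnorm_ge0. Qed.

Let H0 k w : 0 <= H k w.
Proof.
have a0 := ltW (al_gt0 k); have i0 : 0 <= (al k)^-1 by rewrite invr_ge0.
by rewrite !addr_ge0// mulr_ge0// mulr_ge0// invr_ge0 sqr_ge0.
Qed.

Let H1 k : (k < K)%N -> L1 P (H k).
Proof.
move=> kK'; have kK2 := ltnW kK'.
by apply: L1D; [apply: L1D; [apply: L1D|]|]; apply: L1Z;
  [exact: rx1|exact: ry1|exact: re1|exact: rD1].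
Qed.

Let ExH k : (k < K)%N -> Ex (H k) = (al k)^-1 * Ex (rx k) + al k / q ^+ 2 * Ex (ry k)
  + al k * Ex (re k) + (al k)^-1 * Ex (rD k).
Proof.
move=> kK'; have kK2 := ltnW kK'.
have x1 := L1Z (al k)^-1 (rx1 kK2); have y1 := L1Z (al k / q ^+ 2) (ry1 kK2).
have e1 := L1Z (al k) (re1 kK2); have D1 := L1Z (al k)^-1 (rD1 kK').
have xy := L1D x1 y1; have xye := L1D xy e1.
rewrite /H (ExD xye D1) (ExD xy e1) (ExD x1 y1).
by rewrite (ExZ _ (rx1 kK2)) (ExZ _ (ry1 kK2)) (ExZ _ (re1 kK2)) (ExZ _ (rD1 kK')).
Qed.

Let Ha k : (k < K)%N -> adapted (gen k) (H k).
Proof.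
move=> kK'; have [[aX aD aY] _] := regk (ltnW kK').
have aX' := next_X_adapted hA al_gt0 x0dom (regk (ltnW kK')).
have aperp n (B : Om -> 'M[R]_(N, n)) : Madapted (gen k) B ->
    Madapted (gen k) (fun w => perp (B w)).
  by move=> h; apply: MadaptedB => //; exact: Madapted_mul.
have aavg n (B : Om -> 'M[R]_(N, n)) : Madapted (gen k) B ->
    Madapted (gen k) (fun w => avgrow (B w)).
  by move=> h; apply: MadaptedZ; apply: Madapted_sum => i; exact: Madapted_row.
apply: adaptedD; [apply: adaptedD; [apply: adaptedD|]|]; apply: adaptedZ.
- by apply: adaptedZ; apply: adapted_sqnorm; exact: aperp.
- by apply: adaptedZ; apply: adapted_sqnorm; exact: aperp.
- apply: adaptedZ; apply: adapted_sum => i; apply: adapted_sqnorm.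
  apply: MadaptedB; first exact: Madapted_row.
  by apply: (lgrad_adapted hA); exact: Madapted_row.
- by apply: adapted_sqnorm; apply: MadaptedB; exact: aavg.
Qed.

Let stat_le k w (eta : R) : al k <= eta ->
  stationarity pb L (Zr k w) eta <= 12 / al k * H k w.
Proof.
move=> ae; apply: (@le_trans _ _ (stationarity pb L (Zr k w) (al k))).
  apply: lerD; last exact: lexx.
  apply: ler_wpM2l; first exact: NV.
  apply: ler_sum => i _.
  exact: (prox_grad_map_mono (reg_gtNy hA) (reg_convex hA) (reg_prox hA) x0dom).
have aL : al k * L <= 64^-1.
  have h : (al k * L) ^+ 2 <= (64^-1) ^+ 2.
    rewrite alE; apply: le_trans (alpha_L L1' q0 q1 k0q k) _.
    have : q ^+ 4 <= 1 by rewrite exprn_ile1// ltW.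
    by move: (q ^+ 4) => z ?; lra.
  by move: h; rewrite ler_pXn2r// nnegrE ?invr_ge0// mulr_ge0// ltW.
have st := stationarity_step N0 wp hA (lgrad_lip hA) rt01 (al_gt0 k) (domX k w)
  (avgZ k w) (perpZ k w) (track k w) (stepX k w) (ltW L0) aL.
by rewrite mulrAC ler_pdivlMr// mulrC.
Qed.

Lemma offset_gt0 : (0 < k0)%N.
Proof. exact: leq_trans (k0_ge2 q0 q1 k0q). Qed.

Lemma step_size_gt0 k : 0 < al k.
Proof. exact: al_gt0. Qed.

Lemma step_size_le0 k : al k <= al 0%N.
Proof. by rewrite alE; exact: (alpha_le0 L1' q0 q1 k0q). Qed.

Variable eps : R.
Hypothesis eps0 : 0 < eps.
Hypothesis enough : (9 * (25 * 34 * 128)) ^+ 3 *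
  complexity L (fine (delta A P phistar)) sigma hsigma eps k0 <= K%:R.

Let weighted : \sum_(k < K) al k * (12 / al k * Ex (H k)) <= eps * \sum_(k < K) al k.
Proof.
pose E0 := Ex (fun w => sqnorm (perp (Dr 0%N w))).
have E00 : 0 <= E0 by apply: Ex_ge0 => w; exact: sqnorm_ge0.
have dlf : fine (delta A P phistar) = E0 + gap by rewrite dltE.
have [_ [_ D2 _]] := regk (leq0n K).
have y0E : Ex (ry 0%N) <= 4 * q ^+ 4 * E0.
  rewrite -ExZ; last by apply: L1_sqnorm; exact: ML2_perp.
  apply: Ex_le; [exact: ry1|by apply: L1Z; apply: L1_sqnorm; exact: ML2_perp|].
  (* The factor 1 / N is dropped: delta contains the unnormalized consensus error. *)
  move=> w; rewrite /ry; apply: (@le_trans _ _ (1 * sqnorm (perp (Yr 0%N w)))).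
    by rewrite ler_wpM2r ?sqnorm_ge0// invf_le1// ler1n.
  rewrite mul1r /= T0E.
  exact: (sqnorm_perp_cheb0 N0 Wsym WJ Wrho T1 rhoT).
have e0E : Ex (re 0%N) <= sigma ^+ 2.
  rewrite (reM (leq0n K)) ler_pdivrMl//.
  apply: le_trans (ler_sum _ (fun i _ => init_error_le wp hA m_gt0 m0E samp i)) _.
  by rewrite sumr_const card_ord -[leLHS]mulr_natl.
(* Identical initial rows remove the x-term from the initial Lyapunov value. *)
have x00 : Ex (rx 0%N) = 0.
  rewrite -[RHS](Ex_cst P 0); apply: eq_Rintegral => w _.
  by rewrite /rx /= perp_X0 sqnorm0 mulr0.
have al_dec k : al k.+1 <= al k by rewrite alE; exact: (alpha_noninc L1' q0 q1 k0q).
have alLq k : (al k * L) ^+ 2 <= q ^+ 4 / 4096.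
  by rewrite alE; exact: (alpha_L L1' q0 q1 k0q).
have al_slow k : al k <= al k.+1 * (1 + q ^+ 6 / 6).
  by rewrite alE; exact: (alpha_slow L1' q0 q1 k0q).
have bE k : be k = 1 - al k.+1 / al k + 48 * L ^+ 2 * al k.+1 ^+ 2.
  by rewrite beE alE.
have ws := weighted_stationarity L1' q0 q1 k0q kK (sigma_gt0 hA) hs0 eps0 E00 y0E e0E
  (Phi := gap) (dl := fine (delta A P phistar)) (G := fun k => 12 / al k * Ex (H k)).
rewrite -alE -beE in ws; apply: ws => //.
- by rewrite dlf.
- by rewrite dlf addr_ge0.
have -> : \sum_(k < K) al k * (12 / al k * Ex (H k)) =
    12 * \sum_(k < K) ((al k)^-1 * Ex (rx k) + al k / q ^+ 2 * Ex (ry k)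
      + al k * Ex (re k) + (al k)^-1 * Ex (rD k)).
  rewrite mulr_sumr; apply: eq_bigr => k _; rewrite (ExH (ltn_ord k)).
  by rewrite mulrA mulrCA mulfV ?mulr1// gt_eqF.
have ly := lyapunov_sum q0 q1 L0 (sqr_ge0 hsigma) al_gt0 al_dec alLq al_slow bE
  (fun k => Ex_ge0 P (rx0 k)) (fun k => Ex_ge0 P (ry0 k)) (fun k => Ex_ge0 P (re0 k))
  (fun k => Ex_ge0 P (rS0 k)) (fun k => Ex_ge0 P (rD0 k)) stepx stepy stepd stepe stepS
  descent_sum.
(* Origin of the 25: 12 * 100 / 48. *)
have aux (s t : R) : 48 / 100 * s <= t -> 12 * s <= 25 * t by move=> ?; lra.
by apply: aux; move: ly; rewrite x00 mulr0 add0r.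
Qed.

(** The law of [tau], proportional to al k, turns the expectation at the random index into the
    weighted sum divided by the sum of the al k. *)
Lemma random_output_stationary (eta : Om -> R) :
  (forall w, 0 < eta w) -> (forall w, (tau w < K)%N -> al (tau w) <= eta w) ->
  stochastic_stationary P pb L eps (fun w => Zr (tau w) w) eta.
Proof.
move=> eta0 ale; split=> //.
have K0 : (0 < K)%N.
  by apply: leq_trans kK; apply: leq_trans (k0_ge2 q0 q1 k0q).
pose sal := \sum_(k < K) al k.
have sal0 : 0 < sal.
  rewrite /sal (bigD1 (Ordinal K0))//=; apply: ltr_wpDr => //.
  by apply: sumr_ge0 => k _; exact: ltW.
have st0 w : 0 <= stationarity pb L (Zr (tau w) w) (eta w).
  apply: addr_ge0; first by rewrite mulr_ge0// sumr_ge0// => i _; exact: sqnorm_ge0.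
  by rewrite mulr_ge0 ?sqnorm_ge0// mulr_ge0// sqr_ge0.
pose G k w := 12 / al k * H k w.
have G0 k w : 0 <= G k w.
  by rewrite /G mulr_ge0// mulr_ge0// invr_ge0 ltW.
have mtau := tau_measurable samp.
have Ga k : (k < K)%N -> adapted (gen k) (G k) by move=> kK'; apply: adaptedZ; exact: Ha.
have GE k : (k < K)%N -> (\int[P]_w ((tau w == k)%:R * G k w)%:E =
    (al k / sal * (12 / al k * Ex (H k)))%:E)%E.
  move=> kK'; have Gm : <<s gen k>> `<=` measurable by exact: (gen_measurable samp).
  rewrite (integral_random_index mtau k Gm)//.
  - by rewrite (tau_law samp)// EFinM ExE ?ExZ//; [exact: H1|apply: L1Z; exact: H1].
  - exact: (tau_independent samp).
  - exact: Ga.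
apply: le_trans (@random_index_le _ _ _ P tau mtau K G _ _ G0 _ _ _) _.
- under eq_bigr => k _ do rewrite (tau_law samp (ltn_ord k)).
  by rewrite sumEFin -mulr_suml mulfV// gt_eqF.
- move=> k kK'; apply: adapted_measurable (Ga _ kK').
  exact: (gen_measurable samp).
- by move=> w; rewrite lee_fin.
- by move=> w wK; rewrite lee_fin; apply: stat_le; exact: ale.
under eq_bigr => k _ do rewrite (GE _ (ltn_ord k)).
rewrite sumEFin lee_fin.
have -> : \sum_(k < K) al k / sal * (12 / al k * Ex (H k)) =
    (\sum_(k < K) al k * (12 / al k * Ex (H k))) / sal.
  by rewrite mulr_suml; apply: eq_bigr => k _; rewrite mulrAC.
by rewrite ler_pdivrMr//; exact: weighted.
Qed.

End Convergence.

Lemma complexity_ge0 (R : realType) (L dl s h eps : R) (k0 : nat) : 0 <= h ->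
  0 <= complexity L dl s h eps k0.
Proof.
move=> h0; rewrite /complexity le_max; apply/orP; right.
by rewrite mulr_ge0 ?invr_ge0 ?powR_ge0// mulr_ge0 ?powR_ge0// exprn_ge0.
Qed.

Section Costs.
Context (R : realType) (N p : nat) (dXi dOm : measure_display)
  (Xi : measurableType dXi) (Om : measurableType dOm).
Variable A : inputs R N p Xi Om.

Lemma rounds_run w k : st_rounds (run A w k) = (in_T0 A + in_T A * k)%N.
Proof.
elim: k => [|k IH]; first by rewrite muln0 addn0.
by rewrite /= IH mulnS addnAC addnA.
Qed.

Lemma grads_run w k : (st_grads (run A w k) <= in_m0 A + 3 * in_m A * k)%N.
Proof.
elim: k => [|k IH]; first by rewrite muln0 addn0.
rewrite /= mulnS addnCA [leqRHS]addnC -addnA leq_add//.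
by case: in_kind; rewrite ?addn0 ?leq_mul2r ?orbT// -mulSnr.
Qed.

End Costs.

Theorem corollary2 (R : realType) (M : nat) :
  exists C : R, 0 < C /\
  forall (N p : nat) (dXi dOm : measure_display)
    (Xi : measurableType dXi) (Om : measurableType dOm)
    (P : probability Om R) (pb : problem R N p Xi)
    (L sigma hsigma phistar eps : R)
    (edge : rel 'I_N) (W : 'M[R]_N)
    (m T K : nat) (X0 : 'M[R]_(N, p))
    (xi : sample_idx N -> Om -> Xi) (kind : estimator_kind)
    (vt : nat -> 'I_N -> Om -> 'rV[R]_p) (tau : Om -> nat),
  let rho := rho_of W in
  let k0 := k0_of (rhot W T) in
  let alpha := alpha_of L k0 in
  let A := {| in_pb := pb ; in_W := W ;
              in_T0 := T0_of rho (rhot W T) ; in_T := T ;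
              in_m0 := m ; in_m := m ;
              in_alpha := alpha ; in_beta := beta_of L k0 ;
              in_X0 := X0 ; in_xi := xi ; in_kind := kind ; in_vt := vt |} in
  let dlt := delta A P phistar in
  let Theta := complexity L (fine dlt) sigma hsigma eps k0 in
  let Zout := fun w => stZ (run A w (tau w)) in
  (0 < N)%N -> 0 < eps -> 1 <= L ->
  well_posed pb -> assumptionA pb L sigma phistar ->
  assumptionB edge W ->
  (1 <= T)%N ->
  (* the Chebyshev recursion of length T >= 2 divides by rho *)
  (0 < rho \/ T = 1%N) ->
  (1 <= m <= M)%N ->
  (forall i j, row i X0 = row j X0) ->
  (* delta < +oo, i.e. the common initial row lies in the domain of r *)
  (dlt < +oo)%E ->
  sampling P (pb_dist pb) kind m K alpha xi tau ->
  0 < hsigma ->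
  est_unbiased A P K -> est_variance A P K hsigma -> est_option A K ->
  (2 : R) `^ (3 / 2) * k0%:R <= K%:R ->
  C * Theta <= K%:R ->
  [/\ stochastic_stationary P pb L eps Zout (fun w => alpha (tau w)),
      (forall eta : R, alpha 0%N <= eta ->
         stochastic_stationary P pb L eps Zout (fun=> eta)),
      (forall w, (st_grads (run A w K.-1))%:R <= C * K%:R) &
      (forall w, st_rounds (run A w K.-1)
         = (T0_of rho (rhot W T) + T * (K - 1))%N)].
Proof.
pose c : R := (9 * (25 * 34 * 128)) ^+ 3.
have c0 : 0 < c by rewrite exprn_gt0//; lra.
(* [c] governs the accuracy, and 3 M the number of sample gradients per iteration. *)
exists (c + 3 * M%:R); split; first by rewrite ltr_pwDl// mulr_ge0.
move=> N p dXi dOm Xi Om P pb L sigma hsigma phistar eps edge W m T K X0 xi kind vt tau.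
move=> rho k0 alpha A dlt Theta Zout N0 eps0 L1 wp hA hB T1 rhoT /andP[m0 mM] X0c.
move=> dltoo samp hs0 unb var opt kK cK.
have Th0 : 0 <= Theta by apply: complexity_ge0; exact: ltW.
have enough : c * Theta <= K%:R.
  by apply: le_trans cK; rewrite ler_wpM2r// lerDl mulr_ge0.
have k0K : (k0 <= K)%N.
  rewrite -(ler_nat R); apply: le_trans kK; apply: ler_peMl => //.
  by rewrite -[leLHS](powRr0 2) ler_powR ?ler1n// divr_ge0.
have al0 : forall k, 0 < alpha k.
  exact: (@step_size_gt0 R N p dXi dOm Xi Om A L edge N0 L1 hB T1 rhoT (erefl alpha)).
have ale : forall k, alpha k <= alpha 0%N.
  exact: (@step_size_le0 R N p dXi dOm Xi Om A L edge N0 L1 hB T1 rhoT (erefl alpha)).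
have out := @random_output_stationary R N p dXi dOm Xi Om P A L sigma hsigma phistar K tau
  edge N0 L1 wp hA hB T1 rhoT erefl m0 erefl erefl erefl X0c dltoo samp hs0 unb var opt
  k0K eps eps0 enough.
split.
- by apply: out => w.
- move=> eta ae; apply: out => w; first exact: lt_le_trans ae.
  by move=> _; apply: le_trans ae.
- move=> w; have K0 : (0 < K)%N.
    by apply: leq_trans k0K; exact: (@offset_gt0 R N p dXi dOm Xi Om A edge N0 hB T1 rhoT).
  have gK : (st_grads (run A w K.-1) <= 3 * M * K)%N.
    apply: leq_trans (grads_run _ _ _) _; rewrite /=.
    apply: (@leq_trans (3 * m * K)); last by rewrite leq_mul2r leq_mul2l mM !orbT.
    (* The initial batch is charged as one of the K iterations. *)
    rewrite -[X in (_ <= _ * X)%N](prednK K0) mulnS leq_add2r.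
    by rewrite leq_pmull.
  apply: (@le_trans _ _ (3 * M%:R * K%:R)).
    by rewrite -!natrM ler_nat.
  by rewrite ler_wpM2r// lerDr ltW.
- by move=> w; rewrite rounds_run subn1.
Qed.
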